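(* Let $k\ge0$, let $f$ be a smooth function on the real twistor quadric $Q$, homogeneous of degree $-k-4$, and let $$F(x)_{A_1\dots A_k}=\int_{S_x}\mathrm D^3\pi\;\pi_{A_1}\cdots\pi_{A_k}\,f(x^{AB}\pi_B,\pi_A)$$ be the corresponding massless field on split-signature space-time, with Fourier transform $\widetilde F(\lambda^a)_{a_1\dots a_k}$ on the momentum light cone. Then $$\widetilde F(\lambda^a)_{a_1\dots a_k}=\int_{\mathbb{RP}^1}\mathrm Du\;u_{a_1}\cdots u_{a_k}\int d^4\omega\;\delta(\omega^A\lambda_A)\,f(\omega^A,\lambda_A)\,e^{-i\widehat\lambda_A\omega^A},$$ where $u_a$ are homogeneous coordinates on $\mathbb{RP}^1$, $\lambda_A=\lambda^a_Au_a$, and $\widehat\lambda_A$ is any spinor chosen so that $\lambda_{[A}\widehat\lambda_{B]}=P_{AB}$.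
   Context: Everything is real, in split signature. **Twistor space.** $\mathbb R^8$ has coordinates $(\omega^A,\pi_A)$, $A=0,\dots,3$, and $Q=\{[\omega,\pi]\in\mathbb{RP}^7:\omega^A\pi_A=0\}$. A function of weight (homogeneity) $n$ on $Q$ is a function $f$ on the cone $\{\omega^A\pi_A=0\}\setminus\{0\}$ with $f(t\omega,t\pi)=t^nf(\omega,\pi)$. **Space-time.** Space-time is $\mathbb R^6$ with coordinates $x^{AB}=x^{[AB]}$ and metric $\tfrac12\varepsilon_{ABCD}dx^{AB}dx^{CD}$ of signature $(3,3)$. Skew pairs of indices are lowered by $v_{AB}=\tfrac12\varepsilon_{ABCD}v^{CD}$. $S_x=\{\omega^A=x^{AB}\pi_B\}\cong\mathbb{RP}^3\subset Q$, and $\mathrm D^3\pi=\varepsilon^{ABCD}\pi_A\,d\pi_B\,d\pi_C\,d\pi_D$. The field $F$ is symmetric and satisfies $\nabla^{BA_1}F_{A_1\dots A_k}=0$ for $k>0$ (the wave equation for $k=0$), where $\nabla_{AB}=\partial/\partial x^{AB}$. **Fourier transform.** Put $\widetilde F(P)_{A_1\dots A_k}=\int d^6x\,F(x)_{A_1\dots A_k}e^{iP\cdot x}$ with $P\cdot x=P^{AB}x_{AB}$, in the sense of distributions. By the field equation it is supported on the momentum light cone $\{P^2=0\}$, whose points can be written $P_{AB}=\varepsilon_{ab}\lambda^a_A\lambda^b_B$, $a,b\in\{0,1\}$, with $\lambda^a_A$ real and defined up to $\mathrm{SL}(2,\mathbb R)$ acting on $a$. One has $$\widetilde F(P)_{A_1\dots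 A_k}=\widetilde F(\lambda)_{a_1\dots a_k}\,\lambda^{a_1}_{A_1}\cdots\lambda^{a_k}_{A_k}\,\delta(P^2)$$ with $\widetilde F(\lambda)_{a_1\dots a_k}$ symmetric; this $\widetilde F(\lambda^a)_{a_1\dots a_k}$ is called the Fourier transform of $F$. **Conventions.** $\mathrm Du=u_a\,du^a$, with little-group indices raised and lowered by $\varepsilon^{ab}$, $\varepsilon_{ab}$. Square brackets denote skew-symmetrization with factor $\tfrac12$. $\widehat\lambda_A$ is determined modulo multiples of $\lambda_A$, and the formula does not depend on this choice because of the factor $\delta(\omega^A\lambda_A)$. Universal numerical constants (powers of $2$ and $2\pi$) are absorbed into the normalizations of the measures and of $P^2$. *)

(* Defs.v *)
From HB Require Import structures.
From mathcomp Require Import all_boot all_order all_algebra.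
From mathcomp Require Import perm.
From mathcomp Require Import all_classical all_reals all_analysis.
From mathcomp Require Import complex.

Set Implicit Arguments.
Unset Strict Implicit.
Unset Printing Implicit Defensive.

Import Order.TTheory GRing.Theory Num.Theory.
Import numFieldNormedType.Exports.

Local Open Scope classical_set_scope.
Local Open Scope ring_scope.

Section Integration.
Context (R : realType).

Definition R3 : Type := (R * R * R)%type.
Definition R5 : Type := (R * R * R * R * R)%type.
Definition R6 : Type := (R * R * R * R * R * R)%type.

Definition expi (t : R) : R[i] := (cos t +i* sin t)%C.

Definition cintegrable d (T : measurableType d)
    (mu : {measure set T -> \bar R}) (h : T -> R[i]) : Prop :=
  mu.-integrable setT (EFin \o (fun x => complex.Re (h x))) /\
  mu.-integrable setT (EFin \o (fun x => complex.Im (h x))).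

Definition cintegral d (T : measurableType d)
    (mu : {measure set T -> \bar R}) (h : T -> R[i]) : R[i] :=
  (\int[mu]_x complex.Re (h x) +i* \int[mu]_x complex.Im (h x))%C.

End Integration.

Notation leb1 R := (@lebesgue_measure R).
Notation leb3 R := (product_measure1 (product_measure1 (leb1 R) (leb1 R)) (leb1 R)).
Notation leb5 R := (product_measure1 (product_measure1 (leb3 R) (leb1 R)) (leb1 R)).
Notation leb6 R := (product_measure1 (leb5 R) (leb1 R)).

Section Smoothness.
Context (R : realType) (V : normedModType R).

Definition iter_derive (vs : seq V) (g : V -> R) : V -> R :=
  foldr (fun v h => 'D_v h) g vs.

(* Meaningful for [U] open. *)
Definition smooth_on (U : set V) (g : V -> R) : Prop :=
  forall (vs : seq V) (x : V), U x ->
    {for x, continuous (iter_derive vs g)} /\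
    forall v : V, derivable (iter_derive vs g) x v.

Definition schwartz_real (g : V -> R) : Prop :=
  smooth_on setT g /\
  forall (vs : seq V) (m : nat), exists C : R, forall x : V,
    (1 + `|x|) ^+ m * `|iter_derive vs g x| <= C.

Definition schwartz (g : V -> R[i]) : Prop :=
  schwartz_real (fun x => complex.Re (g x)) /\
  schwartz_real (fun x => complex.Im (g x)).

End Smoothness.

Section Twistors.
Context (R : realType).

(* A twistor is a pair (omega^A, pi_A). *)
Definition twistor_cone : set ('rV[R]_4 * 'rV[R]_4) :=
  [set z : 'rV[R]_4 * 'rV[R]_4 | \sum_(A < 4) z.1 ord0 A * z.2 ord0 A = 0 /\ z != 0].

(* Smoothness on the submanifold [twistor_cone] of R^8: locally the
   restriction of a smooth function on an open subset of R^8. *)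
Definition smooth_on_cone (f : 'rV[R]_4 * 'rV[R]_4 -> R[i]) : Prop :=
  forall z, twistor_cone z ->
    exists (U : set ('rV[R]_4 * 'rV[R]_4)) (g : 'rV[R]_4 * 'rV[R]_4 -> R[i]),
      [/\ open U, U z,
          smooth_on U (fun w => complex.Re (g w)),
          smooth_on U (fun w => complex.Im (g w))
        & forall w, U w -> twistor_cone w -> f w = g w].

Definition homogeneous_on_cone (n : int)
    (f : 'rV[R]_4 * 'rV[R]_4 -> R[i]) : Prop :=
  forall (t : R) z, t != 0 -> twistor_cone z -> f (t *: z) = (t ^ n)%:C%C * f z.

(* D^3pi = eps^{ABCD} pi_A dpi_B dpi_C dpi_D restricts to 3! dy1 dy2 dy3 on the
   affine chart pi = (1, y1, y2, y3), whose complement in RP^3 is null.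
   Meant for g homogeneous of degree -4. *)
Definition int_RP3 (g : 'rV[R]_4 -> R[i]) : R[i] :=
  (3`!)%:R * cintegral (leb3 R)
    (fun y : R3 R => let: (y1, y2, y3) := y in
       g (\row_(A < 4) [:: 1; y1; y2; y3]`_A)).

(* With u^a = eps^{ab} u_b and eps^{01} = 1, Du = u_a du^a is
   u_0 du_1 - u_1 du_0, i.e. dt on the affine chart u = (1, t).
   Meant for g homogeneous of degree -2. *)
Definition int_RP1 (g : 'rV[R]_2 -> R[i]) : R[i] :=
  cintegral (leb1 R) (fun t : R => g (\row_(a < 2) [:: 1; t]`_a)).

(* The point of the hyperplane omega^A l_A = 0 whose coordinates other than the
   j-th are y. *)
Definition hyperplane_pt (l : 'rV[R]_4) (j : 'I_4) (y : 'rV[R]_3) : 'rV[R]_4 :=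
  \row_(A < 4)
    if unlift j A is Some i then y ord0 i
    else - (\sum_(i < 3) y ord0 i * l ord0 (lift j i)) / l ord0 j.

(* \int d^4omega delta(omega^A l_A) h(omega) for l != 0: eliminating a
   coordinate omega^j with l_j != 0 turns delta(omega^A l_A) d^4omega into
   d^3omega / |l_j|, which does not depend on j.  Only the values of h on the
   hyperplane are used. *)
Definition int_delta (l : 'rV[R]_4) (h : 'rV[R]_4 -> R[i]) : R[i] :=
  if [pick j | l ord0 j != 0] is Some j then
    (`|l ord0 j|^-1)%:C%C * cintegral (leb3 R)
      (fun y : R3 R => let: (y1, y2, y3) := y in
         h (hyperplane_pt l j (\row_(i < 3) [:: y1; y2; y3]`_i)))
  else 0.

End Twistors.

Section SpaceTime.
Context (R : realType).

(* Skew tensors in the coordinates (01, 02, 03, 12, 13, 23).  This is used both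
   for x^{AB} and for P_{AB}; as P^{01} = P_{23}, P^{02} = - P_{13}, etc.,
   raising indices preserves Lebesgue measure. *)
Definition bivector (p : R6 R) : 'M[R]_4 :=
  let: (p01, p02, p03, p12, p13, p23) := p in
  \matrix_(A, B) nth 0 (nth [::]
    [:: [::     0;   p01;   p02; p03];
        [:: - p01;     0;   p12; p13];
        [:: - p02; - p12;     0; p23];
        [:: - p03; - p13; - p23;   0]] A) B.

(* eps_{ABCD} = eps^{ABCD}, with eps_{0123} = 1. *)
Definition levi_civita (A B C D : 'I_4) : R :=
  \det (\matrix_(r < 4, c < 4) (tnth [tuple A; B; C; D] r == c)%:R).

(* v_{AB} = 1/2 eps_{ABCD} v^{CD}; the inverse is v^{AB} = 1/2 eps^{ABCD} v_{CD},
   so the same map lowers and raises a skew pair of indices. *)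
Definition hodge (v : 'M[R]_4) : 'M[R]_4 :=
  \matrix_(A, B) (2^-1 * \sum_(C < 4) \sum_(D < 4) levi_civita A B C D * v C D).

(* P . x = P^{AB} x_{AB}, given P_{AB} and x^{AB}. *)
Definition pairing (P x : 'M[R]_4) : R :=
  \sum_(A < 4) \sum_(B < 4) hodge P A B * hodge x A B.

Definition twistor_field k (f : 'rV[R]_4 * 'rV[R]_4 -> R[i])
    (x : R6 R) (A : k.-tuple 'I_4) : R[i] :=
  int_RP3 (fun pi_ : 'rV[R]_4 =>
    (\prod_(i < k) pi_ ord0 (tnth A i))%:C%C *
    f (\row_(B < 4) \sum_(C < 4) bivector x B C * pi_ ord0 C, pi_)).

(* P_{AB} = eps_{ab} l^a_A l^b_B with eps_{01} = 1; row a of [l] is l^a_A. *)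
Definition momentum (l : 'M[R]_(2, 4)) : 'M[R]_4 :=
  \matrix_(A, B) (l 0 A * l 1 B - l 1 A * l 0 B).

Definition skew_prod (v w : 'rV[R]_4) : 'M[R]_4 :=
  \matrix_(A, B) (2^-1 * (v ord0 A * w ord0 B - v ord0 B * w ord0 A)).

(* The part of the cone P^2 = 0 with P_{01} != 0, parametrized by the
   coordinates other than P_{23}; here
   P^2 = P^{AB} P_{AB} = 4 (P_{01} P_{23} - P_{02} P_{13} + P_{03} P_{12}). *)
Definition cone_pt (q : R5 R) : R6 R :=
  let: (p01, p02, p03, p12, p13) := q in
  (p01, p02, p03, p12, p13, (p02 * p13 - p03 * p12) / p01).

(* Integrand of \int d^6P delta(P^2) h(P) after eliminating P_{23}:
   delta(P^2) d^6P = d^5P / |dP^2/dP_{23}| = d^5P / |4 P_{01}|.  The part of the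
   cone with P_{01} = 0 is null for this (Leray) measure. *)
Definition cone_integrand (h : R6 R -> R[i]) (q : R5 R) : R[i] :=
  let: (p01, _, _, _, _) := q in (`|4 * p01|^-1)%:C%C * h (cone_pt q).

Definition fourier_test (phi : R6 R -> R[i]) (x : R6 R) : R[i] :=
  cintegral (leb6 R)
    (fun P : R6 R => phi P * expi (pairing (bivector P) (bivector x))).

(* The Fourier transform \int d^6x F(x) e^{iP.x}, as a tempered distribution,
   equals c G(P) delta(P^2). *)
Definition fourier_on_cone (F G : R6 R -> R[i]) (c : R) : Prop :=
  forall phi : R6 R -> R[i], schwartz phi ->
    [/\ cintegrable (leb6 R) (fun x => F x * fourier_test phi x),
        cintegrable (leb5 R) (cone_integrand (fun P => G P * phi P))
      & cintegral (leb6 R) (fun x => F x * fourier_test phi x) =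
        c%:C%C * cintegral (leb5 R) (cone_integrand (fun P => G P * phi P))].

(* With D^3pi, Du, d^6x, d^4omega and P^2 exactly as above, the universal
   constant relating F~(P) to F~(l) l...l delta(P^2) is 3 (2 pi)^3. *)
Definition cone_norm : R := 3 * (2 * pi) ^+ 3.

(* [Ft] is the Fourier transform F~(l)_{a_1...a_k} of [F]: symmetric, with
   F~(P)_{A_1...A_k} = F~(l)_{a_1...a_k} l^{a_1}_{A_1} ... l^{a_k}_{A_k} delta(P^2)
   up to [cone_norm].  The existence of [G] expresses SL(2,R)-covariance: the
   right-hand side depends on l only through P.  As a density on the cone is only
   determined almost everywhere, the continuous representative is selected. *)
Definition is_cone_fourier k (F : R6 R -> k.-tuple 'I_4 -> R[i])
    (Ft : 'M[R]_(2, 4) -> k.-tuple 'I_2 -> R[i]) : Prop :=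
  [/\ forall l, momentum l != 0 -> forall (a : k.-tuple 'I_2) (s : 'S_k),
        Ft l [tuple tnth a (s i) | i < k] = Ft l a,
      forall l, momentum l != 0 -> forall a : k.-tuple 'I_2,
        {for l, continuous (fun m => complex.Re (Ft m a))} /\
        {for l, continuous (fun m => complex.Im (Ft m a))}
    & exists G : 'M[R]_4 -> k.-tuple 'I_4 -> R[i],
        (forall l, momentum l != 0 -> forall A : k.-tuple 'I_4,
           G (momentum l) A =
           \sum_(a : k.-tuple 'I_2)
             Ft l a * (\prod_(i < k) l (tnth a i) (tnth A i))%:C%C) /\
        forall A : k.-tuple 'I_4,
          fourier_on_cone (F ^~ A) (fun P => G (bivector P) A) cone_norm].

End SpaceTime.

(* Main.v *)
(* Pair the field with the Fourier transform phi^ of a test function phi. For a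
   fixed spinor pi = (1, y) the twistor function depends on x only through
   omega = x pi, so the integral over the fibres of x |-> omega restricts phi to
   the momenta (1, y) /\ (0, p), by Fourier inversion on R^3; what remains is the
   Fourier transform D(pi, mu) of f(., pi) on the hyperplane omega . pi = 0, with
   mu = (0, p). Since D(pi, mu) = O(|pi|^-(k+2)) and the integral of phi over p is
   O(|pi|^-2), Fubini applies to (y, p). Exchanging y for P_12, P_13 and the
   affine coordinate t on RP^1 turns this into an integral over the cone against
   d^5P / |4 P_01|, whose density is the contraction of
     F~(l)_a = int dt u_a D(u l, l^1),  u = (1, t).
   The density depends on l only through the momentum because D(pi, mu + c pi) =
   D(pi, mu) and D(s pi, mu / s) = s^-(k+2) D(pi, mu), so that the SL(2) action
   becomes a Moebius substitution in t. The latter invariance also makes the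
   formula independent of the choice of the dual spinor.
   For uniqueness, the difference of two continuous densities integrates to zero
   against all Gaussians, hence vanishes where P_01 <> 0, and everywhere by
   continuity; a symmetric tensor is determined by its contraction with the two
   independent spinors l^0, l^1. *)
Require Import Defs.
From HB Require Import structures.
From mathcomp Require Import all_boot all_order all_algebra.
From mathcomp Require Import all_classical all_reals all_analysis.
From mathcomp Require Import measurable_realfun complex perm.
From mathcomp Require Import ring lra.
Set Implicit Arguments.
Unset Strict Implicit.
Unset Printing Implicit Defensive.
Import Order.TTheory GRing.Theory Num.Theory.
Import numFieldNormedType.Exports.
Local Open Scope classical_set_scope.
Local Open Scope ring_scope.

(** * Products of sigma-finite measures and changes of variables *)

(** Once the k factors of pi are counted, the kernel left after the Fourier transform has size
    |pi|^-2, which is not integrable over y in R^3. The missing |pi|^-2 comes from integrating the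
    test function over p, and the resulting |pi|^-4 is shared evenly among three coordinates: hence
    the recurrent exponent 4/3. No multidimensional Jacobian theorem is invoked. At fixed p the
    spinor y is linear in (P_12, P_13, t), so all substitutions are built fibrewise from
    one-dimensional affine maps, permutations of variables and, for SL(2), the inversion t -> 1/t.
    Points where a map degenerates are null, or carry weight 0 because 0^-1 = 0. The constant 3 (2
    pi)^3 is 6 . pi^3 . 4: here 6 = 3! comes from D^3pi; pi^3 = (2 pi)^3 / 2^3 from inversion in
    R^3, as P . x counts each of the six components twice; and 4 from delta(P^2), whose Leray
    density is 1 / |4 P_01|. Limits are taken along sequences, so that dominated convergence yields
    both the continuity and the measurability of integrals depending on parameters. *)

(* Mathcomp-analysis declares [\x] canonically sigma-finite only for
   subprobabilities; the alias [\xs] carries the instance for sigma-finite factors. *)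
Definition prodm {R : realType} d1 d2 (T1 : measurableType d1) (T2 : measurableType d2)
  (m1 : {sigma_finite_measure set T1 -> \bar R})
  (m2 : {sigma_finite_measure set T2 -> \bar R}) := product_measure1 m1 m2.

Notation "m1 '\xs' m2" := (prodm m1 m2) (at level 40, left associativity) : ring_scope.

Section ProductMeasure.
Context {R : realType} d1 d2 (T1 : measurableType d1) (T2 : measurableType d2).
Variables (m1 : {sigma_finite_measure set T1 -> \bar R})
  (m2 : {sigma_finite_measure set T2 -> \bar R}).

HB.instance Definition _ := Measure.on (m1 \xs m2).

Lemma prodm_sigma_finite : sigma_finite setT (m1 \xs m2).
Proof.
have /sigma_finiteP[F [TF ndF Foo]] := sigma_finiteT m1.
have /sigma_finiteP[G [TG ndG Goo]] := sigma_finiteT m2.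
exists (fun n => F n `*` G n).
  apply/esym/seteqP; split=> // -[x y] _.
  have [n _ Fx] : (\bigcup_n F n) x by rewrite -TF.
  have [k _ Gy] : (\bigcup_n G n) y by rewrite -TG.
  exists (maxn n k) => //; split => /=.
    by move: x Fx; exact/subsetPset/ndF/leq_maxl.
  by move: y Gy; exact/subsetPset/ndG/leq_maxr.
move=> k; have [? ?] := Foo k; have [? ?] := Goo k.
split; first exact: measurableX.
by rewrite /prodm product_measure1E// lte_mul_pinfty// ge0_fin_numE.
Qed.

HB.instance Definition _ :=
  Measure_isSigmaFinite.Build _ _ _ (m1 \xs m2) prodm_sigma_finite.

Section Tonelli.
Variables (f : T1 * T2 -> \bar R).
Hypotheses (mf : measurable_fun setT f) (f0 : forall x, (0 <= f x)%E).

Lemma tonelli1 : (\int[m1 \xs m2]_z f z = \int[m1]_x \int[m2]_y f (x, y))%E.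
Proof. exact: fubini_tonelli1. Qed.

Lemma tonelli12 : (\int[m1]_x \int[m2]_y f (x, y) = \int[m2]_y \int[m1]_x f (x, y))%E.
Proof. exact: fubini_tonelli. Qed.

Lemma tonelli_measurable1 : measurable_fun setT (fun x => \int[m2]_y f (x, y))%E.
Proof. exact: measurable_fun_fubini_tonelli_F. Qed.

End Tonelli.

End ProductMeasure.

Section ChangeOfVariables.
Context {R : realType}.

(** [m2] is the image under [phi] of the measure with density [w] with respect to [m1]. The transfer
    of integrals is itself the definition, so the relation composes and can be verified fibre by
    fibre; every Jacobian below is obtained in this way. *)
Definition cov d1 d2 (T1 : measurableType d1) (T2 : measurableType d2)
    (m1 : {measure set T1 -> \bar R}) (m2 : {measure set T2 -> \bar R})
    (phi : T1 -> T2) (w : T1 -> R) : Prop :=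
  [/\ measurable_fun setT phi, measurable_fun setT w, (forall x, 0 <= w x)
    & forall g : T2 -> \bar R, measurable_fun setT g -> (forall y, (0 <= g y)%E) ->
      (\int[m2]_y g y = \int[m1]_x (g (phi x) * (w x)%:E))%E].

Lemma cov_comp d1 d2 d3 (T1 : measurableType d1) (T2 : measurableType d2)
    (T3 : measurableType d3)
    (m1 : {measure set T1 -> \bar R}) (m2 : {measure set T2 -> \bar R})
    (m3 : {measure set T3 -> \bar R}) phi psi w v :
  cov m1 m2 phi w -> cov m2 m3 psi v ->
  cov m1 m3 (psi \o phi) (fun x => v (phi x) * w x).
Proof.
move=> [mphi mw w0 Hphi] [mpsi mv v0 Hpsi]; split.
- exact: measurableT_comp.
- by apply: measurable_funM => //; exact: measurableT_comp.
- by move=> x; rewrite mulr_ge0.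
- move=> g mg g0; rewrite Hpsi // Hphi //.
  + by apply: eq_integral => x _ /=; rewrite EFinM muleA.
  + apply: emeasurable_funM; first exact: measurableT_comp.
    by apply/measurable_EFinP.
  + by move=> y; rewrite mule_ge0 // lee_fin.
Qed.

Lemma cov_eq d1 d2 (T1 : measurableType d1) (T2 : measurableType d2)
    (m1 : {measure set T1 -> \bar R}) (m2 : {measure set T2 -> \bar R}) phi w phi' w' :
  cov m1 m2 phi w -> phi =1 phi' -> w =1 w' -> cov m1 m2 phi' w'.
Proof. by move=> + /funext <- /funext <-. Qed.

(** Tonelli over the base. The null set [N] absorbs the base points where the fibre map degenerates,
    such as multiplication by 0. *)
Lemma cov_fibR dX d1 d2 (X : measurableType dX) (Y1 : measurableType d1)
    (Y2 : measurableType d2) (m : {sigma_finite_measure set X -> \bar R})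
    (n1 : {sigma_finite_measure set Y1 -> \bar R})
    (n2 : {sigma_finite_measure set Y2 -> \bar R})
    (phi : X * Y1 -> Y2) (w : X * Y1 -> R) (N : set X) :
  measurable N -> m N = 0%E ->
  measurable_fun setT phi -> measurable_fun setT w -> (forall z, 0 <= w z) ->
  (forall x, ~ N x -> cov n1 n2 (fun y => phi (x, y)) (fun y => w (x, y))) ->
  cov (m \xs n1) (m \xs n2) (fun z => (z.1, phi z)) w.
Proof.
move=> mN N0 mphi mw w0 H.
have mp : measurable_fun setT (fun z : X * Y1 => (z.1, phi z)).
  by apply: measurable_fun_pair => //; exact: measurable_fst.
split=> // g mg g0.
have mgp : measurable_fun setT (fun z => (g (z.1, phi z) * (w z)%:E)%E).
  apply: emeasurable_funM; first exact: (measurableT_comp mg mp).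
  exact/measurable_EFinP.
have gp0 z : (0 <= g (z.1, phi z) * (w z)%:E)%E by rewrite mule_ge0 // lee_fin.
rewrite tonelli1 // tonelli1 //.
apply: ae_eq_integral => //.
- exact: (tonelli_measurable1 _ mg g0).
- exact: (tonelli_measurable1 _ mgp gp0).
- exists N; split => // x /= /not_implyP[_ nx]; apply: contrapT => Nx; apply: nx.
  have [_ _ _ Hx] := H x Nx.
  rewrite Hx //.
  by apply: measurableT_comp.
Qed.

Lemma cov_swap d1 d2 (X : measurableType d1) (Y : measurableType d2)
    (m : {sigma_finite_measure set X -> \bar R})
    (n : {sigma_finite_measure set Y -> \bar R}) :
  cov (m \xs n) (n \xs m) (fun z => (z.2, z.1)) (fun=> 1).
Proof.
have ms : measurable_fun setT (fun z : X * Y => (z.2, z.1)).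
  by apply: measurable_fun_pair; [exact: measurable_snd|exact: measurable_fst].
split=> // g mg g0.
rewrite tonelli1 //.
under [RHS]eq_integral do rewrite mule1.
rewrite tonelli1 //; last exact: (measurableT_comp mg ms).
rewrite tonelli12 //; exact: (measurableT_comp mg ms).
Qed.

Lemma cov_fibL dX d1 d2 (X : measurableType dX) (Y1 : measurableType d1)
    (Y2 : measurableType d2) (m : {sigma_finite_measure set X -> \bar R})
    (n1 : {sigma_finite_measure set Y1 -> \bar R})
    (n2 : {sigma_finite_measure set Y2 -> \bar R})
    (phi : Y1 * X -> Y2) (w : Y1 * X -> R) (N : set X) :
  measurable N -> m N = 0%E ->
  measurable_fun setT phi -> measurable_fun setT w -> (forall z, 0 <= w z) ->
  (forall x, ~ N x -> cov n1 n2 (fun y => phi (y, x)) (fun y => w (y, x))) ->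
  cov (n1 \xs m) (n2 \xs m) (fun z => (phi z, z.2)) w.
Proof.
move=> mN N0 mphi mw w0 H.
have ms : measurable_fun setT (fun z : X * Y1 => (z.2, z.1)).
  by apply: measurable_fun_pair; [exact: measurable_snd|exact: measurable_fst].
have := cov_comp (cov_comp (cov_swap n1 m)
  (@cov_fibR _ _ _ _ _ _ m n1 n2 (fun z => phi (z.2, z.1)) (fun z => w (z.2, z.1)) N
    mN N0 _ _ _ H)) (cov_swap m n2).
move=> /(_ (measurableT_comp mphi ms) (measurableT_comp mw ms) (fun z => w0 _)).
by move/cov_eq; apply => -[x y] //=; rewrite mul1r mulr1.
Qed.

Lemma cov_assoc d1 d2 d3 (X : measurableType d1) (Y : measurableType d2)
    (Z : measurableType d3)
    (m : {sigma_finite_measure set X -> \bar R})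
    (n : {sigma_finite_measure set Y -> \bar R})
    (p : {sigma_finite_measure set Z -> \bar R}) :
  cov (m \xs (n \xs p)) ((m \xs n) \xs p)
    (fun z => ((z.1, z.2.1), z.2.2)) (fun=> 1).
Proof.
have ma : measurable_fun setT (fun z : X * (Y * Z) => ((z.1, z.2.1), z.2.2)).
  apply: measurable_fun_pair; first apply: measurable_fun_pair => /=.
  - exact: measurable_fst.
  - exact: (measurableT_comp measurable_fst measurable_snd).
  - exact: (measurableT_comp measurable_snd measurable_snd).
split=> // g mg g0.
under [RHS]eq_integral do rewrite mule1.
rewrite tonelli1 // tonelli1; last 2 first.
- exact: (tonelli_measurable1 _ mg g0).
- by move=> z; exact: integral_ge0.
rewrite tonelli1 //; last exact: (measurableT_comp mg ma).
apply: eq_integral => x _; rewrite /=.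
rewrite (tonelli1 n p (f := fun yz => g (x, yz.1, yz.2))) //.
apply: (measurableT_comp (mg : measurable_fun setT g)) => //.
apply: measurable_fun_pair; last exact: measurable_snd.
by apply: measurable_fun_pair => //; exact: measurable_fst.
Qed.

Lemma cov_assocV d1 d2 d3 (X : measurableType d1) (Y : measurableType d2)
    (Z : measurableType d3)
    (m : {sigma_finite_measure set X -> \bar R})
    (n : {sigma_finite_measure set Y -> \bar R})
    (p : {sigma_finite_measure set Z -> \bar R}) :
  cov ((m \xs n) \xs p) (m \xs (n \xs p))
    (fun z => (z.1.1, (z.1.2, z.2))) (fun=> 1).
Proof.
have ma : measurable_fun setT (fun z : (X * Y) * Z => (z.1.1, (z.1.2, z.2))).
  apply: measurable_fun_pair; last apply: measurable_fun_pair => /=.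
  - exact: (measurableT_comp measurable_fst measurable_fst).
  - exact: (measurableT_comp measurable_snd measurable_fst).
  - exact: measurable_snd.
split=> // g mg g0.
have [_ _ _ H] := cov_assoc m n p.
rewrite H; first by apply: eq_integral => -[x [y z]] _; rewrite !mule1.
- by apply: emeasurable_funM => //; exact: (measurableT_comp mg ma).
- by move=> y; rewrite mule1.
Qed.

(** Both sides are measures in [A], so uniqueness of Lebesgue measure reduces the claim to half-open
    intervals. For [s < 0] the preimage of []a, b]] is closed on the left instead, with the same
    length. *)
Lemma lebesgue_measure_affine (s c : R) (A : set R) : s != 0 -> measurable A ->
  (lebesgue_measure ((fun t : R => (s * t + c)%R : measurableTypeR R) @^-1` A) * `|s|%:E
    = lebesgue_measure A)%E.
Proof.
move=> s0 mA.
have ms : measurable_fun setT (fun t : measurableTypeR R => s * t + c : measurableTypeR R).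
  by apply: measurable_funD => //; exact: measurable_funM.
pose nu := mscale (NngNum (normr_ge0 s))
  (pushforward lebesgue_measure (fun t : measurableTypeR R => s * t + c : measurableTypeR R)).
have : lebesgue_measure A = nu ms A; last by move=> ->; rewrite /nu /mscale /= muleC.
apply: lebesgue_measure_unique => // _ [[a b]] _ <-.
rewrite /nu /mscale /= /pushforward.
have [sp|sn|s00] := ltgtP 0 s; last by rewrite -s00 eqxx in s0.
- rewrite [X in _ = (_ * lebesgue_measure X)%E](_ : _ = `] (a - c) / s, (b - c) / s]%classic).
    rewrite !lebesgue_measure_itv /= !lte_fin gtr0_norm //.
    rewrite ltr_pM2r ?invr_gt0 // ltrD2r.
    case: ifP => _; last by rewrite mule0.
    by rewrite -EFinM; congr EFin; field.
  apply/seteqP; split=> t /=; rewrite !in_itv /= ltr_pdivrMr // ler_pdivlMr //;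
    by rewrite ltrBlDr lerBrDr (mulrC t).
- rewrite [X in _ = (_ * lebesgue_measure X)%E](_ : _ = `[(b - c) / s, (a - c) / s[%classic).
    rewrite !lebesgue_measure_itv /= !lte_fin ltr0_norm //.
    rewrite ltr_nM2r ?invr_lt0 // ltrD2r.
    case: ifP => _; last by rewrite mule0.
    by rewrite -EFinM; congr EFin; field.
  apply/seteqP; split=> t /=; rewrite !in_itv /= ltr_ndivlMr // ler_ndivrMr //;
    by rewrite ltrBlDr lerBrDr (mulrC t) andbC.
Qed.

Lemma cov_affine (s c : R) : s != 0 ->
  cov (leb1 R) (leb1 R) (fun t => s * t + c) (fun=> `|s|).
Proof.
move=> s0.
have ms : measurable_fun setT (fun t : measurableTypeR R => s * t + c : measurableTypeR R).
  by apply: measurable_funD => //; exact: measurable_funM.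
split=> // g mg g0.
pose nu := mscale (NngNum (normr_ge0 s))
  (pushforward lebesgue_measure (fun t : measurableTypeR R => s * t + c : measurableTypeR R)).
transitivity (\int[nu ms]_y g y)%E.
  apply: eq_measure_integral => A mA _.
  by rewrite -[LHS](lebesgue_measure_affine c s0 mA) muleC.
rewrite ge0_integral_mscale //.
rewrite (@ge0_integral_pushforward _ _ _ _ _ _ ms lebesgue_measure setT g) //=.
rewrite preimage_setT -ge0_integralZl //=.
- by apply: eq_integral => x _; rewrite muleC.
- exact: (measurableT_comp mg ms).
Qed.

End ChangeOfVariables.

(** * Complex-valued integrals *)

Section ComplexAbs.
Context {R : realType}.
Implicit Types z w : R[i].

(* The l^1 norm of the pair (Re z, Im z), used instead of the modulus. *)
Definition cabs z : R := `|complex.Re z| + `|complex.Im z|.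

Lemma cabs_ge0 z : 0 <= cabs z. Proof. by rewrite addr_ge0. Qed.
Lemma Re_le_cabs z : `|complex.Re z| <= cabs z. Proof. by rewrite lerDl. Qed.
Lemma Im_le_cabs z : `|complex.Im z| <= cabs z. Proof. by rewrite lerDr. Qed.

Lemma ReM z w : complex.Re (z * w) =
  complex.Re z * complex.Re w - complex.Im z * complex.Im w.
Proof. by case: z w => [a b] [c d]. Qed.

Lemma ImM z w : complex.Im (z * w) =
  complex.Re z * complex.Im w + complex.Im z * complex.Re w.
Proof. by case: z w => [a b] [c d]. Qed.

Lemma ReD z w : complex.Re (z + w) = complex.Re z + complex.Re w.
Proof. by case: z w => [a b] [c d]. Qed.

Lemma ImD z w : complex.Im (z + w) = complex.Im z + complex.Im w.
Proof. by case: z w => [a b] [c d]. Qed.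

Lemma cabsM z w : cabs (z * w) <= cabs z * cabs w.
Proof.
rewrite /cabs ReM ImM.
apply: (le_trans (lerD (ler_normB _ _) (ler_normD _ _))).
by rewrite !normrM le_eqVlt; apply/orP; left; apply/eqP; ring.
Qed.

Lemma cabsD z w : cabs (z + w) <= cabs z + cabs w.
Proof.
rewrite /cabs ReD ImD.
apply: (le_trans (lerD (ler_normD _ _) (ler_normD _ _))).
by rewrite le_eqVlt; apply/orP; left; apply/eqP; ring.
Qed.

Lemma cabs_real (c : R) : cabs c%:C%C = `|c|.
Proof. by rewrite /cabs /= normr0 addr0. Qed.

Lemma cabs_realM (c : R) z : cabs (c%:C%C * z) = `|c| * cabs z.
Proof. by case: z => a b; rewrite /cabs /= !mul0r subr0 addr0 !normrM mulrDr. Qed.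

Lemma cabs_expi (t : R) : cabs (expi t) <= 2.
Proof.
rewrite /cabs /= (_ : 2 = 1 + 1) //; apply: lerD; rewrite ler_norml.
  by rewrite cos_geN1 cos_le1.
by rewrite sin_geN1 sin_le1.
Qed.

Lemma expiD (s t : R) : expi (s + t) = expi s * expi t.
Proof.
by rewrite /expi cosD sinD; apply/eqP; rewrite eq_complex /= eqxx /= (addrC (sin s * _)).
Qed.

Lemma expi0 : expi (0 : R) = 1.
Proof. by rewrite /expi cos0 sin0. Qed.

Lemma complex_eqP z w : complex.Re z = complex.Re w -> complex.Im z = complex.Im w -> z = w.
Proof. by case: z w => [a b] [c d] /= -> ->. Qed.

End ComplexAbs.

Section ComplexMeasurable.
Context {R : realType} d (T : measurableType d).
Implicit Types h g : T -> R[i].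

Definition cmeas h : Prop :=
  measurable_fun setT (fun x => complex.Re (h x)) /\
  measurable_fun setT (fun x => complex.Im (h x)).

Lemma cmeasM h g : cmeas h -> cmeas g -> cmeas (fun x => h x * g x).
Proof.
move=> [h1 h2] [g1 g2]; split.
  under eq_fun do rewrite ReM.
  by apply: measurable_funB; exact: measurable_funM.
under eq_fun do rewrite ImM.
by apply: measurable_funD; exact: measurable_funM.
Qed.

Lemma cmeas_real (f : T -> R) : measurable_fun setT f -> cmeas (fun x => (f x)%:C%C).
Proof. by move=> mf; split. Qed.

Lemma cmeas_cst (c : R[i]) : cmeas (fun=> c).
Proof. by split; exact: measurable_cst. Qed.

Lemma cmeas_expi (f : T -> R) : measurable_fun setT f -> cmeas (fun x => expi (f x)).
Proof.
move=> mf; split.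
  by apply: (measurableT_comp _ mf); apply: continuous_measurable_fun; exact: continuous_cos.
by apply: (measurableT_comp _ mf); apply: continuous_measurable_fun; exact: continuous_sin.
Qed.

Lemma measurable_cabs h : cmeas h -> measurable_fun setT (fun x => cabs (h x)).
Proof.
by move=> [h1 h2]; apply: measurable_funD; apply: measurableT_comp.
Qed.

End ComplexMeasurable.

Lemma cmeas_comp {R : realType} d1 d2 (T1 : measurableType d1) (T2 : measurableType d2)
    (h : T2 -> R[i]) (phi : T1 -> T2) :
  cmeas h -> measurable_fun setT phi -> cmeas (h \o phi).
Proof. by move=> [h1 h2] mp; split; [exact: (measurableT_comp h1 mp)|exact: (measurableT_comp h2
  mp)]. Qed.

Lemma emeas {R : realType} d (T : measurableType d) (f : T -> R) :
  measurable_fun setT f -> measurable_fun setT (fun x => (f x)%:E).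
Proof. by move=> /measurable_EFinP. Qed.

Notation rintegrable mu f := (integrable mu setT (fun x => (f x)%:E)).

Section ComplexIntegral.
Context {R : realType} d (T : measurableType d) (mu : {measure set T -> \bar R}).
Implicit Types (h g : T -> R[i]) (f : T -> R).

Lemma rintegrable_dom f f' : measurable_fun setT f -> rintegrable mu f' ->
  (forall x, `|f x| <= f' x) -> rintegrable mu f.
Proof.
move=> mf if' ff'; apply: le_integrable if' => //.
  exact: emeas.
move=> x _ /=; rewrite lee_fin; apply: (le_trans (ff' x)); exact: ler_norm.
Qed.

Lemma cintegrable_dom h f : cmeas h -> rintegrable mu f ->
  (forall x, cabs (h x) <= f x) -> cintegrable mu h.
Proof.
move=> [h1 h2] fi hf; split; apply: (rintegrable_dom _ fi) => // x;
  apply: le_trans (hf x); [exact: Re_le_cabs|exact: Im_le_cabs].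
Qed.

Lemma cintegrable_cmeas h : cintegrable mu h -> cmeas h.
Proof.
by move=> [/integrableP[h1 _] /integrableP[h2 _]]; split; apply/measurable_EFinP.
Qed.

Lemma cintegrable_cabs h : cintegrable mu h -> rintegrable mu (fun x => cabs (h x)).
Proof.
move=> ih; have [h1 h2] := cintegrable_cmeas ih; case: ih => i1 i2.
have := integrableD measurableT (integrable_abse i1) (integrable_abse i2).
by apply: eq_integrable.
Qed.

Lemma eq_cintegral h g : h =1 g -> cintegral mu h = cintegral mu g.
Proof. by move=> /funext ->. Qed.

Lemma eq_cintegrable h g : h =1 g -> cintegrable mu h -> cintegrable mu g.
Proof. by move=> /funext ->. Qed.

Lemma cintegrableM_real (c : R) h : cintegrable mu h -> cintegrable mu (fun x => c%:C%C * h x).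
Proof.
move=> ih; apply: (@cintegrable_dom _ (fun x => `|c| * cabs (h x))).
- by apply: cmeasM; [exact: cmeas_cst|exact: cintegrable_cmeas].
- by have := integrableZl measurableT `|c| (cintegrable_cabs ih).
- by move=> x; rewrite cabs_realM.
Qed.

Lemma cintegrableMl (c : R[i]) h : cintegrable mu h -> cintegrable mu (fun x => c * h x).
Proof.
move=> ih; apply: (@cintegrable_dom _ (fun x => cabs c * cabs (h x))).
- by apply: cmeasM; [exact: cmeas_cst|exact: cintegrable_cmeas].
- by have := integrableZl measurableT (cabs c) (cintegrable_cabs ih).
- by move=> x; exact: cabsM.
Qed.

Lemma cintegralMl (c : R[i]) h : cintegrable mu h ->
  cintegral mu (fun x => c * h x) = c * cintegral mu h.
Proof.
case: c => a b [ih1 ih2].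
have mM c k : rintegrable mu k -> rintegrable mu (fun x => c * k x).
  by move=> ik; have := integrableZl measurableT c ik.
apply: complex_eqP; rewrite /cintegral /=.
  under eq_Rintegral do rewrite ReM /=.
  rewrite RintegralB //; [|exact: mM|exact: mM].
  by rewrite !RintegralZl.
under eq_Rintegral do rewrite ImM /=.
rewrite RintegralD //; [|exact: mM|exact: mM].
by rewrite !RintegralZl.
Qed.

Lemma cintegrableD h g : cintegrable mu h -> cintegrable mu g ->
  cintegrable mu (fun x => h x + g x).
Proof.
move=> [h1 h2] [g1 g2]; split.
  by apply: eq_integrable (integrableD measurableT h1 g1) => // x _ /=; rewrite ReD EFinD.
by apply: eq_integrable (integrableD measurableT h2 g2) => // x _ /=; rewrite ImD EFinD.
Qed.

Lemma cintegralD h g : cintegrable mu h -> cintegrable mu g ->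
  cintegral mu (fun x => h x + g x) = cintegral mu h + cintegral mu g.
Proof.
move=> [h1 h2] [g1 g2]; apply: complex_eqP; rewrite /cintegral /=.
  by under eq_Rintegral do rewrite ReD; rewrite RintegralD.
by under eq_Rintegral do rewrite ImD; rewrite RintegralD.
Qed.

Lemma cintegral0 : cintegral mu (fun=> 0) = 0.
Proof. by apply: complex_eqP; rewrite /cintegral /= Rintegral_cst // mul0r. Qed.

Lemma cintegrable0 : cintegrable mu (fun=> 0).
Proof. by split; exact: integrable0. Qed.

Lemma cintegral_sum (I : Type) (s : seq I) (F : I -> T -> R[i]) :
  (forall i, cintegrable mu (F i)) ->
  cintegrable mu (fun x => \sum_(i <- s) F i x) /\
  cintegral mu (fun x => \sum_(i <- s) F i x) = \sum_(i <- s) cintegral mu (F i).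
Proof.
move=> iF; elim: s => [|i s [IH1 IH2]].
  rewrite big_nil; split.
    by apply: eq_cintegrable cintegrable0 => x; rewrite big_nil.
  by rewrite -[RHS]cintegral0; apply: eq_cintegral => x; rewrite big_nil.
rewrite big_cons -IH2 -cintegralD //; split.
  by apply: eq_cintegrable (cintegrableD (iF i) IH1) => x; rewrite big_cons.
by apply: eq_cintegral => x; rewrite big_cons.
Qed.

Lemma cabs_cintegral h : cintegrable mu h ->
  cabs (cintegral mu h) <= \int[mu]_x cabs (h x).
Proof.
move=> [h1 h2]; rewrite /cabs RintegralD //; last 2 first.
  exact: (integrable_abse h1).
  exact: (integrable_abse h2).
by apply: lerD; exact: le_normr_Rintegral.
Qed.

Lemma rdct (f_ : nat -> T -> R) f (g' : T -> R) :
  (forall n, measurable_fun setT (f_ n)) -> (forall x, f_ ^~ x @ \oo --> f x) ->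
  rintegrable mu g' -> (forall n x, `|f_ n x| <= g' x) ->
  (fun n => \int[mu]_x f_ n x) @ \oo --> \int[mu]_x f x.
Proof.
move=> mf_ ff ig fg.
have mf : measurable_fun setT f by apply: (measurable_fun_cvg (h := f_)) => // x _; exact: ff.
have [] := @dominated_convergence _ _ _ mu setT measurableT (fun n x => (f_ n x)%:E)
  (fun x => (f x)%:E) (fun x => (g' x)%:E).
- by move=> n; exact: emeas.
- exact: emeas.
- apply: aeW => x _; apply/fine_cvgP; split; first exact: nearW.
  exact: ff.
- exact: ig.
- by apply: aeW => x n _; rewrite lee_fin.
move=> i1 _ cv.
apply: fine_cvg.
by rewrite /Rintegral fineK // integrable_fin_num.
Qed.

Lemma cdct (h_ : nat -> T -> R[i]) h (g' : T -> R) :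
  (forall n, cmeas (h_ n)) ->
  (forall x, (fun n => complex.Re (h_ n x)) @ \oo --> complex.Re (h x)) ->
  (forall x, (fun n => complex.Im (h_ n x)) @ \oo --> complex.Im (h x)) ->
  rintegrable mu g' -> (forall n x, cabs (h_ n x) <= g' x) ->
  (fun n => complex.Re (cintegral mu (h_ n))) @ \oo --> complex.Re (cintegral mu h) /\
  (fun n => complex.Im (cintegral mu (h_ n))) @ \oo --> complex.Im (cintegral mu h).
Proof.
move=> mh rh ih ig hg; split.
  apply: (rdct (g' := g')) => // [n|n x]; first by case: (mh n).
  by apply: le_trans (hg n x); exact: Re_le_cabs.
apply: (rdct (g' := g')) => // [n|n x]; first by case: (mh n).
by apply: le_trans (hg n x); exact: Im_le_cabs.
Qed.

End ComplexIntegral.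

Section ComplexFubini.
Context {R : realType} d1 d2 (T1 : measurableType d1) (T2 : measurableType d2).
Variables (m1 : {sigma_finite_measure set T1 -> \bar R})
  (m2 : {sigma_finite_measure set T2 -> \bar R}).

Lemma rfubini (f : T1 * T2 -> R) : rintegrable (m1 \xs m2) f ->
  rintegrable m1 (fun x => \int[m2]_y f (x, y)) /\
  \int[m1]_x \int[m2]_y f (x, y) = \int[m1 \xs m2]_z f z.
Proof.
move=> fi.
have mF : measurable_fun setT (fun x => \int[m2]_y (f (x, y))%:E)%E.
  exact: (measurable_fubini_F fi).
have iF : m1.-integrable setT (fun x => \int[m2]_y (f (x, y))%:E)%E.
  exact: (integrable_fubini_F fi).
(* The inner extended integral is finite only for almost every [x]; elsewhere [fine] replaces an
   infinite value by 0, which the outer integral does not see. *)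
have ae : {ae m1, forall x, setT x ->
    (\int[m2]_y (f (x, y))%:E)%E = (\int[m2]_y f (x, y))%:E}.
  have := integrable_ae measurableT iF.
  by apply: filterS => x /= /(_ I) fx _; rewrite /Rintegral fineK.
have mf : measurable_fun setT (fun x => (\int[m2]_y f (x, y))%:E).
  by apply: emeas; exact: (measurableT_comp (fine_measurable measurableT) mF).
split.
  apply: le_integrable iF => // x _; rewrite /Rintegral.
  by case: (\int[m2]_y (f (x, y))%:E)%E => [r| |] //=; rewrite normr0 leey.
rewrite /Rintegral; congr fine; rewrite -[RHS](integral12_prod_meas1 fi).
apply: ae_eq_integral => //.
by move: ae; apply: filterS => x /= H xT; rewrite /fubini_F /= H.
Qed.

Lemma cfubini (h : T1 * T2 -> R[i]) : cintegrable (m1 \xs m2) h ->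
  cintegrable m1 (fun x => cintegral m2 (fun y => h (x, y))) /\
  cintegral m1 (fun x => cintegral m2 (fun y => h (x, y))) = cintegral (m1 \xs m2) h.
Proof.
move=> [/rfubini[a1 a2] /rfubini[b1 b2]]; split; first by split.
by apply: complex_eqP; rewrite /cintegral /=.
Qed.

Lemma rintegrable_prod (f : T1 -> R) (g : T2 -> R) :
  rintegrable m1 f -> rintegrable m2 g -> rintegrable (m1 \xs m2) (fun z => f z.1 * g z.2).
Proof.
move=> fi gi.
have mf : measurable_fun setT f by apply/measurable_EFinP; case/integrableP: fi.
have mg : measurable_fun setT g by apply/measurable_EFinP; case/integrableP: gi.
have mfg : measurable_fun setT (fun z : T1 * T2 => f z.1 * g z.2).
  apply: measurable_funM; first exact: (measurableT_comp mf measurable_fst).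
  exact: (measurableT_comp mg measurable_snd).
apply/integrableP; split; first exact: emeas.
rewrite tonelli1 //; last by apply: measurableT_comp => //; exact: emeas.
have -> : (\int[m1]_x \int[m2]_y `|(f x * g y)%:E| =
    (\int[m1]_x `|(f x)%:E|) * \int[m2]_y `|(g y)%:E|)%E.
  rewrite -ge0_integralZr //; last 2 first.
  - by apply: measurableT_comp => //; exact: emeas.
  - exact: integral_ge0.
  apply: eq_integral => x _; rewrite -ge0_integralZl //; last first.
    by apply: measurableT_comp => //; exact: emeas.
  by apply: eq_integral => y _; rewrite -abseM.
by apply: lte_mul_pinfty; [exact: integral_ge0| |]; 
  [rewrite ge0_fin_numE ?integral_ge0 //|]; case/integrableP: fi => //; case/integrableP: gi.
Qed.

End ComplexFubini.

Section ComplexCov.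
Context {R : realType} d1 d2 (T1 : measurableType d1) (T2 : measurableType d2).
Variables (m1 : {measure set T1 -> \bar R}) (m2 : {measure set T2 -> \bar R})
  (phi : T1 -> T2) (w : T1 -> R).
Hypothesis H : cov m1 m2 phi w.

Lemma rintegrable_cov (f : T2 -> R) : measurable_fun setT f ->
  rintegrable m1 (fun x => f (phi x) * w x) <-> rintegrable m2 f.
Proof.
case: H => mphi mw w0 K mf.
have E : (\int[m2]_y `|(f y)%:E| = \int[m1]_x `|(f (phi x) * w x)%:E|)%E.
  rewrite K //; last by apply: measurableT_comp => //; exact: emeas.
  by apply: eq_integral => x _; rewrite EFinM abseM (gee0_abs (x := (w x)%:E)) ?lee_fin.
have mfw : measurable_fun setT (fun x => f (phi x) * w x).
  by apply: measurable_funM => //; exact: measurableT_comp.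
split=> /integrableP[_ fi]; apply/integrableP; split; try exact: emeas.
  by rewrite E.
by rewrite -E.
Qed.

Lemma rintegral_cov (f : T2 -> R) : measurable_fun setT f ->
  \int[m2]_y f y = \int[m1]_x (f (phi x) * w x).
Proof.
case: H => mphi mw w0 K mf; rewrite /Rintegral; congr fine.
(* The substitution rule concerns nonnegative functions; multiplication by the nonnegative weight
   commutes with taking positive and negative parts. *)
rewrite integralE [RHS]integralE; congr (_ - _)%E; rewrite K //.
- apply: eq_integral => x _; rewrite !funeposE.
  by rewrite -[0%E]/(0%:E) -!EFin_max -EFinM maxr_pMl // mul0r.
- by apply: measurable_funepos; exact: emeas.
- apply: eq_integral => x _; rewrite !funenegE.
  by rewrite -[0%E]/(0%:E) -!EFinN -!EFin_max -EFinM maxr_pMl // mul0r mulNr.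
- by apply: measurable_funeneg; exact: emeas.
Qed.

Lemma cintegrable_cov (h : T2 -> R[i]) : cmeas h ->
  cintegrable m1 (fun x => (w x)%:C%C * h (phi x)) <-> cintegrable m2 h.
Proof.
move=> [h1 h2]; split=> -[i1 i2].
  split; apply/rintegrable_cov => //.
    by apply: eq_integrable i1 => // x _ /=; rewrite ReM /= mul0r subr0 mulrC.
  by apply: eq_integrable i2 => // x _ /=; rewrite ImM /= mul0r addr0 mulrC.
split.
  apply: eq_integrable ((rintegrable_cov h1).2 i1) => // x _ /=.
  by rewrite ReM /= mul0r subr0 mulrC.
apply: eq_integrable ((rintegrable_cov h2).2 i2) => // x _ /=.
by rewrite ImM /= mul0r addr0 mulrC.
Qed.

Lemma cintegral_cov (h : T2 -> R[i]) : cmeas h ->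
  cintegral m2 h = cintegral m1 (fun x => (w x)%:C%C * h (phi x)).
Proof.
move=> [h1 h2]; apply: complex_eqP; rewrite /cintegral /= rintegral_cov //.
  by apply: eq_Rintegral => x _; rewrite ReM /= mul0r subr0 mulrC.
by apply: eq_Rintegral => x _; rewrite ImM /= mul0r addr0 mulrC.
Qed.

End ComplexCov.

Notation l1 R := (@lebesgue_measure R).

(* Lebesgue measure lives on [measurableTypeR R], which is convertible to [R] but
   carries another measurable structure. *)
Notation L1 R := (measurableTypeR R).
Notation L3 R := (L1 R * L1 R * L1 R)%type.
Notation L5 R := (L3 R * L1 R * L1 R)%type.
Notation L6 R := (L5 R * L1 R)%type.

Definition l3 (R : realType) : {sigma_finite_measure set (L3 R) -> \bar R} :=
  l1 R \xs l1 R \xs l1 R.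
Definition l5 (R : realType) : {sigma_finite_measure set (L5 R) -> \bar R} :=
  l3 R \xs l1 R \xs l1 R.
Definition l6 (R : realType) : {sigma_finite_measure set (L6 R) -> \bar R} :=
  l5 R \xs l1 R.

(** An integral depends only on the underlying set function, so the bare products in the definitions
    can be exchanged for the sigma-finite instances [l3], [l5], [l6], to which Fubini applies. *)
Lemma cintegral_measure_eq {R : realType} d (T : measurableType d)
    (mu nu : {measure set T -> \bar R}) (h : T -> R[i]) :
  (mu : set T -> \bar R) = nu ->
  (cintegrable mu h <-> cintegrable nu h) /\ cintegral mu h = cintegral nu h.
Proof. by rewrite /cintegrable /cintegral /Rintegral => ->. Qed.

Lemma leb3E {R : realType} (h : R3 R -> R[i]) :
  (cintegrable (leb3 R) h <-> cintegrable (l3 R) h) /\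
  cintegral (leb3 R) h = cintegral (l3 R) h.
Proof. apply: cintegral_measure_eq. rewrite /l6 /l5 /l3 /prodm /=. reflexivity. Qed.

Lemma leb5E {R : realType} (h : R5 R -> R[i]) :
  (cintegrable (leb5 R) h <-> cintegrable (l5 R) h) /\
  cintegral (leb5 R) h = cintegral (l5 R) h.
Proof. apply: cintegral_measure_eq. rewrite /l6 /l5 /l3 /prodm /=. reflexivity. Qed.

Lemma leb6E {R : realType} (h : R6 R -> R[i]) :
  (cintegrable (leb6 R) h <-> cintegrable (l6 R) h) /\
  cintegral (leb6 R) h = cintegral (l6 R) h.
Proof. apply: cintegral_measure_eq. rewrite /l6 /l5 /l3 /prodm /=. reflexivity. Qed.

(** * Joint measurability in product spaces *)

Section Measurability.
Context {R : realType}.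

(** Rounding the last variable down to the grid of step 1 / (n + 1) gives functions that are
    measurable slab by slab, and continuity in that variable makes them converge to [g]. This
    supplies measurability for the product sigma-algebra on iterated products of lines. *)
Lemma measurable_caratheodory d (T : measurableType d) (g : T * measurableTypeR R -> R) :
  (forall s, measurable_fun setT (fun t => g (t, s))) ->
  (forall t, continuous (fun s : R => g (t, s))) -> measurable_fun setT g.
Proof.
move=> mg cg.
pose r (n : nat) (s : R) : R := (Num.floor (n.+1%:R * s))%:~R / n.+1%:R.
apply: (measurable_fun_cvg (h := fun n z => g (z.1, r n z.2))) => //.
  move=> n _ Y mY; rewrite setTI.
  rewrite (_ : _ @^-1` _ = \bigcup_(k : int)
     ([set z | (n.+1%:R * z.2) \in `[k%:~R, (k + 1)%:~R[ ] `&`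
      [set z : T * measurableTypeR R | Y (g (z.1, k%:~R / n.+1%:R))])).
    apply: countable_bigcupT_measurable => // k; apply: measurableI.
      have mf : measurable_fun setT (fun z : T * measurableTypeR R => n.+1%:R * z.2).
        by apply: measurable_funM => //; exact: measurable_snd.
      rewrite (_ : [set z | _] = setT `&` (fun z : T * measurableTypeR R => n.+1%:R * z.2) @^-1`
        `[k%:~R, (k + 1)%:~R[%classic) ?setTI //.
      by rewrite -[X in measurable X]setTI; exact: (mf measurableT _ (measurable_itv _)).
    rewrite -[X in measurable X]setTI.
    exact: (measurableT_comp (mg (k%:~R / n.+1%:R)) measurable_fst).
  apply/seteqP; split=> -[t s] /=.
    move=> Yg; exists (Num.floor (n.+1%:R * s)) => //; split => //=.
    by rewrite in_itv /= floor_itv.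
  by move=> [k _ [/=]]; rewrite in_itv /= -floor_eq => /eqP <-.
move=> [t s] _ /=.
have rs : r n s @[n --> \oo] --> s.
  apply: (squeeze_cvgr (f := fun n => s - harmonic n) (h := fun=> s)).
  - apply: nearW => n; rewrite /r /harmonic /=.
    have /andP[h1 h2] := floor_itv (n.+1%:R * s).
    rewrite ler_pdivrMr // (mulrC s) h1 andbT.
    rewrite ler_pdivlMr // mulrBl mulVf // lerBlDr mulrC.
    by apply: ltW; rewrite intrD in h2.
  - rewrite -[X in _ --> X]subr0; apply: cvgB; [exact: cvg_cst|exact: cvg_harmonic].
  - exact: cvg_cst.
by apply: (cvg_comp (fun n => r n s) (fun u => g (t, u)) rs); exact: cg.
Qed.

End Measurability.

(** * Explicit one-dimensional integrals *)

Section OneDimIntegrals.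
Context {R : realType}.

Lemma even_integral (f F : R -> R) (l : R) : (forall x, 0 <= f x) -> continuous f ->
  (forall x, f (- x) = f x) -> (forall x : R, 0 < x -> is_derive x 1 F (f x)) ->
  {for (0 : R), continuous F} -> F x @[x --> +oo] --> l ->
  rintegrable (l1 R) f /\ \int[l1 R]_x f x = 2 * (l - F 0).
Proof.
move=> f0 cf ef dF F0 Fl.
have E : (\int[l1 R]_x (f x)%:E = (2 * (l - F 0))%:E)%E.
  rewrite ge0_symfun_integralT //; last by move=> x /=; rewrite ef.
  rewrite -set_itvcy (ge0_continuous_FTC2y (F := F) (l := l)) //.
  - exact: continuous_subspaceT.
  - by move=> x x0; case: (dF x x0).
  - exact: cvg_at_right_filter.
  - move=> x; rewrite in_itv /= andbT => x0.
    by rewrite derive1E; case: (dF x x0).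
split.
  apply/integrableP; split; first by apply: emeas; exact: continuous_measurable_fun.
  under eq_integral do rewrite gee0_abs ?lee_fin //.
  by rewrite E ltry.
by rewrite /Rintegral E.
Qed.

(** Decay profile used for Schwartz functions: positive, at most 1 (so that factors may be discarded
    from a product), and of mass [pi]. *)
Definition cw (s : R) : R := (1 + s ^+ 2)^-1.

Lemma cw_gt0 s : 0 < cw s.
Proof. by rewrite invr_gt0 ltr_pwDl // sqr_ge0. Qed.

Lemma cw_le1 s : cw s <= 1.
Proof. by rewrite invf_le1 ?ltr_pwDl ?sqr_ge0 // lerDl sqr_ge0. Qed.

Lemma continuous_cw : continuous cw.
Proof. exact: continuous_oneDsqrV. Qed.

Lemma cw_integral : rintegrable (l1 R) cw /\ \int[l1 R]_x cw x = pi.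
Proof.
have [] := @even_integral cw (@atan R) (pi / 2).
- by move=> x; exact: ltW (cw_gt0 x).
- exact: continuous_cw.
- by move=> x; rewrite /cw sqrrN.
- exact: continuous_atan.
- exact: cvgy_atan.
by move=> i1 ->; split => //; rewrite atan0 subr0; field.
Qed.

(** The function (1 + |s|)^(-4/3). Three such factors match a decay of order 4 in R^3, and 4/3 > 1
    keeps each of them integrable. *)
Definition w43 (s : R) : R := expR (- (4 / 3) * ln (1 + `|s|)).

Lemma w43_gt0 s : 0 < w43 s. Proof. exact: expR_gt0. Qed.

Lemma continuous_w43 : continuous w43.
Proof.
move=> x; apply: continuous_comp; last exact: continuous_expR.
apply: cvgM; first exact: cvg_cst.
apply: continuous_comp; last by apply: continuous_ln; rewrite ltr_pwDl.
by apply: cvgD; [exact: cvg_cst|exact: norm_continuous].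
Qed.

Lemma w43_integrable : rintegrable (l1 R) w43.
Proof.
pose F (x : R) := - 3 * expR (- (1 / 3) * ln (1 + x)).
have D (x : R) : 0 < x -> is_derive x 1 F (w43 x).
  move=> x0.
  have x1 : 0 < 1 + x by rewrite addr_gt0.
  have d1 : is_derive x 1 (fun x : R => 1 + x) 1.
    have := is_deriveD (is_derive_cst (1 : R) x 1) (is_derive_id x 1).
    by rewrite add0r.
  have d2 : is_derive x 1 (fun x : R => ln (1 + x)) ((1 + x)^-1 * 1).
    by apply: (@is_derive1_comp _ (@ln R) (fun x => 1 + x)); exact: is_derive1_ln.
  have d3 : is_derive x 1 (fun x : R => - (1 / 3) * ln (1 + x)) (- (1 / 3) * ((1 + x)^-1 * 1)).
    exact: is_deriveZ.
  have d4 : is_derive x 1 (fun x : R => expR (- (1 / 3) * ln (1 + x)))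
     (expR (- (1 / 3) * ln (1 + x)) * (- (1 / 3) * ((1 + x)^-1 * 1))).
    exact: (@is_derive1_comp _ expR (fun x => - (1 / 3) * ln (1 + x))).
  apply: (is_derive_eq (is_deriveZ (-3) d4)).
  rewrite /w43 gtr0_norm //.
  rewrite (_ : - (4 / 3) * ln (1 + x) = - (1 / 3) * ln (1 + x) - ln (1 + x)); last by field.
  rewrite expRD expRN lnK ?posrE // /GRing.scale /=; field.
  by rewrite gt_eqF.
have [||||//] := even_integral (l := 0) _ continuous_w43 _ D.
- by move=> x; exact: ltW (w43_gt0 x).
- by move=> x; rewrite /w43 normrN.
- apply: cvgM; first exact: cvg_cst.
  apply: continuous_comp; last exact: continuous_expR.
  apply: cvgM; first exact: cvg_cst.
  apply: continuous_comp; last by apply: continuous_ln; rewrite addr0.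
  by apply: cvgD; [exact: cvg_cst|exact: cvg_id].
- rewrite -[X in _ --> X](mulr0 (-3)); apply: cvgM; first exact: cvg_cst.
  have lny : (1 / 3) * ln (1 + x) @[x --> (+oo : set_system R)] --> +oo.
    apply/cvgryPge => A; near=> x.
    have x0 : expR (3 * A) <= x by near: x; apply: nbhs_pinfty_ge; rewrite num_real.
    have : 3 * A <= ln (1 + x).
      rewrite -[leLHS](expRK) ler_ln ?posrE ?expR_gt0 //.
        by apply: (le_trans x0); rewrite lerDr.
      by apply: (lt_le_trans (expR_gt0 (3 * A))); apply: (le_trans x0); rewrite lerDr.
    lra.
  have := cvg_comp (fun x : R => (1 / 3) * ln (1 + x)) (fun y => expR (- y)) lny (@cvgr_expR R).
  by apply: cvg_trans; apply: near_eq_cvg; apply: nearW => x /=; rewrite mulNr.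
Unshelve. all: by end_near. Qed.

End OneDimIntegrals.

Section Laplace.
Context {R : realType}.

Lemma rintegral_opp (f : R -> R) : measurable_fun setT f ->
  \int[l1 R]_x f (- x) = \int[l1 R]_x f x.
Proof.
move=> mf.
have N1 : (-1 : R) != 0 by rewrite oppr_eq0 oner_eq0.
rewrite (rintegral_cov (cov_affine 0 N1) mf).
by apply: eq_Rintegral => x _; rewrite normrN normr1 mulr1 addr0 mulN1r.
Qed.

Lemma cvg_expRN_lin (e : R) : 0 < e -> expR (- (e * x)) @[x --> +oo] --> 0.
Proof.
move=> e0.
have lny : e * x @[x --> +oo] --> +oo.
  apply/cvgryPge => A; near=> x.
  have : A / e <= x by near: x; apply: nbhs_pinfty_ge; rewrite num_real.
  by rewrite ler_pdivrMr // mulrC.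
by apply: (cvg_comp (fun x => e * x) (fun y => expR (- y)) lny); exact: cvgr_expR.
Unshelve. all: by end_near. Qed.

Lemma is_derive_expRlin (e x : R) :
  is_derive x 1 (fun x : R => expR (- (e * x))) (- (e * expR (- (e * x)))).
Proof.
have d1 : is_derive x 1 (fun x : R => - (e * x)) (- (e * 1)).
  exact: (is_deriveN (is_deriveZ e (is_derive_id x 1))).
have := @is_derive1_comp _ expR (fun x => - (e * x)) x _ _ (is_derive_expR _) d1.
by rewrite mulr1 mulrN mulrC.
Qed.

Lemma continuous_laplace (e : R) : continuous (fun x : R => expR (- (e * `|x|))).
Proof.
move=> x; apply: continuous_comp; last exact: continuous_expR.
apply: cvgN; apply: cvgM; first exact: cvg_cst.
exact: norm_continuous.
Qed.

Lemma laplace_integral (e : R) : 0 < e ->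
  rintegrable (l1 R) (fun x => expR (- (e * `|x|))) /\
  \int[l1 R]_x expR (- (e * `|x|)) = 2 / e.
Proof.
move=> e0.
pose F (x : R) := - e^-1 * expR (- (e * x)).
have D (x : R) : 0 < x -> is_derive x 1 F (expR (- (e * `|x|))).
  move=> x0; apply: (is_derive_eq (is_deriveZ (- e^-1) (is_derive_expRlin e x))).
  by rewrite gtr0_norm // /GRing.scale /=; field; rewrite gt_eqF.
have [||||i1 ->] := even_integral (l := 0) _ (@continuous_laplace e) _ D.
- by move=> x; exact: expR_ge0.
- by move=> x; rewrite normrN.
- apply: cvgM; first exact: cvg_cst.
  apply: continuous_comp; last exact: continuous_expR.
  by apply: cvgN; apply: cvgM; [exact: cvg_cst|exact: cvg_id].
- rewrite -[X in _ --> X](mulr0 (- e^-1)); apply: cvgM; first exact: cvg_cst.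
  exact: cvg_expRN_lin.
split=> //; rewrite /F mulr0 oppr0 expR0; field; by rewrite gt_eqF.
Qed.

(** [even_integral] wants a nonnegative integrand, so it is applied to the exponential times 1 + cos
    (c x), and [laplace_integral] is then subtracted. *)
Lemma laplace_cos_integral (e c : R) : 0 < e ->
  \int[l1 R]_x (expR (- (e * `|x|)) * cos (c * x)) = 2 * e / (e ^+ 2 + c ^+ 2).
Proof.
move=> e0.
have ec0 : e ^+ 2 + c ^+ 2 != 0 by rewrite gt_eqF // ltr_pwDl ?exprn_gt0 ?sqr_ge0.
pose E (x : R) := expR (- (e * x)).
pose F (x : R) := - e^-1 * E x + (e ^+ 2 + c ^+ 2)^-1 * (E x * (c * sin (c * x) - e * cos (c * x))).
have dc (x : R) : is_derive x 1 (fun x => cos (c * x)) (- sin (c * x) * (c * 1)).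
  exact: (@is_derive1_comp _ (@cos R) (fun x => c * x) x _ _ _ (is_deriveZ c (is_derive_id x 1))).
have ds (x : R) : is_derive x 1 (fun x => sin (c * x)) (cos (c * x) * (c * 1)).
  exact: (@is_derive1_comp _ (@sin R) (fun x => c * x) x _ _ _ (is_deriveZ c (is_derive_id x 1))).
have Fx (x : R) : is_derive x 1 F (E x * (1 + cos (c * x))).
  have d1 := is_deriveB (is_deriveZ c (ds x)) (is_deriveZ e (dc x)).
  have d2 := is_deriveM (is_derive_expRlin e x) d1.
  have d3 := is_deriveD (is_deriveZ (- e^-1) (is_derive_expRlin e x))
    (is_deriveZ (e ^+ 2 + c ^+ 2)^-1 d2).
  apply: (is_derive_eq d3).
  rewrite [X in _ + _ *: (_ + X *: _)](_ : _ = c * sin (c * x) - e * cos (c * x)) //.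
  rewrite /GRing.scale /= /E; field.
  by rewrite ec0 gt_eqF.
have Ccos : continuous (fun x : R => cos (c * x)).
  move=> x; apply: continuous_comp; last exact: continuous_cos.
  by apply: cvgM; [exact: cvg_cst|exact: cvg_id].
have Cg : continuous (fun x : R => expR (- (e * `|x|)) * (1 + cos (c * x))).
  move=> x; apply: cvgM; first exact: continuous_laplace.
  by apply: cvgD; [exact: cvg_cst|exact: Ccos].
have D (x : R) : 0 < x -> is_derive x 1 F (expR (- (e * `|x|)) * (1 + cos (c * x))).
  by move=> x0; rewrite gtr0_norm //; exact: Fx.
have [||||i1 i1E] := even_integral (l := 0) _ Cg _ D.
- by move=> x; rewrite mulr_ge0 ?expR_ge0 // -lerBlDl sub0r cos_geN1.
- by move=> x; rewrite normrN mulrN cosN.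
- apply: differentiable_continuous; apply/derivable1_diffP.
  by case: (Fx 0).
- have E0 := cvg_expRN_lin e0.
  rewrite -[X in _ --> X](addr0 0) -{1}(mulr0 (- e^-1)) -{2}(mulr0 (e ^+ 2 + c ^+ 2)^-1).
  apply: cvgD; apply: cvgM; try exact: cvg_cst; first exact: E0.
  apply/norm_cvg0P.
  apply: (squeeze_cvgr (f := fun=> 0) (h := fun x => E x * (`|c| + e))).
  + apply: nearW => x; rewrite normr_ge0 /= normrM ger0_norm ?expR_ge0 //.
    apply: ler_wpM2l; first exact: expR_ge0.
    apply: (le_trans (ler_normB _ _)); rewrite !normrM (gtr0_norm e0).
    apply: lerD; rewrite ler_piMr // ?(ltW e0) // ler_norml.
      by rewrite sin_geN1 sin_le1.
    by rewrite cos_geN1 cos_le1.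
  + exact: cvg_cst.
  + rewrite -[X in _ --> X](mul0r (`|c| + e)); apply: cvgM; last exact: cvg_cst.
    exact: E0.
have [il ilE] := laplace_integral e0.
transitivity (\int[l1 R]_x (expR (- (e * `|x|)) * (1 + cos (c * x)) - expR (- (e * `|x|)))).
  by apply: eq_Rintegral => x _; ring.
rewrite RintegralB // ilE i1E /F mulr0 sin0 cos0 /E mulr0 oppr0 expR0; field.
by rewrite ec0 gt_eqF.
Qed.

Lemma laplace_fourier (e q : R) : 0 < e ->
  cintegral (l1 R) (fun b => (expR (- (e * `|b|)))%:C%C * expi (2 * (q * b))) =
  (2 * e / (e ^+ 2 + 4 * q ^+ 2))%:C%C.
Proof.
move=> e0; apply: complex_eqP; rewrite /cintegral /=.
  rewrite (_ : 4 * q ^+ 2 = (2 * q) ^+ 2); last by ring.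
  rewrite -laplace_cos_integral //.
  by apply: eq_Rintegral => x _; rewrite mul0r subr0 mulrA.
(* The imaginary part integrates an odd function. *)
set I := \int[_]_x _.
suff : I = - I by move=> h; lra.
pose g (b : R) := expR (- (e * `|b|)) * sin (2 * (q * b)).
have cg : continuous g.
  move=> x; apply: cvgM; first exact: continuous_laplace.
  apply: continuous_comp; last exact: continuous_sin.
  by apply: cvgM; [exact: cvg_cst|apply: cvgM; [exact: cvg_cst|exact: cvg_id]].
have -> : I = \int[l1 R]_x g x by apply: eq_Rintegral => x _; rewrite mul0r addr0.
rewrite -{1}(rintegral_opp (continuous_measurable_fun cg)).
transitivity (\int[l1 R]_x (-1 * g x)).
  by apply: eq_Rintegral => x _; rewrite /g normrN !mulrN sinN mulN1r mulrN.
rewrite RintegralZl ?mulN1r //.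
have [il _] := laplace_integral e0.
apply: rintegrable_dom il _; first exact: continuous_measurable_fun.
move=> x; rewrite normrM ger0_norm ?expR_ge0 // ler_piMr ?expR_ge0 //.
by rewrite ler_norml sin_geN1 sin_le1.
Qed.

End Laplace.

(** * Integrals over products of lines *)

Section ProductIntegrals.
Context {R : realType}.

Lemma cov_prod d1 d2 d3 d4 (X1 : measurableType d1) (X2 : measurableType d2)
    (Y1 : measurableType d3) (Y2 : measurableType d4)
    (m1 : {sigma_finite_measure set X1 -> \bar R})
    (m2 : {sigma_finite_measure set X2 -> \bar R})
    (n1 : {sigma_finite_measure set Y1 -> \bar R})
    (n2 : {sigma_finite_measure set Y2 -> \bar R}) phi w psi v :
  cov m1 m2 phi w -> cov n1 n2 psi v ->
  cov (m1 \xs n1) (m2 \xs n2) (fun z => (phi z.1, psi z.2)) (fun z => w z.1 * v z.2).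
Proof.
move=> H1 H2.
have [mphi mw w0 _] := H1; have [mpsi mv v0 _] := H2.
have K1 : cov (m1 \xs n1) (m2 \xs n1) (fun z => (phi z.1, z.2)) (fun z => w z.1).
  apply: (@cov_fibL _ _ _ _ _ _ _ _ _ _ (fun z => phi z.1) (fun z => w z.1) set0) => //.
  - exact: (measurableT_comp mphi measurable_fst).
  - exact: (measurableT_comp mw measurable_fst).
have K2 : cov (m2 \xs n1) (m2 \xs n2) (fun z => (z.1, psi z.2)) (fun z => v z.2).
  apply: (@cov_fibR _ _ _ _ _ _ _ _ _ _ (fun z => psi z.2) (fun z => v z.2) set0) => //.
  - exact: (measurableT_comp mpsi measurable_snd).
  - exact: (measurableT_comp mv measurable_snd).
by apply: (cov_eq (cov_comp K1 K2)) => -[x y] //=; rewrite mulrC.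
Qed.

Lemma cintegrable_prod d1 d2 (T1 : measurableType d1) (T2 : measurableType d2)
    (m1 : {sigma_finite_measure set T1 -> \bar R})
    (m2 : {sigma_finite_measure set T2 -> \bar R}) (h1 : T1 -> R[i]) (h2 : T2 -> R[i]) :
  cintegrable m1 h1 -> cintegrable m2 h2 ->
  cintegrable (m1 \xs m2) (fun z => h1 z.1 * h2 z.2).
Proof.
move=> i1 i2.
apply: cintegrable_dom (rintegrable_prod (cintegrable_cabs i1) (cintegrable_cabs i2)) _.
  apply: cmeasM; first exact: (cmeas_comp (cintegrable_cmeas i1) measurable_fst).
  exact: (cmeas_comp (cintegrable_cmeas i2) measurable_snd).
by move=> z; exact: cabsM.
Qed.

Lemma cintegral_prod d1 d2 (T1 : measurableType d1) (T2 : measurableType d2)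
    (m1 : {sigma_finite_measure set T1 -> \bar R})
    (m2 : {sigma_finite_measure set T2 -> \bar R}) (h1 : T1 -> R[i]) (h2 : T2 -> R[i]) :
  cintegrable m1 h1 -> cintegrable m2 h2 ->
  cintegral (m1 \xs m2) (fun z => h1 z.1 * h2 z.2) = cintegral m1 h1 * cintegral m2 h2.
Proof.
move=> i1 i2; have [_ <-] := cfubini (cintegrable_prod i1 i2).
rewrite mulrC -cintegralMl //; apply: eq_cintegral => x /=.
by rewrite cintegralMl // mulrC.
Qed.

Lemma cintegrable_real d (T : measurableType d) (m : {measure set T -> \bar R}) (f : T -> R) :
  rintegrable m f -> cintegrable m (fun x => (f x)%:C%C).
Proof. by move=> fi; split => //; exact: integrable0. Qed.

Lemma cintegral_real d (T : measurableType d) (m : {measure set T -> \bar R}) (f : T -> R) :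
  cintegral m (fun x => (f x)%:C%C) = (\int[m]_x f x)%:C%C.
Proof. by apply: complex_eqP; rewrite /cintegral //= Rintegral_cst // mul0r. Qed.

Lemma cfubini2 d1 d2 (T1 : measurableType d1) (T2 : measurableType d2)
    (m1 : {sigma_finite_measure set T1 -> \bar R})
    (m2 : {sigma_finite_measure set T2 -> \bar R}) (h : T1 * T2 -> R[i]) :
  cintegrable (m1 \xs m2) h ->
  cintegrable m2 (fun y => cintegral m1 (fun x => h (x, y))) /\
  cintegral m2 (fun y => cintegral m1 (fun x => h (x, y))) = cintegral (m1 \xs m2) h.
Proof.
move=> ih; have S := cov_swap m2 m1.
have mh := cintegrable_cmeas ih.
have := (cintegrable_cov S mh).2 ih.
rewrite (_ : (fun x => _) = (fun z => h (z.2, z.1))); last by apply/funext => x; rewrite mul1r.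
move=> /cfubini[i1 e1]; split; first exact: i1.
rewrite e1 (cintegral_cov S mh); apply: eq_cintegral => x.
by rewrite mul1r.
Qed.

Definition prod3 (f : R -> R) (y : R * R * R) : R := f y.1.1 * f y.1.2 * f y.2.

Lemma rintegrable_prod3 f : rintegrable (l1 R) f -> rintegrable (l3 R) (prod3 f).
Proof. by move=> fi; exact: (rintegrable_prod (rintegrable_prod fi fi) fi). Qed.

Lemma prod3_ge0 f : (forall s, 0 <= f s) -> forall y, 0 <= prod3 f y.
Proof. by move=> f0 y; rewrite /prod3 !mulr_ge0. Qed.

Lemma rintegrableZ d (T : measurableType d) (m : {measure set T -> \bar R}) (c : R) (f : T -> R) :
  rintegrable m f -> rintegrable m (fun x => c * f x).
Proof. by move=> fi; have := integrableZl measurableT c fi. Qed.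

Lemma rintegrable_meas d (T : measurableType d) (m : {measure set T -> \bar R}) (f : T -> R) :
  rintegrable m f -> measurable_fun setT f.
Proof. by case/integrableP => /measurable_EFinP. Qed.

Lemma cov_scale3 (e : R) : 0 < e ->
  cov (l3 R) (l3 R) (fun s => (e * s.1.1, e * s.1.2, e * s.2)) (fun=> e ^+ 3).
Proof.
move=> e0; have e1 : e != 0 by rewrite gt_eqF.
have A : cov (l1 R) (l1 R) (fun s => e * s) (fun=> e).
  by apply: (cov_eq (cov_affine 0 e1)) => s; rewrite ?addr0 ?gtr0_norm.
apply: (cov_eq (cov_prod (cov_prod A A) A)) => // s.
by rewrite exprS expr2 mulrA.
Qed.

End ProductIntegrals.

(** * Fourier inversion at a point of R^3 *)

Section FourierInversion.
Context {R : realType}.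
Local Notation R3 := (L3 R).

Definition dot3 (q b : R * R * R) : R := q.1.1 * b.1.1 + q.1.2 * b.1.2 + q.2 * b.2.

Lemma measurable_dot3 d (T : measurableType d) (f g : T -> R3) :
  measurable_fun setT f -> measurable_fun setT g -> measurable_fun setT (fun x => dot3 (f x) (g x)).
Proof.
move=> mf mg; rewrite /dot3.
have m11 := measurableT_comp measurable_fst measurable_fst : measurable_fun setT (fun q : R3 =>
  q.1.1).
have m12 := measurableT_comp measurable_snd measurable_fst : measurable_fun setT (fun q : R3 =>
  q.1.2).
have m2 := measurable_snd : measurable_fun setT (fun q : R3 => q.2).
apply: measurable_funD; first apply: measurable_funD; apply: measurable_funM.
- exact: (measurableT_comp m11 mf).
- exact: (measurableT_comp m11 mg).
- exact: (measurableT_comp m12 mf).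
- exact: (measurableT_comp m12 mg).
- exact: (measurableT_comp m2 mf).
- exact: (measurableT_comp m2 mg).
Qed.

Definition lap (e s : R) : R := expR (- (e * `|s|)).

(** The exponential regulator factorizes over the coordinates, and its transform is a product of
    Poisson kernels of width proportional to [e]. *)
Lemma lap3_fourier (e : R) (q : R3) : 0 < e ->
  cintegral (l3 R) (fun b => (prod3 (lap e) b)%:C%C * expi (2 * dot3 q b)) =
  (prod3 (fun s => 2 * e / (e ^+ 2 + 4 * s ^+ 2)) q)%:C%C.
Proof.
move=> e0.
pose h (s b : R) := (lap e b)%:C%C * expi (2 * (s * b)).
have ih s : cintegrable (l1 R) (h s).
  apply: (cintegrable_dom _ (rintegrableZ 2 (laplace_integral e0).1)).
    apply: cmeasM.
      by apply: cmeas_real; apply: continuous_measurable_fun; exact: continuous_laplace.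
    by apply: cmeas_expi; apply: measurable_funM => //; exact: measurable_funM.
  move=> b; apply: (le_trans (cabsM _ _)); rewrite cabs_real mulrC.
  by rewrite ger0_norm ?expR_ge0 // ler_wpM2r ?expR_ge0 // cabs_expi.
transitivity (cintegral (l3 R) (fun b => (h q.1.1 b.1.1 * h q.1.2 b.1.2) * h q.2 b.2)).
  apply: eq_cintegral => b; rewrite /h /prod3 /dot3 !mulrDr !expiD !rmorphM /=.
  ring.
rewrite (cintegral_prod (cintegrable_prod (ih q.1.1) (ih q.1.2)) (ih q.2)).
rewrite (cintegral_prod (ih q.1.1) (ih q.1.2)) /h !laplace_fourier //.
by rewrite /prod3 !rmorphM.
Qed.

Lemma pois_integral : rintegrable (l1 R) (fun s => 2 / (1 + 4 * s ^+ 2)) /\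
  \int[l1 R]_s (2 / (1 + 4 * s ^+ 2)) = pi.
Proof.
have n2 : (2 : R) != 0 by rewrite pnatr_eq0.
have A := cov_affine 0 n2.
have mcw : measurable_fun setT (@cw R).
  by apply: continuous_measurable_fun; exact: continuous_cw.
have E (s : R) : cw (2 * s + 0) * `|2| = 2 / (1 + 4 * s ^+ 2).
  rewrite addr0 /cw ger0_norm // mulrC; congr (_ / (_ + _)).
  by rewrite exprMn; congr (_ * _); rewrite -natrX.
have [i1 <-] := @cw_integral R; split.
  by have := (rintegrable_cov A mcw).2 i1; apply: eq_integrable => // s _; rewrite E.
by rewrite (rintegral_cov A mcw); apply: eq_Rintegral => s _; rewrite E.
Qed.

(** Abel summation. The convergence of [psi] is required along the sequences that shrink a point to
    the origin, which is what dominated convergence uses after rescaling. The phase [2 * dot3 q b]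
    turns the usual (2 pi)^3 into [pi ^+ 3]. *)
Lemma fourier_inversion3 (psi : R3 -> R[i]) (C : R) : cintegrable (l3 R) psi ->
  (forall q, cabs (psi q) <= C) ->
  (forall s : R3, (fun n => complex.Re (psi (harmonic n * s.1.1, harmonic n * s.1.2, harmonic n *
    s.2)))
      @ \oo --> complex.Re (psi (0, 0, 0))) ->
  (forall s : R3, (fun n => complex.Im (psi (harmonic n * s.1.1, harmonic n * s.1.2, harmonic n *
    s.2)))
      @ \oo --> complex.Im (psi (0, 0, 0))) ->
  cintegrable (l3 R) (fun b => cintegral (l3 R) (fun q => psi q * expi (2 * dot3 q b))) ->
  cintegral (l3 R) (fun b => cintegral (l3 R) (fun q => psi q * expi (2 * dot3 q b))) =
  (pi ^+ 3)%:C%C * psi (0, 0, 0).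
Proof.
move=> ipsi psiC cre cim ihat.
have mpsi := cintegrable_cmeas ipsi.
set psih := (fun b => cintegral (l3 R) _) in ihat *.
pose e (n : nat) : R := harmonic n.
have e0 n : 0 < e n by exact: harmonic_gt0.
have lap0 n y : 0 <= prod3 (lap (e n)) y by apply: prod3_ge0 => s; exact: expR_ge0.
have lap1 n y : prod3 (lap (e n)) y <= 1.
  have l1 s : lap (e n) s <= 1.
    by rewrite /lap -expR0 ler_expR oppr_le0 mulr_ge0 // ltW.
  by rewrite /prod3 !mulr_ile1 ?mulr_ge0 ?expR_ge0.
have ilap n : rintegrable (l3 R) (prod3 (lap (e n))).
  exact: (rintegrable_prod3 (laplace_integral (e0 n)).1).
(* Fubini computes the Laplace-regularized integral J n in two ways. *)
pose J n := cintegral (l3 R) (fun b => (prod3 (lap (e n)) b)%:C%C * psih b).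
have JE n : J n = cintegral (l3 R) (fun s =>
    (prod3 (fun s => 2 / (1 + 4 * s ^+ 2)) s)%:C%C *
    psi (e n * s.1.1, e n * s.1.2, e n * s.2)).
  pose g (z : R3 * R3) := (prod3 (lap (e n)) z.1)%:C%C * psi z.2 * expi (2 * dot3 z.2 z.1).
  have ig : cintegrable (l3 R \xs l3 R) g.
    apply: (cintegrable_dom _ (rintegrable_prod (rintegrableZ 2 (ilap n)) (cintegrable_cabs ipsi))).
      apply: cmeasM; first apply: cmeasM.
      - apply: cmeas_real.
        exact: (measurableT_comp (rintegrable_meas (ilap n)) measurable_fst).
      - exact: (cmeas_comp mpsi measurable_snd).
      - apply: cmeas_expi; apply: measurable_funM => //.
        by apply: measurable_dot3; [exact: measurable_snd|exact: measurable_fst].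
    move=> z; apply: (le_trans (cabsM _ _)).
    rewrite cabs_realM ger0_norm // mulrC mulrA.
    by do 2 (apply: ler_wpM2r => //; rewrite ?cabs_ge0 //); rewrite cabs_expi.
  have -> : J n = cintegral (l3 R) (fun b => cintegral (l3 R) (fun q => g (b, q))).
    apply: eq_cintegral => b; rewrite /psih -cintegralMl.
      by apply: eq_cintegral => q; rewrite mulrA.
    apply: (cintegrable_dom _ (rintegrableZ 2 (cintegrable_cabs ipsi))).
      by apply: cmeasM => //; apply: cmeas_expi; apply: measurable_funM => //; exact:
        measurable_dot3.
    move=> q; apply: (le_trans (cabsM _ _)); rewrite mulrC.
    by apply: ler_wpM2r; [exact: cabs_ge0|exact: cabs_expi].
  have [_ ->] := cfubini ig; have [_ <-] := cfubini2 ig.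
  have mlp q : cintegrable (l3 R) (fun b => (prod3 (lap (e n)) b)%:C%C * expi (2 * dot3 q b)).
    apply: (cintegrable_dom _ (rintegrableZ 2 (ilap n))).
      apply: cmeasM; first by apply: cmeas_real; exact: rintegrable_meas (ilap n).
      by apply: cmeas_expi; apply: measurable_funM => //; exact: measurable_dot3.
    move=> b; rewrite cabs_realM ger0_norm // mulrC.
    by apply: ler_wpM2r => //; exact: cabs_expi.
  (* Substituting q = e s makes the Poisson kernel independent of [n] and moves the parameter into
     the argument of [psi]. *)
  have cS := cov_scale3 (e0 n).
  transitivity (cintegral (l3 R) (fun q => psi q *
      (prod3 (fun s => 2 * e n / (e n ^+ 2 + 4 * s ^+ 2)) q)%:C%C)).
    apply: eq_cintegral => q; rewrite -lap3_fourier // -cintegralMl //.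
    by apply: eq_cintegral => b; rewrite /g /= mulrA (mulrC (psi q)).
  rewrite (cintegral_cov cS).
    apply: eq_cintegral => s /=.
    rewrite [X in _ * X = _]mulrC mulrA; congr (_ * _).
    rewrite -rmorphM; congr ((_)%:C%C); rewrite /prod3 /=.
    have P (t : R) : 1 + 4 * t ^+ 2 != 0 by rewrite gt_eqF // ltr_pwDl // mulr_ge0 ?sqr_ge0.
    have Q (t : R) : e n ^+ 2 + 4 * (e n * t) ^+ 2 = e n ^+ 2 * (1 + 4 * t ^+ 2).
      by rewrite exprMn; ring.
    rewrite !Q; field.
    by rewrite !P gt_eqF.
  apply: cmeasM => //; apply: cmeas_real; rewrite /prod3.
  have mp : measurable_fun setT (fun s : R => 2 * e n / (e n ^+ 2 + 4 * s ^+ 2)).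
    apply: continuous_measurable_fun => s; apply: cvgM; first exact: cvg_cst.
    apply: cvgV; first by rewrite gt_eqF // ltr_pwDl ?exprn_gt0 // mulr_ge0 ?sqr_ge0.
    apply: cvgD; first exact: cvg_cst.
    by apply: cvgM; [exact: cvg_cst|exact: exprn_continuous].
  apply: measurable_funM; first apply: measurable_funM.
  - exact: (measurableT_comp mp (measurableT_comp measurable_fst measurable_fst)).
  - exact: (measurableT_comp mp (measurableT_comp measurable_snd measurable_fst)).
  - exact: (measurableT_comp mp measurable_snd).
have [ip ipE] := pois_integral.
have ip3 := rintegrable_prod3 ip.
pose p3 := prod3 (fun s : R => 2 / (1 + 4 * s ^+ 2)).
have p30 y : 0 <= p3 y.
  by apply: prod3_ge0 => s; rewrite divr_ge0 // addr_ge0 // mulr_ge0 ?sqr_ge0.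
(* First evaluation of the limit: the regulator tends to 1, and the integrable [psih] dominates. *)
have limit1 : (fun n => complex.Re (J n)) @ \oo --> complex.Re (cintegral (l3 R) psih) /\
    (fun n => complex.Im (J n)) @ \oo --> complex.Im (cintegral (l3 R) psih).
  have mlap n : cmeas (fun b : R3 => (prod3 (lap (e n)) b)%:C%C).
    by apply: cmeas_real; exact: rintegrable_meas (ilap n).
  have cl (t : R) : (fun n => lap (e n) t) @ \oo --> (1 : R).
    rewrite -expR0; apply: (cvg_comp (fun n => - (e n * `|t|)) (@expR R)); last exact:
      continuous_expR.
    rewrite -oppr0; apply: cvgN; rewrite -[X in _ --> X](mul0r `|t|).
    by apply: cvgM; [exact: cvg_harmonic|exact: cvg_cst].
  have cl3 b : (fun n => prod3 (lap (e n)) b) @ \oo --> (1 : R).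
    rewrite /prod3 -[X in _ --> X](mulr1 1) -{1}(mulr1 1).
    by apply: cvgM; [apply: cvgM|].
  apply: (cdct (g' := fun b => cabs (psih b))).
  - by move=> n; exact: (cmeasM (mlap n) (cintegrable_cmeas ihat)).
  - move=> b; rewrite -[X in _ --> X]mul1r.
    under eq_fun do rewrite ReM /= mul0r subr0.
    by apply: cvgM => //; exact: cvg_cst.
  - move=> b; rewrite -[X in _ --> X]mul1r.
    under eq_fun do rewrite ImM /= mul0r addr0.
    by apply: cvgM => //; exact: cvg_cst.
  - exact: cintegrable_cabs.
  - move=> n b; rewrite cabs_realM ger0_norm //.
    by rewrite ler_piMl // cabs_ge0.
(* Second evaluation: [psi] is taken ever closer to the origin against a fixed kernel of mass
   [pi ^+ 3], and the bound [C] gives the domination. *)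
have limit2 : (fun n => complex.Re (J n)) @ \oo -->
      complex.Re (cintegral (l3 R) (fun s => (p3 s)%:C%C * psi (0, 0, 0))) /\
    (fun n => complex.Im (J n)) @ \oo -->
      complex.Im (cintegral (l3 R) (fun s => (p3 s)%:C%C * psi (0, 0, 0))).
  have ms n : measurable_fun setT (fun s : R3 => (e n * s.1.1, e n * s.1.2, e n * s.2)).
    by case: (cov_scale3 (e0 n)).
  pose H n (s : R3) := (p3 s)%:C%C * psi (e n * s.1.1, e n * s.1.2, e n * s.2).
  have -> : J = (fun n => cintegral (l3 R) (H n)) by apply/funext.
  apply: (@cdct _ _ _ (l3 R) H _ (fun s => C * p3 s)).
  - move=> n; apply: cmeasM; first by apply: cmeas_real; exact: rintegrable_meas ip3.
    exact: (cmeas_comp mpsi (ms n)).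
  - move=> b; rewrite ReM /= mul0r subr0.
    under eq_fun do rewrite ReM /= mul0r subr0.
    by apply: cvgM => //; exact: cvg_cst.
  - move=> b; rewrite ImM /= mul0r addr0.
    under eq_fun do rewrite ImM /= mul0r addr0.
    by apply: cvgM => //; exact: cvg_cst.
  - exact: rintegrableZ.
  - move=> n b; rewrite cabs_realM ger0_norm ?p30 // mulrC.
    by apply: ler_wpM2r.
have <- : cintegral (l3 R) (fun s => (p3 s)%:C%C * psi (0, 0, 0)) = (pi ^+ 3)%:C%C * psi (0, 0, 0).
  under eq_cintegral do rewrite mulrC.
  rewrite cintegralMl; last exact: cintegrable_real.
  rewrite mulrC; congr (_ * _).
  have iC := cintegrable_real ip.
  have := cintegral_prod (cintegrable_prod iC iC) iC.
  rewrite (cintegral_prod iC iC) cintegral_real ipE => h.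
  transitivity (pi%:C%C * pi%:C%C * pi%:C%C : R[i]); last by rewrite !exprSr expr0 mul1r !rmorphM.
  rewrite -h; apply: eq_cintegral => s; by rewrite /p3 /prod3 !rmorphM.
case: limit1 limit2 => [a1 a2] [b1 b2]; apply: complex_eqP.
  exact: (cvg_unique _ a1 b1).
exact: (cvg_unique _ a2 b2).
Qed.

End FourierInversion.

(** * Coordinates and weights on R^6 *)

Section SixDim.
Context {R : realType}.

Definition dot6 (p x : R6 R) : R :=
  p.1.1.1.1.1 * x.1.1.1.1.1 + p.1.1.1.1.2 * x.1.1.1.1.2 + p.1.1.1.2 * x.1.1.1.2 +
  p.1.1.2 * x.1.1.2 + p.1.2 * x.1.2 + p.2 * x.2.

Definition prod6 (f : R -> R) (x : R6 R) : R :=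
  f x.1.1.1.1.1 * f x.1.1.1.1.2 * f x.1.1.1.2 * f x.1.1.2 * f x.1.2 * f x.2.

Lemma prod6_gt0 f x : (forall s, 0 < f s) -> 0 < prod6 f x.
Proof. by move=> f0; rewrite /prod6 !mulr_gt0. Qed.

Lemma rintegrable_prod6 f : rintegrable (l1 R) f -> rintegrable (l6 R) (prod6 f).
Proof.
move=> fi; have i3 : rintegrable (l3 R) (prod3 f) := rintegrable_prod3 fi.
have i5 : rintegrable (l5 R) (fun z : L5 R => prod3 f z.1.1 * f z.1.2 * f z.2).
  exact: (rintegrable_prod (rintegrable_prod i3 fi) fi).
exact: (rintegrable_prod i5 fi).
Qed.

Definition coord6 (i : nat) (x : R6 R) : R :=
  match i with 0 => x.1.1.1.1.1 | 1 => x.1.1.1.1.2 | 2 => x.1.1.1.2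
             | 3 => x.1.1.2 | 4 => x.1.2 | _ => x.2 end.

Definition basis6 (i : nat) : R6 R :=
  let e j : R := (i == j)%:R in (e 0%N, e 1%N, e 2%N, e 3%N, e 4%N, e 5%N).

Lemma dot6_basis6 i x : (i < 6)%N -> dot6 (basis6 i) x = coord6 i x.
Proof. by case: i => [|[|[|[|[|[|//]]]]]] _; rewrite /dot6 /basis6 /coord6 /=; ring. Qed.

Lemma dot6D p q x : dot6 (p + q) x = dot6 p x + dot6 q x.
Proof. rewrite /dot6 /=; ring. Qed.

Lemma dot6Z (c : R) p x : dot6 (c *: p) x = c * dot6 p x.
Proof. rewrite /dot6 /= /GRing.scale /=; ring. Qed.

Lemma norm_pair (U V : normedModType R) (x : U * V) : `|x| = Num.max `|x.1| `|x.2|.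
Proof. by []. Qed.

Lemma coord6_le_norm i (x : R6 R) : `|coord6 i x| <= `|x|.
Proof.
by case: i => [|[|[|[|[|i]]]]] /=; rewrite !norm_pair !le_max lexx ?orbT.
Qed.

Lemma norm_basis6 i : `|basis6 i| <= 1.
Proof.
have e j : `|(i == j)%:R : R| <= 1 by case: (i == j); rewrite ?normr1 // normr0.
by rewrite !norm_pair /= !ge_max !e.
Qed.

(** The product norm is the maximum of the coordinates, so each of the six factors satisfies 1 +
    x_i^2 <= (1 + |x|)^2; hence the exponent 12. *)
Lemma cw_decay (x : R6 R) : ((1 + `|x|) ^+ 12)^-1 <= prod6 cw x.
Proof.
have c i : (((1 + `|x|) ^+ 2)^-1 <= cw (coord6 i x)).
  rewrite lef_pV2 ?posrE ?exprn_gt0 ?ltr_pwDl ?sqr_ge0 //.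
  rewrite -normr_id -(ger0_norm (sqr_ge0 (coord6 i x))) normrX.
  have := coord6_le_norm i x; have := normr_ge0 (coord6 i x); rewrite normr_id; nra.
have p0 : 0 <= ((1 + `|x|) ^+ 2)^-1 by rewrite invr_ge0 exprn_ge0 // addr_ge0.
move: p0; set a := (_ ^+ 2)^-1 in c * => a0.
rewrite -[12%N]/(2 * 6)%N exprM -exprVn -/a (_ : a ^+ 6 = a * a * a * a * a * a); last by ring.
have := c 0%N; have := c 1%N; have := c 2%N; have := c 3%N; have := c 4%N; have := c 5%N.
rewrite /prod6 /coord6 => c5 c4 c3 c2 c1 c0.
by do 4 (apply: ler_pM => //; first by rewrite ?mulr_ge0); apply: ler_pM.
Qed.

(** The sigma-algebra is that of the iterated product, so the variables are peeled off one at a time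
    with [measurable_caratheodory]; fixing the last variable preserves continuity of the rest. *)
Lemma continuous_measurable6 (g : R6 R -> R) : continuous g ->
  measurable_fun (setT : set (L6 R)) g.
Proof.
move=> cg.
have pc (U V : topologicalType) (v : V) : continuous (fun u : U => (u, v)).
  by move=> u; apply: cvg_pair; [exact: cvg_id|exact: cvg_cst].
have cp (U V : topologicalType) (u : U) : continuous (fun v : V => (u, v)).
  by move=> v; apply: cvg_pair; [exact: cvg_cst|exact: cvg_id].
apply: measurable_caratheodory => [s6|t s]; last first.
  by apply: continuous_comp; [exact: cp|exact: cg].
have {cg} : continuous (fun t : R5 R => g (t, s6)).
  by move=> t; apply: continuous_comp; [exact: pc|exact: cg].
move: (fun t : R5 R => g (t, s6)) => {}g cg.
apply: measurable_caratheodory => [s5|t s]; last first.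
  by apply: continuous_comp; [exact: cp|exact: cg].
have {cg} : continuous (fun t : R * R * R * R => g (t, s5)).
  by move=> t; apply: continuous_comp; [exact: pc|exact: cg].
move: (fun t : R * R * R * R => g (t, s5)) => {}g cg.
apply: measurable_caratheodory => [s4|t s]; last first.
  by apply: continuous_comp; [exact: cp|exact: cg].
have {cg} : continuous (fun t : R * R * R => g (t, s4)).
  by move=> t; apply: continuous_comp; [exact: pc|exact: cg].
move: (fun t : R * R * R => g (t, s4)) => {}g cg.
apply: measurable_caratheodory => [s3|t s]; last first.
  by apply: continuous_comp; [exact: cp|exact: cg].
have {cg} : continuous (fun t : R * R => g (t, s3)).
  by move=> t; apply: continuous_comp; [exact: pc|exact: cg].
move: (fun t : R * R => g (t, s3)) => {}g cg.
apply: measurable_caratheodory => [s2|t s]; last first.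
  by apply: continuous_comp; [exact: cp|exact: cg].
apply: continuous_measurable_fun => t.
by apply: continuous_comp; [exact: pc|exact: cg].
Qed.

Lemma cov_translate6 (a : R6 R) : cov (l6 R) (l6 R) (fun p : R6 R => p + a) (fun=> 1).
Proof.
have A (c : R) : cov (l1 R) (l1 R) (fun t : R => t + c) (fun=> 1).
  by apply: (cov_eq (cov_affine c (@oner_neq0 R))) => t; rewrite ?mul1r ?normr1.
case: a => [[[[[a1 a2] a3] a4] a5] a6].
have A3 : cov (l3 R) (l3 R) (fun p : R * R * R => p + (a1, a2, a3)) (fun=> 1).
  apply: (cov_eq (cov_prod (cov_prod (A a1) (A a2)) (A a3))) => [[[p1 p2] p3]|p] //.
  by rewrite !mulr1.
have A5 : cov (l5 R) (l5 R) (fun p : R5 R => p + (a1, a2, a3, a4, a5)) (fun=> 1).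
  apply: (cov_eq (cov_prod (cov_prod A3 (A a4)) (A a5))) => [[[p1 p2] p3]|p] //.
  by rewrite !mulr1.
apply: (cov_eq (cov_prod A5 (A a6))) => [[p1 p2]|p] //.
by rewrite !mulr1.
Qed.

End SixDim.

(** * Decay of the Fourier transform of a Schwartz function on R^6 *)

Section SchwartzFourier.
Context {R : realType}.
Implicit Types (g : R6 R -> R).

Lemma schwartz_derive g (v : R6 R) : schwartz_real g -> schwartz_real ('D_v g).
Proof.
move=> [sg bg].
have E vs : iter_derive vs ('D_v g) = iter_derive (rcons vs v) g.
  by rewrite /iter_derive foldr_rcons.
by split=> [vs x _|vs m]; rewrite E; [exact: sg|exact: bg].
Qed.

Lemma schwartz_continuous g : schwartz_real g -> continuous g.
Proof. by move=> [sg _] x; case: (sg [::] x I). Qed.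

Lemma schwartz_decay g : schwartz_real g -> exists2 C, 0 <= C & forall x, `|g x| <= C * prod6 cw x.
Proof.
move=> [_ bg]; have [C HC] := bg [::] 12%N.
have p0 (x : R6 R) : 0 < (1 + `|x|) ^+ 12 by rewrite exprn_gt0 // ltr_pwDl.
have C0 : 0 <= C.
  by apply: le_trans (HC 0); rewrite mulr_ge0 // ltW.
exists C => // x; apply: (@le_trans _ _ (C * ((1 + `|x|) ^+ 12)^-1)).
  by rewrite ler_pdivlMr // mulrC.
by apply: ler_wpM2l => //; exact: cw_decay.
Qed.

(** The mean value theorem replaces the quotient by a derivative at [x + c *: v], where |c v| <= 1.
    Moving the base point back to [x] costs a factor 2 in 1 + |x|, whence [2 ^+ 12]. The bound is
    uniform in [h], as dominated convergence requires. *)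
Lemma schwartz_difference g (v : R6 R) : `|v| <= 1 -> schwartz_real g ->
  exists2 C, 0 <= C & forall (h : R) x, 0 < h -> h <= 1 ->
    `|h^-1 * (g (x + h *: v) - g x)| <= C * prod6 cw x.
Proof.
move=> v1 sg; have [_ /(_ [::] 12%N)[C HC]] := schwartz_derive v sg.
have p0 (x : R6 R) : 0 < (1 + `|x|) ^+ 12 by rewrite exprn_gt0 // ltr_pwDl.
have C0 : 0 <= C.
  by apply: le_trans (HC 0); rewrite mulr_ge0 // ltW.
exists (C * 2 ^+ 12); first by rewrite mulr_ge0 // exprn_ge0.
move=> h x h0 h1.
pose k (t : R) := g (x + t *: v).
have dk (t : R) : is_derive t 1 k ('D_v g (x + t *: v)).
  have [_ /(_ v) dg] := sg.1 [::] (x + t *: v) I.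
  have E : (fun s : R => s^-1 *: (k (s + t) - k t)) = (fun s => s^-1 *: (g (s *: v + (x + t *: v))
    - g (x + t *: v))).
    by apply/funext => s; rewrite /k scalerDl addrCA.
  have dgl : s^-1 *: (k (s *: 1 + t) - k t) @[s --> (0:R)^'] --> 'D_v g (x + t *: v).
    under eq_fun do rewrite [_ *: 1]mulr1.
    by rewrite E; exact: dg.
  apply: DeriveDef; first by apply/cvg_ex; exists ('D_v g (x + t *: v)).
  exact: cvg_lim dgl.
have ck : {within `[0, h], continuous k}.
  apply: derivable_within_continuous => t _; by case: (dk t).
have [c ch E] := MVT h0 (fun t _ => dk t) ck.
have -> : g (x + h *: v) - g x = 'D_v g (x + c *: v) * h.
  by rewrite -(subr0 h) -E /k scale0r addr0 subr0.
rewrite mulrC mulfK ?gt_eqF //.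
move: ch; rewrite in_itv /= => /andP[c0 c1].
have := HC (x + c *: v); rewrite /=.
set D := 'D_v g _ => HD.
apply: (@le_trans _ _ (C * 2 ^+ 12 * ((1 + `|x|) ^+ 12)^-1)); last first.
  apply: ler_wpM2l; first by rewrite mulr_ge0 // exprn_ge0.
  exact: cw_decay.
rewrite ler_pdivlMr //.
apply: (@le_trans _ _ (`|D| * (2 * (1 + `|x + c *: v|)) ^+ 12)).
  apply: ler_wpM2l => //; apply: lerXn2r; rewrite ?nnegrE ?mulr_ge0 ?addr_ge0 //.
  have cv : `|c *: v| <= 1.
    rewrite normrZ gtr0_norm //; apply: mulr_ile1; rewrite ?(ltW c0) //.
    by apply: ltW; apply: lt_le_trans c1 h1.
  have : `|x| <= `|x + c *: v| + `|c *: v|.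
    by rewrite -{1}(addrK (c *: v) x); exact: ler_normB.
  have := normr_ge0 (x + c *: v); lra.
rewrite exprMn mulrCA mulrC; apply: ler_wpM2r; first by rewrite exprn_ge0.
by rewrite mulrC.
Qed.

(** The Fourier transform in the normalization of [pairing], which is [2 * dot6] in coordinates. *)
Definition fhat (h : R6 R -> R[i]) (x : R6 R) : R[i] :=
  cintegral (l6 R) (fun p : R6 R => h p * expi (2 * dot6 p x)).

Lemma measurable_dot6 d (T : measurableType d) (f g : T -> L6 R) :
  measurable_fun setT f -> measurable_fun setT g -> measurable_fun setT (fun x => dot6 (f x) (g x)).
Proof.
move=> mf mg; rewrite /dot6.
have m1 := measurable_fst; have m2 := measurable_snd.
have M1 k (U : measurableType k) (k' : measure_display) (V : measurableType k') (W :
  measure_display) 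
  (Z : measurableType W) (q : Z -> U * V) : measurable_fun setT q ->
   measurable_fun setT (fun z => (q z).1) /\ measurable_fun setT (fun z => (q z).2).
  by move=> mq; split; [exact: (measurableT_comp measurable_fst mq)|exact: (measurableT_comp
    measurable_snd mq)].
have [f5 f6] := M1 _ _ _ _ _ _ _ mf; have [f4 f5'] := M1 _ _ _ _ _ _ _ f5.
have [f3 f4'] := M1 _ _ _ _ _ _ _ f4; have [f2 f3'] := M1 _ _ _ _ _ _ _ f3.
have [f1 f2'] := M1 _ _ _ _ _ _ _ f2.
have [g5 g6] := M1 _ _ _ _ _ _ _ mg; have [g4 g5'] := M1 _ _ _ _ _ _ _ g5.
have [g3 g4'] := M1 _ _ _ _ _ _ _ g4; have [g2 g3'] := M1 _ _ _ _ _ _ _ g3.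
have [g1 g2'] := M1 _ _ _ _ _ _ _ g2.
by do 5 (apply: measurable_funD; last exact: measurable_funM); exact: measurable_funM.
Qed.

Lemma cmeas_phase6 (x : R6 R) : cmeas (fun p : L6 R => expi (2 * dot6 p x)).
Proof.
apply: cmeas_expi; apply: measurable_funM => //.
by apply: measurable_dot6; [exact: measurable_id|exact: measurable_cst].
Qed.

Lemma fhat_integrand g x : schwartz_real g ->
  cintegrable (l6 R) (fun p : L6 R => (g p)%:C%C * expi (2 * dot6 p x)).
Proof.
move=> sg; have [C C0 HC] := schwartz_decay sg.
have i6 := rintegrable_prod6 (@cw_integral R).1.
apply: (cintegrable_dom _ (rintegrableZ (2 * C) i6)).
  apply: cmeasM; last exact: cmeas_phase6.
  by apply: cmeas_real; apply: continuous_measurable6; exact: schwartz_continuous.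
move=> p; rewrite cabs_realM mulrC -mulrA.
by apply: ler_pM; rewrite ?cabs_ge0 ?cabs_expi.
Qed.

Lemma fhat_translate g (a x : R6 R) : schwartz_real g ->
  cintegral (l6 R) (fun p : L6 R => (g (p + a : R6 R))%:C%C * expi (2 * dot6 p x)) =
  expi (- (2 * dot6 a x)) * fhat (fun p => (g p)%:C%C) x.
Proof.
move=> sg; have ig := fhat_integrand x sg.
rewrite /fhat -cintegralMl // [RHS](cintegral_cov (cov_translate6 a)); last first.
  apply: cmeasM; first exact: cmeas_cst.
  exact: cintegrable_cmeas ig.
apply: eq_cintegral => p; rewrite mul1r mulrCA -expiD; congr (_ * expi _).
by rewrite dot6D; ring.
Qed.

Lemma cvg_cMr (u : nat -> R[i]) (l z : R[i]) :
  (fun n => complex.Re (u n)) @ \oo --> complex.Re l ->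
  (fun n => complex.Im (u n)) @ \oo --> complex.Im l ->
  (fun n => complex.Re (u n * z)) @ \oo --> complex.Re (l * z) /\
  (fun n => complex.Im (u n * z)) @ \oo --> complex.Im (l * z).
Proof.
move=> ur ui; rewrite ReM ImM.
have Er : (fun n => complex.Re (u n * z)) =
    (fun n => complex.Re (u n) * complex.Re z - complex.Im (u n) * complex.Im z).
  by apply/funext => n; rewrite ReM.
have Ei : (fun n => complex.Im (u n * z)) =
    (fun n => complex.Re (u n) * complex.Im z + complex.Im (u n) * complex.Re z).
  by apply/funext => n; rewrite ImM.
rewrite Er Ei; split.
  by apply: cvgB; apply: cvgM => //; exact: cvg_cst.
by apply: cvgD; apply: cvgM => //; exact: cvg_cst.
Qed.

Lemma cvg_realM (u : nat -> R) (l : R) (z : R[i]) : u @ \oo --> l ->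
  (fun n => complex.Re ((u n)%:C%C * z)) @ \oo --> complex.Re (l%:C%C * z) /\
  (fun n => complex.Im ((u n)%:C%C * z)) @ \oo --> complex.Im (l%:C%C * z).
Proof. by move=> ul; apply: cvg_cMr => //=; exact: cvg_cst. Qed.

Lemma cvg_harmonic_dnbhs : (fun n => harmonic n : R) @ \oo --> (0 : R)^'.
Proof.
move=> A /= [e e0 eA]; move/cvgrPdist_lt : (@cvg_harmonic R) => /(_ e e0).
by apply: filterS => n hn; apply: eA => //=; rewrite gt_eqF // harmonic_gt0.
Qed.

Lemma is_derive_harmonic (k : R -> R) (d : R) : is_derive (0 : R) 1 k d ->
  (fun n => (harmonic n)^-1 * (k (harmonic n) - k 0)) @ \oo --> d.
Proof.
move=> [dk dE]; have := cvg_comp _ _ cvg_harmonic_dnbhs dk.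
rewrite -[lim _]/('D_1 k 0) dE; apply: cvg_trans; apply: near_eq_cvg; apply: nearW => n /=.
by rewrite [_ *: 1]mulr1 addr0.
Qed.

(** In place of integration by parts, the difference quotient of [g] is transformed: translation
    invariance gives the factor (exp(-2 i h x_i) - 1) / h. As h = [harmonic n] tends to 0, dominated
    convergence handles the left side and the derivative of the exponential the right side. *)
Lemma fhat_derive g i (x : R6 R) : (i < 6)%N -> schwartz_real g ->
  fhat (fun p => ('D_(basis6 i) g p)%:C%C) x =
  (0 +i* (- (2 * coord6 i x)))%C * fhat (fun p => (g p)%:C%C) x.
Proof.
move=> i6 sg; have v1 := @norm_basis6 R i.
have [C C0 HC] := schwartz_difference v1 sg.
pose h (n : nat) : R := harmonic n.
have h0 n : 0 < h n by exact: harmonic_gt0.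
have h1 n : h n <= 1 by rewrite /h /harmonic /= invf_le1 ?ltr0n // ler1n.
pose q n (p : R6 R) := (h n)^-1 * (g (p + h n *: basis6 i) - g p).
have cg := schwartz_continuous sg.
have cq n : continuous (q n).
  move=> p; apply: cvgM; first exact: cvg_cst.
  apply: cvgB; last exact: cg.
  apply: continuous_comp; last exact: cg.
  by apply: cvgD; [exact: cvg_id|exact: cvg_cst].
have mq n : cmeas (fun p : L6 R => (q n p)%:C%C * expi (2 * dot6 p x)).
  apply: cmeasM; last exact: cmeas_phase6.
  by apply: cmeas_real; exact: continuous_measurable6.
have i6w := rintegrable_prod6 (@cw_integral R).1.
have qlim p : (fun n => q n p) @ \oo --> 'D_(basis6 i) g p.
  have [_ /(_ (basis6 i)) dg] := sg.1 [::] p I.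
  have := cvg_comp _ _ cvg_harmonic_dnbhs dg; apply: cvg_trans; apply: near_eq_cvg; apply: nearW
    => n.
  by rewrite /q /= (addrC p).
pose H n (p : L6 R) : R[i] := (q n p)%:C%C * expi (2 * dot6 p x).
pose Hl (p : L6 R) : R[i] := ('D_(basis6 i) g p)%:C%C * expi (2 * dot6 p x).
have [||||L1 L2] := @cdct _ _ _ (l6 R) H Hl (fun p => 2 * C * prod6 cw p) mq.
- by move=> p; exact: (cvg_realM _ (qlim p)).1.
- by move=> p; exact: (cvg_realM _ (qlim p)).2.
- exact: rintegrableZ.
- move=> n p; rewrite cabs_realM mulrC -mulrA.
  by apply: ler_pM; rewrite ?cabs_ge0 ?cabs_expi // HC.
pose G := fhat (fun p => (g p)%:C%C) x.
pose c := coord6 i x.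
have E n : cintegral (l6 R) (fun p : L6 R => (q n p)%:C%C * expi (2 * dot6 p x)) =
    ((h n)^-1)%:C%C * (expi (- (2 * (h n * c))) - 1) * G.
  have ig := fhat_integrand x sg.
  have it : cintegrable (l6 R) (fun p : L6 R => (g (p + h n *: basis6 i : R6 R))%:C%C * expi (2 *
    dot6 p x)).
    have := (cintegrable_cov (cov_translate6 (h n *: basis6 i)) (cintegrable_cmeas ig)).2 ig.
    move=> /(cintegrableMl (expi (- (2 * dot6 (h n *: basis6 i) x)))).
    apply: eq_cintegrable => p; rewrite mul1r mulrCA -expiD; congr (_ * expi _).
    by rewrite dot6D; ring.
  have -> : (h n)^-1%:C%C * (expi (- (2 * (h n * c))) - 1) * G =
      (h n)^-1%:C%C * (cintegral (l6 R) (fun p : L6 R => (g (p + h n *: basis6 i : R6 R))%:C%C *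
        expi (2 * dot6 p x)) + (-1) * G).
    rewrite fhat_translate // dot6Z dot6_basis6 // -/G -/c; ring.
  rewrite -[G]/(cintegral _ _) -cintegralMl // -cintegralD //; last exact: cintegrableMl.
  rewrite -cintegralMl; last by apply: cintegrableD => //; exact: cintegrableMl.
  apply: eq_cintegral => p; rewrite /q rmorphM rmorphB /=; ring.
have dlin : is_derive (0 : R) 1 (fun t : R => - (2 * c) * t) (- (2 * c)).
  have := is_deriveZ (- (2 * c)) (is_derive_id (0 : R) 1).
  by rewrite [_ *: 1]mulr1.
have lim1 : (fun n => (h n)^-1 * (cos (- (2 * (h n * c))) - 1)) @ \oo --> (0 : R).
  have := is_derive_harmonic (@is_derive1_comp _ (@cos R) _ (0 : R) _ _ (is_derive_cos _) dlin).
  rewrite /= mulr0 sin0 cos0 oppr0 mul0r; apply: cvg_trans; apply: near_eq_cvg.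
  by apply: nearW => n; rewrite mulNr (mulrC (h n)) mulrA.
have lim2 : (fun n => (h n)^-1 * sin (- (2 * (h n * c)))) @ \oo --> - (2 * c).
  have := is_derive_harmonic (@is_derive1_comp _ (@sin R) _ (0 : R) _ _ (is_derive_sin _) dlin).
  rewrite /= mulr0 sin0 cos0 mul1r; apply: cvg_trans; apply: near_eq_cvg.
  by apply: nearW => n; rewrite subr0 mulNr (mulrC (h n)) mulrA.
pose U n : R[i] := ((h n)^-1)%:C%C * (expi (- (2 * (h n * c))) - 1).
have [||R1 R2] := @cvg_cMr U (0 +i* (- (2 * c)))%C G.
- apply: cvg_trans lim1; apply: near_eq_cvg; apply: nearW => n.
  by rewrite /U /= mul0r subr0.
- apply: cvg_trans lim2; apply: near_eq_cvg; apply: nearW => n.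
  by rewrite /U /= oppr0 addr0 mul0r addr0.
have {}R1 : (fun n => complex.Re (cintegral (l6 R) (H n))) @ \oo -->
    complex.Re ((0 +i* (- (2 * c)))%C * G).
  by apply: cvg_trans R1; apply: near_eq_cvg; apply: nearW => n; rewrite /H E.
have {}R2 : (fun n => complex.Im (cintegral (l6 R) (H n))) @ \oo -->
    complex.Im ((0 +i* (- (2 * c)))%C * G).
  by apply: cvg_trans R2; apply: near_eq_cvg; apply: nearW => n; rewrite /H E.
apply: complex_eqP; first exact: (cvg_unique _ L1 R1).
exact: (cvg_unique _ L2 R2).
Qed.

Lemma fhat_bounded g : schwartz_real g ->
  exists2 C, 0 <= C & forall x, cabs (fhat (fun p => (g p)%:C%C) x) <= C.
Proof.
move=> sg; have [C C0 HC] := schwartz_decay sg.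
have i6 := rintegrable_prod6 (@cw_integral R).1.
exists (\int[l6 R]_p (2 * C * prod6 cw p)).
  apply: Rintegral_ge0 => x _; apply: mulr_ge0; first exact: mulr_ge0.
  by apply: ltW; apply: (prod6_gt0 x); exact: cw_gt0.
move=> x; have ig := fhat_integrand x sg.
apply: (le_trans (cabs_cintegral ig)); apply: le_Rintegral => //.
- exact: cintegrable_cabs.
- exact: rintegrableZ.
- move=> p _; rewrite cabs_realM mulrC -mulrA.
  by apply: ler_pM; rewrite ?cabs_ge0 ?cabs_expi.
Qed.

(** Each coordinate costs two derivatives: the transform of the second derivative is -4 x_i^2 times
    that of [g], so it controls x_i^2 times the latter. Induction on the number of coordinates, with
    [g] quantified inside, accumulates the product of all factors. *)
Lemma fhat_decay_upto (n : nat) : (n <= 6)%N -> forall g, schwartz_real g ->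
  exists2 C, 0 <= C & forall x,
    (\prod_(i < n) (1 + coord6 i x ^+ 2)) * cabs (fhat (fun p => (g p)%:C%C) x) <= C.
Proof.
elim: n => [|n IHn] n6 g sg.
  by have [C C0 HC] := fhat_bounded sg; exists C => // x; rewrite big_ord0 mul1r.
have [C1 C10 H1] := IHn (ltnW n6) g sg.
have sg2 := schwartz_derive (basis6 n) (schwartz_derive (basis6 n) sg).
have [C2 C20 H2] := IHn (ltnW n6) _ sg2.
exists (C1 + C2); first by rewrite addr_ge0.
move=> x; rewrite big_ord_recr /= (_ : forall P c F : R, P * (1 + c) * F = P * F + P * c * F);
  last by (move=> *; ring).
  apply: lerD; first exact: H1.
apply: le_trans (H2 x); rewrite -mulrA; apply: ler_wpM2l.
  by apply: prodr_ge0 => i _; rewrite addr_ge0 // sqr_ge0.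
rewrite fhat_derive //; last exact: schwartz_derive.
rewrite fhat_derive // mulrA.
set F := fhat _ x; set c := coord6 n x.
have -> : ((0 +i* - (2 * c)) * (0 +i* - (2 * c)))%C = (- (4 * c ^+ 2))%:C%C :> R[i].
  by apply: complex_eqP; rewrite /=; ring.
rewrite cabs_realM normrN ger0_norm; last by rewrite mulr_ge0 // sqr_ge0.
apply: ler_wpM2r; first exact: cabs_ge0.
have := sqr_ge0 c; lra.
Qed.

Lemma fhat_decay_real g : schwartz_real g ->
  exists2 C, 0 <= C & forall x, cabs (fhat (fun p => (g p)%:C%C) x) <= C * prod6 cw x.
Proof.
move=> sg; have [C C0 HC] := fhat_decay_upto (leqnn 6) sg; exists C => // x.
have := HC x; rewrite !big_ord_recr big_ord0 /= mul1r.
have P (s : R) : 0 < 1 + s ^+ 2 by rewrite ltr_pwDl // sqr_ge0.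
rewrite (_ : prod6 cw x = ((1 + x.1.1.1.1.1 ^+ 2) * (1 + x.1.1.1.1.2 ^+ 2) * (1 + x.1.1.1.2 ^+ 2) *
  (1 + x.1.1.2 ^+ 2) * (1 + x.1.2 ^+ 2) * (1 + x.2 ^+ 2))^-1).
  by rewrite ler_pdivlMr ?mulr_gt0 // mulrC.
by rewrite /prod6 /cw !invfM.
Qed.

Lemma fhat_decay (phi : R6 R -> R[i]) : schwartz phi ->
  exists2 C, 0 <= C & forall x, cabs (fhat phi x) <= C * prod6 cw x.
Proof.
move=> [s1 s2].
have [C1 C10 H1] := fhat_decay_real s1; have [C2 C20 H2] := fhat_decay_real s2.
exists (C1 + C2); first by rewrite addr_ge0.
move=> x; have i1 := fhat_integrand x s1; have i2 := fhat_integrand x s2.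
have -> : fhat phi x = fhat (fun p => (complex.Re (phi p))%:C%C) x +
    (0 +i* 1)%C * fhat (fun p => (complex.Im (phi p))%:C%C) x.
  rewrite /fhat -cintegralMl // -cintegralD //; last exact: cintegrableMl.
  apply: eq_cintegral => p; rewrite mulrA -mulrDl; congr (_ * _).
  by apply: complex_eqP; case: (phi p) => a b /=; ring.
apply: (le_trans (cabsD _ _)); rewrite mulrDl; apply: lerD => //.
apply: (le_trans (cabsM _ _)).
have c1 : cabs (0 +i* 1 : R[i])%C = 1 by rewrite /cabs /= normr0 normr1 add0r.
by rewrite c1 mul1r; exact: H2.
Qed.

Lemma schwartz_cabs_decay (phi : R6 R -> R[i]) : schwartz phi ->
  exists2 C, 0 <= C & forall x, cabs (phi x) <= C * prod6 cw x.
Proof.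
move=> [s1 s2].
have [C1 C10 H1] := schwartz_decay s1; have [C2 C20 H2] := schwartz_decay s2.
exists (C1 + C2); first by rewrite addr_ge0.
by move=> x; rewrite /cabs mulrDl; apply: lerD.
Qed.

Lemma schwartz_cmeas (phi : R6 R -> R[i]) : schwartz phi -> cmeas (phi : L6 R -> R[i]).
Proof.
by move=> [s1 s2]; split; apply: continuous_measurable6; exact: schwartz_continuous.
Qed.

Lemma fhat_integrandC (phi : R6 R -> R[i]) x : schwartz phi ->
  cintegrable (l6 R) (fun p : L6 R => phi p * expi (2 * dot6 p x)).
Proof.
move=> sp; have [K K0 HK] := schwartz_cabs_decay sp.
have i6 := rintegrable_prod6 (@cw_integral R).1.
apply: (cintegrable_dom _ (rintegrableZ (2 * K) i6)).
  by apply: cmeasM; [exact: schwartz_cmeas|exact: cmeas_phase6].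
move=> p; apply: (le_trans (cabsM _ _)); rewrite mulrC -mulrA.
by apply: ler_pM; rewrite ?cabs_ge0 ?cabs_expi.
Qed.

(* Measurability comes from Fubini, after weighting by an integrable function of x. *)
Lemma cintegrable_transform d (T : measurableType d)
    (m : {sigma_finite_measure set T -> \bar R}) (w : T -> R) (theta : T * T -> R)
    (phi F : T -> R[i]) (K C : R) : rintegrable m w -> (forall x, 0 < w x) ->
  measurable_fun setT theta -> cmeas phi -> (forall p, cabs (phi p) <= K * w p) ->
  (forall x, F x = cintegral m (fun p => phi p * expi (theta (p, x)))) ->
  (forall x, cabs (F x) <= C * w x) -> cintegrable m F.
Proof.
move=> iw w0 mt mphi HK FE HC.
have wn0 x : 0 <= w x by exact: ltW.
have mw := rintegrable_meas iw.
pose h (z : T * T) := (w z.1)%:C%C * (phi z.2 * expi (theta (z.2, z.1))).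
have mth : cmeas (fun z : T * T => expi (theta (z.2, z.1))).
  apply: cmeas_expi; apply: (measurableT_comp mt).
  by apply: measurable_fun_pair; [exact: measurable_snd|exact: measurable_fst].
have bexp p (t : R) : cabs (phi p * expi t) <= 2 * K * w p.
  apply: (le_trans (cabsM _ _)); rewrite mulrC -mulrA.
  by apply: ler_pM; rewrite ?cabs_ge0 ?cabs_expi.
have ih : cintegrable (m \xs m) h.
  apply: (cintegrable_dom _ (rintegrable_prod iw (rintegrableZ (2 * K) iw))).
    apply: cmeasM.
      exact: (cmeas_comp (cmeas_real mw) measurable_fst).
    by apply: cmeasM => //; exact: (cmeas_comp mphi measurable_snd).
  move=> z; rewrite cabs_realM ger0_norm //.
  by apply: ler_wpM2l.
have [i1 _] := cfubini ih.
have E : F = (fun x => ((w x)^-1)%:C%C * cintegral m (fun p => h (x, p))).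
  apply/funext => x; rewrite /h /= cintegralMl.
    by rewrite mulrA -rmorphM mulVf ?mul1r ?gt_eqF // FE.
  apply: (cintegrable_dom _ (rintegrableZ (2 * K) iw)) => //.
  apply: cmeasM => //; apply: cmeas_expi; apply: (measurableT_comp mt).
  by apply: measurable_fun_pair => //; exact: measurable_cst.
apply: (cintegrable_dom _ (rintegrableZ C iw)) => //; rewrite E.
apply: cmeasM; last exact: cintegrable_cmeas i1.
apply: cmeas_real.
have -> : (fun x => (w x)^-1) = (fun y : R => expR (- ln y)) \o w.
  by apply/funext => x /=; rewrite expRN lnK ?posrE.
have me : measurable_fun setT (fun y : R => expR (- ln y)).
  apply: measurableT_comp; first exact: measurable_expR.
  by apply: measurableT_comp => //; exact: measurable_ln.
exact: (measurableT_comp me mw).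
Qed.

Lemma cintegrable_fhat (phi : R6 R -> R[i]) : schwartz phi -> cintegrable (l6 R) (fhat phi).
Proof.
move=> sp; have [C C0 HC] := fhat_decay sp; have [K K0 HK] := schwartz_cabs_decay sp.
have i6 := rintegrable_prod6 (@cw_integral R).1.
apply: (@cintegrable_transform _ _ (l6 R) (prod6 cw) (fun z => 2 * dot6 z.1 z.2) phi _ K C) => //.
- by move=> x; apply: prod6_gt0; exact: cw_gt0.
- apply: measurable_funM => //.
  by apply: measurable_dot6; [exact: measurable_fst|exact: measurable_snd].
- exact: schwartz_cmeas.
Qed.

End SchwartzFourier.

(** * Integration over space-time for a fixed spinor *)

Section FixedSpinor.
Context {R : realType}.

Definition join6 (p q : R * R * R) : R6 R := (p.1.1, p.1.2, p.2, q.1.1, q.1.2, q.2).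

(* The components P_ij, 1 <= i < j <= 3, of (1, y) wedge (0, p); the others are p. *)
Definition wedge3 (y p : R * R * R) : R * R * R :=
  (y.1.1 * p.1.2 - y.1.2 * p.1.1, y.1.1 * p.2 - y.2 * p.1.1, y.1.2 * p.2 - y.2 * p.1.2).

(* omega^i = x^{iB} pi_B, i = 1, 2, 3, for pi = (1, y). *)
Definition omega3 (y : R * R * R) (x : R6 R) : R * R * R :=
  let: (a1, a2, a3, b12, b13, b23) := x in
  (b12 * y.1.2 + b13 * y.2 - a1, b23 * y.2 - b12 * y.1.1 - a2, - b13 * y.1.1 - b23 * y.1.2 - a3).

(** The fibre of [omega3 y] over [w]: the components x^ij with 1 <= i < j <= 3 are the free
    parameters [b], and the incidence relation is solved for the x^0i. *)
Definition fibre_pt (y w b : R * R * R) : R6 R :=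
  join6 (b.1.1 * y.1.2 + b.1.2 * y.2 - w.1.1, b.2 * y.2 - b.1.1 * y.1.1 - w.1.2,
         - b.1.2 * y.1.1 - b.2 * y.1.2 - w.2) b.

Lemma omega3_fibre y w b : omega3 y (fibre_pt y w b) = w.
Proof.
case: y w b => [[y1 y2] y3] [[w1 w2] w3] [[b1 b2] b3]; rewrite /omega3 /fibre_pt /=.
by congr (_, _, _); ring.
Qed.

(** The parameters [b] along the fibre see only the deviation [q] of the momentum from (1, y) wedge
    (0, p). Integrating over [b] is therefore Fourier inversion at q = 0. *)
Lemma dot6_fibre y w p q b :
  dot6 (join6 p (q + wedge3 y p)) (fibre_pt y w b) = - dot3 p w + dot3 q b.
Proof.
case: y w b p q => [[y1 y2] y3] [[w1 w2] w3] [[b1 b2] b3] [[p1 p2] p3] [[q1 q2] q3].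
rewrite /dot6 /dot3 /wedge3 /fibre_pt /join6 /=; ring.
Qed.

Lemma cov_id d (T : measurableType d) (m : {measure set T -> \bar R}) :
  cov m m id (fun=> 1).
Proof. by split=> // g _ _; apply: eq_integral => x _; rewrite mule1. Qed.

Lemma cov_join6 : cov (l3 R \xs l3 R) (l6 R) (fun z : L3 R * L3 R => join6 z.1 z.2) (fun=> 1).
Proof.
have A1 := cov_assoc (l3 R) (l1 R \xs l1 R) (l1 R).
have A2 := cov_prod (cov_assoc (l3 R) (l1 R) (l1 R)) (cov_id (l1 R)).
apply: (cov_eq (cov_comp A1 A2)) => [[[[p1 p2] p3] [[q1 q2] q3]]|z] //=.
by rewrite !mulr1.
Qed.

Lemma cov_affine3 (s : R) (a : R * R * R) : s != 0 ->
  cov (l3 R) (l3 R) (fun p => (s * p.1.1 + a.1.1, s * p.1.2 + a.1.2, s * p.2 + a.2))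
    (fun=> `|s| ^+ 3).
Proof.
move=> s0; have A c := cov_affine c s0.
apply: (cov_eq (cov_prod (cov_prod (A a.1.1) (A a.1.2)) (A a.2))) => // p.
by rewrite exprS expr2 mulrA.
Qed.

Lemma measurable3 d (T : measurableType d) (f g h : T -> R) : measurable_fun setT f ->
  measurable_fun setT g -> measurable_fun setT h ->
  measurable_fun setT (fun x => (f x, g x, h x) : L3 R).
Proof. by move=> mf mg mh; apply: measurable_fun_pair => //; exact: measurable_fun_pair. Qed.

Lemma measurable_co3 d (T : measurableType d) (f : T -> L3 R) : measurable_fun setT f ->
  [/\ measurable_fun setT (fun x => (f x).1.1 : R), measurable_fun setT (fun x => (f x).1.2 : R)
    & measurable_fun setT (fun x => (f x).2 : R)].
Proof.
move=> mf; have m1 := measurableT_comp measurable_fst mf; split.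
- exact: (measurableT_comp measurable_fst m1).
- exact: (measurableT_comp measurable_snd m1).
- exact: (measurableT_comp measurable_snd mf).
Qed.

Lemma measurable_wedge3 d (T : measurableType d) (f g : T -> L3 R) : measurable_fun setT f ->
  measurable_fun setT g -> measurable_fun setT (fun x => wedge3 (f x) (g x) : L3 R).
Proof.
move=> /measurable_co3[f1 f2 f3] /measurable_co3[g1 g2 g3].
by apply: measurable3; apply: measurable_funB; exact: measurable_funM.
Qed.

Lemma measurable_join6 d (T : measurableType d) (f g : T -> L3 R) : measurable_fun setT f ->
  measurable_fun setT g -> measurable_fun setT (fun x => join6 (f x) (g x) : L6 R).
Proof.
move=> mf /measurable_co3[g1 g2 g3].
have [mj _ _ _] := cov_join6.
have mg : measurable_fun setT (fun x => ((g x).1.1, (g x).1.2, (g x).2) : L3 R).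
  exact: measurable3.
by apply: (measurableT_comp mj (g := fun x => (f x, ((g x).1.1, (g x).1.2, (g x).2))));
  exact: measurable_fun_pair.
Qed.

Lemma cov_shear (y : L3 R) : cov (l3 R \xs l3 R) (l3 R \xs l3 R)
  (fun z : L3 R * L3 R => (z.1, (z.2 : R * R * R) + wedge3 y z.1)) (fun=> 1).
Proof.
have mw : measurable_fun setT (fun z : L3 R * L3 R => (z.2 : R * R * R) + wedge3 y z.1 : L3 R).
  have [g1 g2 g3] := measurable_co3 (measurable_wedge3
     (measurable_cst y) (measurable_fst : measurable_fun setT (fun z : L3 R * L3 R => z.1))).
  have [h1 h2 h3] := measurable_co3 (measurable_snd : measurable_fun setT (fun z : L3 R * L3 R =>
    z.2)).
  by apply: measurable3; apply: measurable_funD.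
apply: (@cov_fibR _ _ _ _ _ _ _ _ _ _ (fun z : L3 R * L3 R => (z.2 : R * R * R) + wedge3 y z.1 :
  L3 R) (fun=> 1) set0) => //.
move=> p _; have := cov_affine3 (wedge3 y p) (@oner_neq0 R).
move/cov_eq; apply => [[[q1 q2] q3]|q] /=; last by rewrite normr1 expr1n.
by rewrite !mul1r.
Qed.

(** For fixed [b] the map sends [w] to a translate of [- w], so its Jacobian is |-1|^3 = 1. *)
Lemma cov_fibre_pt (y : L3 R) : cov (l3 R \xs l3 R) (l6 R)
  (fun z : L3 R * L3 R => fibre_pt y z.1 z.2) (fun=> 1).
Proof.
pose beta (b : R * R * R) : R * R * R := (b.1.1 * y.1.2 + b.1.2 * y.2, b.2 * y.2 - b.1.1 * y.1.1,
         - b.1.2 * y.1.1 - b.2 * y.1.2).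
pose phi (z : L3 R * L3 R) : L3 R := ((beta z.2).1.1 - z.1.1.1, (beta z.2).1.2 - z.1.1.2, (beta
  z.2).2 - z.1.2).
have mphi : measurable_fun setT phi.
  have [g1 g2 g3] := measurable_co3 (measurable_fst : measurable_fun setT (fun z : L3 R * L3 R =>
    z.1)).
  have [h1 h2 h3] := measurable_co3 (measurable_snd : measurable_fun setT (fun z : L3 R * L3 R =>
    z.2)).
  apply: measurable3; apply: measurable_funB => //.
  - by apply: measurable_funD; apply: measurable_funM => //; exact: measurable_cst.
  - by apply: measurable_funB; apply: measurable_funM => //; exact: measurable_cst.
  - apply: measurable_funB; apply: measurable_funM; try exact: measurable_cst; last by [].
    exact: measurable_funN.
have N1 : (-1 : R) != 0 by rewrite oppr_eq0 oner_eq0.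
have C1 : cov (l3 R \xs l3 R) (l3 R \xs l3 R) (fun z => (phi z, z.2)) (fun=> 1).
  apply: (@cov_fibL _ _ _ _ _ _ _ _ _ _ phi (fun=> 1) set0) => //.
  move=> b _; have := cov_affine3 (beta b) N1.
  move/cov_eq; apply => [[[q1 q2] q3]|q] /=; last by rewrite normrN normr1 expr1n.
  by rewrite /phi /= !mulN1r ![- _ + _]addrC.
by apply: (cov_eq (cov_comp C1 cov_join6)) => // z; rewrite mulr1.
Qed.

Lemma prod6_join f p q : prod6 f (join6 p q) = prod3 f p * prod3 f q.
Proof. by rewrite /prod6 /prod3 /= !mulrA. Qed.

Lemma prod3_cw_le1 (q : R * R * R) : prod3 cw q <= 1.
Proof.
have c0 (s : R) : 0 <= cw s by rewrite ltW // cw_gt0.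
by rewrite /prod3 !mulr_ile1 ?mulr_ge0 ?cw_le1.
Qed.

Lemma prod3_cw_ge0 (q : R * R * R) : 0 <= prod3 cw q.
Proof. by apply: prod3_ge0 => s; rewrite ltW // cw_gt0. Qed.

Lemma cmeas_phase3 d (T : measurableType d) (f g : T -> L3 R) (c : R) : measurable_fun setT f ->
  measurable_fun setT g -> cmeas (fun x => expi (c * dot3 (f x) (g x))).
Proof.
by move=> mf mg; apply: cmeas_expi; apply: measurable_funM => //; exact: measurable_dot3.
Qed.

Lemma cvgn_pair (U V : topologicalType) (f : nat -> U) (g : nat -> V) (a : U) (b : V) :
  f @ \oo --> a -> g @ \oo --> b -> (fun n => (f n, g n)) @ \oo --> (a, b).
Proof. by move=> fa gb; apply: cvg_pair. Qed.

(** The last three coordinates of [fibre_pt y w b] are [b] itself, so the decay of [fhat phi] in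
    these three variables gives the majorant. *)
Lemma cintegrable_fibre (phi : R6 R -> R[i]) (y w : L3 R) : schwartz phi ->
  cintegrable (l3 R) (fun b : L3 R => fhat phi (fibre_pt y w b)).
Proof.
move=> sp; have [C C0 HC] := fhat_decay sp.
have icw3 := rintegrable_prod3 (@cw_integral R).1.
have mfp : measurable_fun setT (fun b : L3 R => fibre_pt y w b : L6 R).
  have [m6 _ _ _] := cov_fibre_pt y.
  apply: (measurableT_comp m6 (g := fun b => (w, b))).
  by apply: measurable_fun_pair => //; exact: measurable_cst.
apply: (cintegrable_dom _ (rintegrableZ C icw3)).
  exact: (cmeas_comp (cintegrable_cmeas (cintegrable_fhat sp)) mfp).
move=> b; apply: (le_trans (HC _)); rewrite prod6_join mulrCA.
by rewrite ler_piMl ?prod3_cw_le1 // mulr_ge0 // prod3_cw_ge0.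
Qed.

Lemma measurable_omega3 d (T : measurableType d) (f : T -> L3 R) (g : T -> L6 R) :
  measurable_fun setT f -> measurable_fun setT g ->
  measurable_fun setT (fun x => omega3 (f x) (g x) : L3 R).
Proof.
move=> /measurable_co3[f1 f2 f3] mg.
have g5 := measurableT_comp measurable_fst mg; have g6 := measurableT_comp measurable_snd mg.
have g4 := measurableT_comp measurable_fst g5; have b13 := measurableT_comp measurable_snd g5.
have g3 := measurableT_comp measurable_fst g4; have b12 := measurableT_comp measurable_snd g4.
have [a1 a2 a3] := measurable_co3 g3.
have -> : (fun x => omega3 (f x) (g x)) = (fun x => ((g x).1.1.2 * (f x).1.2 + (g x).1.2 * (f x).2
  - (g x).1.1.1.1.1,
   (g x).2 * (f x).2 - (g x).1.1.2 * (f x).1.1 - (g x).1.1.1.1.2,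
   - (g x).1.2 * (f x).1.1 - (g x).2 * (f x).1.2 - (g x).1.1.1.2)).
  by apply/funext => x; case: (g x) => [[[[[? ?] ?] ?] ?] ?].
apply: measurable3; apply: measurable_funB => //.
- by apply: measurable_funD; exact: measurable_funM.
- by apply: measurable_funB; exact: measurable_funM.
- by apply: measurable_funB; apply: measurable_funM => //; exact: measurable_funN.
Qed.

(** [fourier_inversion3] is applied to psi(q), the integral over p of phi(p, q + wedge3 y p) exp(-2
    i p . w). Its boundedness and its limit at 0 come from the decay of [phi] in p, uniform in q,
    and from the continuity of [phi]; integrability of its transform is [cintegrable_fibre]. *)
Lemma fibre_inversion (phi : R6 R -> R[i]) (y w : L3 R) : schwartz phi ->
  cintegral (l3 R) (fun b : L3 R => fhat phi (fibre_pt y w b)) =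
  (pi ^+ 3)%:C%C * cintegral (l3 R) (fun p : L3 R => phi (join6 p (wedge3 y p)) * expi (- 2 * dot3
    p w)).
Proof.
move=> sp.
have [K K0 HK] := schwartz_cabs_decay sp.
have icw3 := rintegrable_prod3 (@cw_integral R).1.
have msp := schwartz_cmeas sp.
pose g (z : L3 R * L3 R) : R[i] :=
  phi (join6 z.1 ((z.2 : R * R * R) + wedge3 y z.1)) * expi (- 2 * dot3 z.1 w).
have bK p q : cabs (phi (join6 p q)) <= K * prod3 cw p * prod3 cw q.
  by apply: (le_trans (HK _)); rewrite prod6_join mulrA.
have bg p q : cabs (g (p, q)) <= 2 * K * prod3 cw p.
  apply: (le_trans (cabsM _ _)); rewrite mulrC -mulrA.
  apply: ler_pM; rewrite ?cabs_ge0 ?cabs_expi //=.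
  apply: (le_trans (bK _ _)); rewrite ler_piMr ?prod3_cw_le1 //.
  by rewrite mulr_ge0 // prod3_cw_ge0.
have icov := cov_comp (cov_shear y) cov_join6.
have iphi : cintegrable (l6 R) phi.
  exact: (cintegrable_dom msp (rintegrableZ K (rintegrable_prod6 (@cw_integral R).1)) HK).
have ig : cintegrable (l3 R \xs l3 R) g.
  have ip := (cintegrable_cov icov msp).2 iphi.
  apply: (cintegrable_dom _ (rintegrableZ 2 (cintegrable_cabs ip))).
    apply: cmeasM; last by apply: cmeas_phase3; [exact: measurable_fst|exact: measurable_cst].
    apply: (cmeas_comp msp); by case: icov.
  move=> z; apply: (le_trans (cabsM _ _)); rewrite mulrC /= mulr1 mul1r.
  by apply: ler_wpM2r; [exact: cabs_ge0|exact: cabs_expi].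
have [ipsi _] := cfubini2 ig.
pose psi (q : L3 R) : R[i] := cintegral (l3 R) (fun p => g (p, q)).
have hatE b : fhat phi (fibre_pt y w b) = cintegral (l3 R) (fun q => psi q * expi (2 * dot3 q b)).
  rewrite /fhat (cintegral_cov icov); last first.
    exact: (cintegrable_cmeas (fhat_integrandC _ sp)).
  transitivity (cintegral (l3 R \xs l3 R) (fun z => g z * expi (2 * dot3 z.2 b))).
    apply: eq_cintegral => z /=; rewrite mulr1 mul1r dot6_fibre /g -mulrA -expiD.
    by congr (_ * expi _); ring.
  have ig' : cintegrable (l3 R \xs l3 R) (fun z => g z * expi (2 * dot3 z.2 b)).
    apply: (cintegrable_dom _ (rintegrableZ 2 (cintegrable_cabs ig))).
      apply: cmeasM; first exact: cintegrable_cmeas ig.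
      by apply: cmeas_phase3; [exact: measurable_snd|exact: measurable_cst].
    move=> z; apply: (le_trans (cabsM _ _)); rewrite mulrC.
    by apply: ler_wpM2r; [exact: cabs_ge0|exact: cabs_expi].
  have [_ <-] := cfubini2 ig'; apply: eq_cintegral => q /=.
  rewrite /psi [RHS]mulrC -cintegralMl; first by apply: eq_cintegral => p; rewrite mulrC.
  apply: (cintegrable_dom _ (rintegrableZ (2 * K) icw3)) => [|p]; last exact: bg.
  apply: (cmeas_comp (cintegrable_cmeas ig) (phi := fun p => (p, q))).
  by apply: measurable_fun_pair => //; exact: measurable_cst.
have sect q : cmeas (fun p => g (p, q)).
  apply: (cmeas_comp (cintegrable_cmeas ig) (phi := fun p => (p, q))).
  by apply: measurable_fun_pair => //; exact: measurable_cst.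
have isect q : cintegrable (l3 R) (fun p => g (p, q)).
  by apply: (cintegrable_dom (sect q) (rintegrableZ (2 * K) icw3)) => p; exact: bg.
have psib q : cabs (psi q) <= \int[l3 R]_p (2 * K * prod3 cw p).
  apply: (le_trans (cabs_cintegral (isect q))); apply: le_Rintegral => //.
  - exact: cintegrable_cabs.
  - exact: rintegrableZ.
have psilim (s : L3 R) :
    (fun n => complex.Re (psi (harmonic n * s.1.1, harmonic n * s.1.2, harmonic n * s.2)))
      @ \oo --> complex.Re (psi (0, 0, 0)) /\
    (fun n => complex.Im (psi (harmonic n * s.1.1, harmonic n * s.1.2, harmonic n * s.2)))
      @ \oo --> complex.Im (psi (0, 0, 0)).
  pose hs n : L3 R := (harmonic n * s.1.1, harmonic n * s.1.2, harmonic n * s.2).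
  have clim p : (fun n => complex.Re (g (p, hs n))) @ \oo --> complex.Re (g (p, (0, 0, 0))) /\
      (fun n => complex.Im (g (p, hs n))) @ \oo --> complex.Im (g (p, (0, 0, 0))).
    have ch (t : R) : (fun n => harmonic n * t) @ \oo --> (0 : R).
      by rewrite -[X in _ --> X](mul0r t); apply: cvgM; [exact: cvg_harmonic|exact: cvg_cst].
    have c6 : (fun n => join6 p ((hs n : R * R * R) + wedge3 y p)) @ \oo -->
        (join6 p ((0, 0, 0) + wedge3 y p) : R6 R).
      have cj (t c : R) : (fun n => harmonic n * t + c) @ \oo --> 0 + c.
        by apply: cvgD; [exact: ch|exact: cvg_cst].
      by apply: cvgn_pair; [apply: cvgn_pair; [apply: cvgn_pair|]|]; try exact: cj; exact: cvg_cst.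
    apply: cvg_cMr.
      by apply: (cvg_comp _ (fun x => complex.Re (phi x)) c6); exact: (schwartz_continuous sp.1).
    by apply: (cvg_comp _ (fun x => complex.Im (phi x)) c6); exact: (schwartz_continuous sp.2).
  apply: (@cdct _ _ _ (l3 R) (fun n p => g (p, hs n)) (fun p => g (p, (0, 0, 0)))
     (fun p => 2 * K * prod3 cw p)) => [n|p|p||n p].
  - exact: sect.
  - by case: (clim p).
  - by case: (clim p).
  - exact: rintegrableZ.
  - exact: bg.
have hatEf : (fun b : L3 R => fhat phi (fibre_pt y w b)) =
    (fun b => cintegral (l3 R) (fun q => psi q * expi (2 * dot3 q b))).
  by apply/funext => b; rewrite hatE.
rewrite hatEf (@fourier_inversion3 _ psi _ ipsi psib) //.
- congr (_ * _); apply: eq_cintegral => p; rewrite /g /=.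
  by congr (phi (join6 p _) * _); case: (wedge3 y p) => [[a b] c]; rewrite /= -[RHS]add0r.
- by move=> s; case: (psilim s).
- by move=> s; case: (psilim s).
- by rewrite -hatEf; exact: cintegrable_fibre.
Qed.

(** Here [h] stands for f(., pi) in the coordinates omega^1, omega^2, omega^3 of its hyperplane. The
    integral over x becomes one over (w, b); the b-integral is [fibre_inversion], and Fubini then
    brings the w-integral, which is the transform of [h], inside the p-integral. *)
Lemma fixed_spinor_transform (phi : R6 R -> R[i]) (y : L3 R) (h : L3 R -> R[i]) (B : R) :
  schwartz phi -> cintegrable (l3 R) h -> (forall w, cabs (h w) <= B) ->
  cintegral (l6 R) (fun x : L6 R => h (omega3 y x) * fhat phi x) =
  (pi ^+ 3)%:C%C * cintegral (l3 R) (fun p : L3 R => phi (join6 p (wedge3 y p)) *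
     cintegral (l3 R) (fun w => h w * expi (- 2 * dot3 p w))).
Proof.
move=> sp ih hB.
have [K K0 HK] := schwartz_cabs_decay sp.
have icw3 := rintegrable_prod3 (@cw_integral R).1.
have mh := cintegrable_cmeas ih.
have mo : measurable_fun setT (fun x : L6 R => omega3 y x : L3 R).
  by apply: measurable_omega3 => //; exact: measurable_cst.
have ihf : cintegrable (l6 R) (fun x : L6 R => h (omega3 y x) * fhat phi x).
  have ifh := cintegrable_fhat sp.
  apply: (cintegrable_dom _ (rintegrableZ B (cintegrable_cabs ifh))).
    exact: (cmeasM (cmeas_comp mh mo) (cintegrable_cmeas ifh)).
  by move=> x; apply: (le_trans (cabsM _ _)); apply: ler_wpM2r => //; exact: cabs_ge0.
have cF := cov_fibre_pt y.
rewrite (cintegral_cov cF (cintegrable_cmeas ihf)).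
have := (cintegrable_cov cF (cintegrable_cmeas ihf)).2 ihf.
have -> : (fun x : L3 R * L3 R => 1%:C%C * (h (omega3 y (fibre_pt y x.1 x.2)) * fhat phi (fibre_pt
  y x.1 x.2)))
    = (fun z : L3 R * L3 R => h z.1 * fhat phi (fibre_pt y z.1 z.2)).
  by apply/funext => z; rewrite mul1r omega3_fibre.
move=> ihz; have [_ <-] := cfubini ihz.
pose k (z : L3 R * L3 R) : R[i] := phi (join6 z.2 (wedge3 y z.2)) * (h z.1 * expi (- 2 * dot3 z.2
  z.1)).
have mpw : measurable_fun setT (fun p : L3 R => join6 p (wedge3 y p) : L6 R).
  by apply: measurable_join6 => //; apply: measurable_wedge3 => //; exact: measurable_cst.
have mphi : cmeas (fun p : L3 R => phi (join6 p (wedge3 y p))).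
  exact: (cmeas_comp (schwartz_cmeas sp) mpw).
have bphi (p : L3 R) : cabs (phi (join6 p (wedge3 y p))) <= K * prod3 cw p.
  apply: (le_trans (HK _)); rewrite prod6_join mulrA ler_piMr ?prod3_cw_le1 //.
  by rewrite mulr_ge0 // prod3_cw_ge0.
have ik : cintegrable (l3 R \xs l3 R) k.
  apply: (cintegrable_dom _ (rintegrable_prod (cintegrable_cabs ih) (rintegrableZ (2 * K) icw3))).
    apply: cmeasM; first exact: (cmeas_comp mphi measurable_snd).
    apply: cmeasM; first exact: (cmeas_comp mh measurable_fst).
    by apply: cmeas_phase3; [exact: measurable_snd|exact: measurable_fst].
  move=> z; apply: (le_trans (cabsM _ _)).
  apply: (le_trans (ler_pM (cabs_ge0 _) (cabs_ge0 _) (bphi z.2) (cabsM _ _))).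
  rewrite mulrCA; apply: ler_wpM2l; first exact: cabs_ge0.
  rewrite mulrC -!mulrA; apply: ler_wpM2r; last exact: cabs_expi.
  by rewrite mulr_ge0 // prod3_cw_ge0.
have [_ E2] := cfubini2 ik; have [_ E1] := cfubini ik.
have iphip : cintegrable (l3 R) (fun p : L3 R => phi (join6 p (wedge3 y p))).
  exact: (cintegrable_dom mphi (rintegrableZ K icw3) bphi).
transitivity ((pi ^+ 3)%:C%C * cintegral (l3 R) (fun w => cintegral (l3 R) (fun p => k (w, p)))).
  rewrite -cintegralMl; last by case: (cfubini ik).
  apply: eq_cintegral => w.
  have iw : cintegrable (l3 R) (fun p : L3 R => phi (join6 p (wedge3 y p)) * expi (- 2 * dot3 p w)).
    apply: (cintegrable_dom _ (rintegrableZ 2 (cintegrable_cabs iphip))).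
      by apply: cmeasM => //; apply: cmeas_phase3 => //; exact: measurable_cst.
    move=> p; apply: (le_trans (cabsM _ _)); rewrite mulrC.
    by apply: ler_wpM2r; [exact: cabs_ge0|exact: cabs_expi].
  rewrite -[LHS]/(cintegral (l3 R) (fun b => h w * fhat phi (fibre_pt y w b))).
  have ihat := cintegrable_fibre y w sp.
  rewrite cintegralMl // fibre_inversion // mulrCA; congr (_ * _).
  rewrite -cintegralMl //; apply: eq_cintegral => p; rewrite /k /= mulrCA; congr (_ * _).
rewrite E1 -E2; congr (_ * _); apply: eq_cintegral => p.
rewrite /k /= cintegralMl //.
apply: (cintegrable_dom _ (rintegrableZ 2 (cintegrable_cabs ih))).
  by apply: cmeasM => //; apply: cmeas_phase3 => //; exact: measurable_cst.
move=> w; apply: (le_trans (cabsM _ _)); rewrite mulrC.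
by apply: ler_wpM2r; [exact: cabs_ge0|exact: cabs_expi].
Qed.

End FixedSpinor.

(** * Homogeneous functions on the twistor cone *)

Section ConeFunction.
Context {R : realType}.
Local Notation V := ('rV[R]_4 * 'rV[R]_4)%type.

Lemma coord_le_norm m n (A : 'M[R]_(m.+1, n.+1)) i j : `|A i j| <= `|A|.
Proof.
by rewrite [leRHS]/Num.Def.normr /= mx_normrE; apply/bigmax_geP; right; exists (i, j).
Qed.

Lemma norm_le_coord m n (A : 'M[R]_(m.+1, n.+1)) (c : R) : 0 <= c ->
  (forall i j, `|A i j| <= c) -> `|A| <= c.
Proof. by move=> c0 H; rewrite [leLHS]/Num.Def.normr /= mx_normrE; apply/bigmax_leP. Qed.

Lemma cvgn_mx m n (u : nat -> 'M[R]_(m.+1, n.+1)) (A : 'M[R]_(m.+1, n.+1)) :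
  (forall i j, (fun k => u k i j) @ \oo --> A i j) -> u @ \oo --> A.
Proof.
move=> H; apply/cvgrPdist_le => e e0.
have : \forall k \near \oo, forall ij : 'I_m.+1 * 'I_n.+1, `|A ij.1 ij.2 - u k ij.1 ij.2| <= e.
  apply: filter_forall => -[i j] /=.
  by move/cvgrPdist_le : (H i j) => /(_ e e0).
apply: filterS => k Hk; apply: norm_le_coord; first exact: ltW.
by move=> i j; rewrite !mxE; exact: (Hk (i, j)).
Qed.

Lemma cvgn_coord m n (u : nat -> 'M[R]_(m.+1, n.+1)) (A : 'M[R]_(m.+1, n.+1)) i j :
  u @ \oo --> A -> (fun k => u k i j) @ \oo --> A i j.
Proof.
move=> uA; apply/cvgrPdist_le => e e0; move/cvgrPdist_le : uA => /(_ e e0).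
apply: filterS => k; apply: le_trans.
by have := coord_le_norm (A - u k) i j; rewrite !mxE.
Qed.

Variables (k : nat) (f : V -> R[i]).
Hypotheses (f_smooth : smooth_on_cone f)
  (f_homog : homogeneous_on_cone (- (k + 4)%N%:Z) f).

(** The local extension agrees with [f] only on the cone, so the statements about [f] below are made
    along points of the cone. *)
Lemma cone_local z : twistor_cone z -> exists g : V -> R[i],
  [/\ {for z, continuous (fun w => complex.Re (g w))},
      {for z, continuous (fun w => complex.Im (g w))} &
      \forall w \near z, twistor_cone w -> f w = g w].
Proof.
move=> cz; have [U [g [oU Uz s1 s2 E]]] := f_smooth cz.
exists g; split.
- by case: (s1 [::] z Uz).
- by case: (s2 [::] z Uz).
- by apply: filterS (open_nbhs_nbhs (conj oU Uz)) => w; exact: E.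
Qed.

Lemma cone_cvg (u : nat -> V) z : twistor_cone z -> (forall n, twistor_cone (u n)) ->
  u @ \oo --> z ->
  (fun n => complex.Re (f (u n))) @ \oo --> complex.Re (f z) /\
  (fun n => complex.Im (f (u n))) @ \oo --> complex.Im (f z).
Proof.
move=> cz cu uz; have [g [c1 c2 E]] := cone_local cz.
have Ez : f z = g z by exact: (nbhs_singleton E).
have En : \forall n \near \oo, f (u n) = g (u n).
  have : \forall n \near \oo, twistor_cone (u n) -> f (u n) = g (u n) by exact: (uz _ E).
  by apply: filterS => n; apply.
rewrite Ez; split.
  have := cvg_comp _ (fun w => complex.Re (g w)) uz c1; apply: cvg_trans.
  by apply: near_eq_cvg; apply: filterS En => n /= ->.
have := cvg_comp _ (fun w => complex.Im (g w)) uz c2; apply: cvg_trans.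
by apply: near_eq_cvg; apply: filterS En => n /= ->.
Qed.

Definition pair4 (z : V) : R := \sum_(A < 4) z.1 ord0 A * z.2 ord0 A.

Lemma continuous_pair4 : continuous pair4.
Proof.
have c A : continuous (fun z : V => z.1 ord0 A * z.2 ord0 A).
  move=> z; apply: cvgM.
    apply: (cvg_comp (fun w : V => w.1) (fun v : 'rV[R]_4 => v ord0 A)); first exact: cvg_fst.
    exact: coord_continuous.
  apply: (cvg_comp (fun w : V => w.2) (fun v : 'rV[R]_4 => v ord0 A)); first exact: cvg_snd.
  exact: coord_continuous.
have -> : pair4 = (fun z : V => z.1 ord0 (inord 0) * z.2 ord0 (inord 0) +
    (z.1 ord0 (inord 1) * z.2 ord0 (inord 1) + (z.1 ord0 (inord 2) * z.2 ord0 (inord 2) +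
     z.1 ord0 (inord 3) * z.2 ord0 (inord 3)))).
  apply/funext => z; rewrite /pair4 !big_ord_recl big_ord0 addr0.
  by do ![congr (_ + _)]; congr (z.1 ord0 _ * z.2 ord0 _); apply/val_inj; rewrite /= inordK.
by move=> z; apply: cvgD; [|apply: cvgD; [|apply: cvgD]]; exact: c.
Qed.

Lemma cone_sphere_compact : compact [set z : V | twistor_cone z /\ `|z| = 1].
Proof.
apply: (@subclosed_compact _ _ ([set x : 'rV[R]_4 | `|x| <= 1] `*` [set x : 'rV[R]_4 | `|x| <= 1])).
- rewrite (_ : [set z | _] = pair4 @^-1` [set 0] `&` (fun z : V => `|z|) @^-1` [set 1]).
    apply: closedI; apply: preimage_closed => //.
    + by move=> z _; exact: continuous_pair4.
    + by move=> z _; exact: norm_continuous.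
  apply/seteqP; split=> z /=.
    by move=> [[z0 _] z1].
  move=> [z0 z1]; split=> //; split=> //.
  by apply/eqP => z00; move: z1; rewrite z00 normr0 => /eqP; rewrite eq_sym oner_eq0.
- have B : compact [set x : 'rV[R]_4 | `|x| <= 1].
    apply: bounded_closed_compact.
      by exists 1; split => // M M1 x /= x1; apply: le_trans x1 (ltW M1).
    rewrite (_ : [set _ | _] = (fun x : 'rV[R]_4 => `|x|) @^-1` [set t | t <= 1]) //.
    by apply: preimage_closed; [move=> z _; exact: norm_continuous|exact: closed_le].
  exact: compact_setX.
- move=> z /= [_ z1]; have : `|z| <= 1 by rewrite z1.
  by rewrite norm_pair ge_max => /andP[].
Qed.

(** Compactness bounds [f] on the unit sphere of the cone, and homogeneity spreads the bound along
    the rays. *)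
Lemma cone_bound : exists2 C, 0 <= C & forall z, twistor_cone z ->
  cabs (f z) <= C * (`|z| ^+ (k + 4))^-1.
Proof.
have [M HM] : exists M : R, forall z, twistor_cone z -> `|z| = 1 -> cabs (f z) <= M.
  (* Local bounds are glued by the near-covering form of compactness, with the bound [M] running
     through the filter at +oo. *)
  have /compact_near_coveringP := cone_sphere_compact.
  move=> /(_ R (+oo : set_system R) (fun M z => twistor_cone z -> cabs (f z) <= M)) H.
  have : \forall M \near (+oo : set_system R), [set z : V | twistor_cone z /\ `|z| = 1] `<=`
      (fun z => twistor_cone z -> cabs (f z) <= M).
    apply: H => z [cz _].
    have [g [c1 c2 E]] := cone_local cz.
    pose M0 := cabs (g z) + 1.
    have cg : {for z, continuous (fun w => cabs (g w))}.
      by apply: cvgD; [apply: (cvg_comp _ _ c1)|apply: (cvg_comp _ _ c2)]; exact: norm_continuous.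
    have nz : \forall w \near z, twistor_cone w -> cabs (f w) <= M0.
      move/cvgrPdist_le : cg => /(_ 1 ltr01) cg.
      apply: filterS2 E cg => w Ew cw tw; rewrite Ew // /M0 -lerBlDl.
      by apply: le_trans cw; rewrite distrC ler_norm.
    exists ([set w | twistor_cone w -> cabs (f w) <= M0], [set M | M0 <= M]) => /=.
      by split => //; apply: nbhs_pinfty_ge; rewrite num_real.
    move=> [w M] /= [h1 h2] tw; apply: le_trans h2; exact: h1.
  by move=> /filter_ex[M HM]; exists M => z cz z1; exact: HM.
exists (Num.max 0 M); first by rewrite le_max lexx.
move=> z cz; have [_ zn0] := cz.
have nz : 0 < `|z| by rewrite normr_gt0.
pose z' := `|z|^-1 *: z.
have cz' : twistor_cone z'.
  split; last by rewrite scaler_eq0 negb_or invr_eq0 normr_eq0 zn0.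
  have [+ _] := cz; rewrite -[X in X = 0 -> _]/(pair4 z) -[X in _ -> X = 0]/(pair4 z') => h0.
  have -> : pair4 z' = `|z|^-1 ^+ 2 * pair4 z.
    by rewrite /pair4 mulr_sumr; apply: eq_bigr => A _; rewrite !mxE; ring.
  by rewrite h0 mulr0.
have z'1 : `|z'| = 1 by rewrite normrZ normfV normr_id mulVf // gt_eqF.
have -> : f z = (`|z| ^ (- (k + 4)%N%:Z))%:C%C * f z'.
  by rewrite -f_homog ?gt_eqF // /z' scalerA divff ?scale1r // gt_eqF.
rewrite cabs_realM -exprnN ger0_norm; last by rewrite invr_ge0 exprn_ge0.
rewrite mulrC; apply: ler_wpM2r; first by rewrite invr_ge0 exprn_ge0.
by rewrite le_max HM // orbT.
Qed.

End ConeFunction.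

(** * Affine charts of a hyperplane *)

Section Charts.
Context {R : realType}.
Implicit Types (l w : 'rV[R]_4) (y : R * R * R).

Definition o0 : 'I_3 := @Ordinal 3 0 isT.
Definition o1 : 'I_3 := @Ordinal 3 1 isT.
Definition o2 : 'I_3 := @Ordinal 3 2 isT.

Lemma ord3P (m : 'I_3) : [\/ m = o0, m = o1 | m = o2].
Proof.
by case: m => [[|[|[|//]]] H]; [apply: Or31|apply: Or32|apply: Or33]; apply/val_inj.
Qed.

Lemma sum3 (F : 'I_3 -> R) : \sum_(i < 3) F i = F o0 + F o1 + F o2.
Proof.
rewrite !big_ord_recl big_ord0 addr0 addrA.
by congr (F _ + F _ + F _); apply/val_inj.
Qed.

Definition hyp_pt l (j : 'I_4) y : 'rV[R]_4 :=
  hyperplane_pt l j (\row_(i < 3) [:: y.1.1; y.1.2; y.2]`_i).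

Definition del (i : 'I_4) w : R * R * R :=
  (w ord0 (lift i o0), w ord0 (lift i o1), w ord0 (lift i o2)).

Lemma hyp_pt_lift l j y (m : 'I_3) : hyp_pt l j y ord0 (lift j m) = [:: y.1.1; y.1.2; y.2]`_m.
Proof. by rewrite mxE liftK mxE. Qed.

Lemma hyp_pt_self l j y : hyp_pt l j y ord0 j =
  - (y.1.1 * l ord0 (lift j o0) + y.1.2 * l ord0 (lift j o1) + y.2 * l ord0 (lift j o2)) / l ord0 j.
Proof. by rewrite mxE unlift_none sum3 !mxE. Qed.

Lemma sum_lift (j : 'I_4) (F : 'I_4 -> R) :
  \sum_(A < 4) F A = F j + (F (lift j o0) + F (lift j o1) + F (lift j o2)).
Proof. by rewrite (bigD1_ord j) //= sum3. Qed.

Lemma hyp_pt_orth l j y : l ord0 j != 0 -> \sum_(A < 4) hyp_pt l j y ord0 A * l ord0 A = 0.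
Proof.
move=> lj; rewrite (sum_lift j) !hyp_pt_lift hyp_pt_self /=.
by rewrite mulfVK // addNr.
Qed.

Lemma hyp_pt_del l i w : l ord0 i != 0 -> \sum_(A < 4) w ord0 A * l ord0 A = 0 ->
  hyp_pt l i (del i w) = w.
Proof.
move=> li; rewrite (sum_lift i) => /eqP; rewrite addr_eq0 => /eqP E.
apply/rowP => A; case: (unliftP i A) => [m ->|->].
  by rewrite hyp_pt_lift; case: (ord3P m) => ->.
by rewrite hyp_pt_self -E mulfK.
Qed.

Lemma del_hyp_pt l i y : del i (hyp_pt l i y) = y.
Proof. by case: y => [[a b] c]; rewrite /del !hyp_pt_lift. Qed.

(** [to_last m] carries coordinate number [m] to the last slot, and [from_last m] puts the last
    coordinate into slot [m]; between the two, a change of chart alters the last coordinate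
    alone. *)
Definition to_last (m : nat) y : R * R * R :=
  match m with 0 => (y.1.2, y.2, y.1.1) | 1 => (y.1.1, y.2, y.1.2) | _ => y end.
Definition from_last (m : nat) y : R * R * R :=
  match m with 0 => (y.2, y.1.1, y.1.2) | 1 => (y.1.1, y.2, y.1.2) | _ => y end.

Lemma cov_to_last m : cov (l3 R) (l3 R) (to_last m) (fun=> 1).
Proof.
case: m => [|[|m]].
- apply: (cov_eq (cov_comp (cov_assocV (l1 R) (l1 R) (l1 R)) (cov_swap (l1 R) (l1 R \xs l1 R))))
  => //.
  by move=> z; rewrite mulr1.
- apply: (cov_eq (cov_comp (cov_comp (cov_assocV (l1 R) (l1 R) (l1 R))
    (cov_prod (cov_id (l1 R)) (cov_swap (l1 R) (l1 R)))) (cov_assoc (l1 R) (l1 R) (l1 R)))) => //.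
  by move=> z; rewrite !mulr1.
- exact: cov_id.
Qed.

Lemma cov_from_last m : cov (l3 R) (l3 R) (from_last m) (fun=> 1).
Proof.
case: m => [|[|m]].
- apply: (cov_eq (cov_comp (cov_swap (l1 R \xs l1 R) (l1 R)) (cov_assoc (l1 R) (l1 R) (l1 R)))) =>
  //.
  by move=> z; rewrite mulr1.
- exact: (cov_to_last 1).
- exact: cov_id.
Qed.

Lemma cov_last (s : R) (g : R * R -> R) : s != 0 ->
  measurable_fun (setT : set (L1 R * L1 R)) g ->
  cov (l3 R) (l3 R) (fun y => (y.1, s * y.2 + g y.1)) (fun=> `|s|).
Proof.
move=> s0 mg.
apply: (@cov_fibR _ _ _ _ _ _ _ (l1 R \xs l1 R) (l1 R) (l1 R) (fun y : L3 R => s * y.2 + g y.1 :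
  L1 R) (fun=> `|s|) set0) => //.
  apply: measurable_funD; last exact: (measurableT_comp mg measurable_fst).
  by apply: measurable_funM => //; exact: measurable_snd.
by move=> x _; exact: (cov_affine (g x) s0).
Qed.

Definition others (m : nat) : 'I_3 * 'I_3 :=
  match m with 0 => (o1, o2) | 1 => (o0, o2) | _ => (o0, o1) end.

Lemma del_perm (j : 'I_4) (m : 'I_3) : exists m', forall w,
  del (lift j m) w =
  from_last m' (w ord0 (lift j (others m).1), w ord0 (lift j (others m).2), w ord0 j).
Proof.
(* The slot of [j] when the indices different from [lift j m] are listed in order. *)
exists (unbump (lift j m) j) => w.
case: j => [[|[|[|[|//]]]] Hj]; case: m => [[|[|[|//]]] Hm]; rewrite /del /=;
  by congr (w _ _, w _ _, w _ _); apply/val_inj.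
Qed.

(** With the two shared coordinates fixed, the equation of the hyperplane makes omega^j affine in
    omega^i, with slope -l_i / l_j. *)
Lemma cov_chart l i j : l ord0 i != 0 -> l ord0 j != 0 ->
  cov (l3 R) (l3 R) (fun y => del i (hyp_pt l j y)) (fun=> `|l ord0 i| / `|l ord0 j|).
Proof.
case: (unliftP j i) => [m ->|->] li lj; last first.
  apply: (cov_eq (cov_id (l3 R))) => y; first by rewrite /= del_hyp_pt.
  by rewrite divff // normr_eq0.
have [m' E] := del_perm j m.
pose s := - l ord0 (lift j m) / l ord0 j.
have s0 : s != 0 by rewrite mulf_neq0 ?oppr_eq0 // invr_eq0.
pose g (z : R * R) := - (z.1 * l ord0 (lift j (others m).1) + z.2 * l ord0 (lift j (others m).2))
  / l ord0 j.
have mg : measurable_fun (setT : set (L1 R * L1 R)) g.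
  apply: measurable_funM; last exact: measurable_cst.
  have f1 : measurable_fun (setT : set (L1 R * L1 R)) (fun z : R * R => z.1) := measurable_fst.
  have f2 : measurable_fun (setT : set (L1 R * L1 R)) (fun z : R * R => z.2) := measurable_snd.
  apply: measurable_funN; apply: measurable_funD; apply: measurable_funM;
    first [exact: f1|exact: f2|exact: measurable_cst].
apply: (cov_eq (cov_comp (cov_comp (cov_to_last m) (cov_last s0 mg)) (cov_from_last m'))) => [[[a
  b] c]|y].
  rewrite /= E !hyp_pt_lift hyp_pt_self; congr (from_last m' _); rewrite /s /g.
  by case: (ord3P m) => -> /=; congr (_, _); field.
by rewrite mul1r mulr1 /s normrM normrN normfV.
Qed.

(** [int_delta] uses whichever index [pick] returns; this frees the choice. Estimates need the index
    of the largest component, limits an index fixed along the sequence. *)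
Lemma int_deltaE l j (h : 'rV[R]_4 -> R[i]) : l ord0 j != 0 ->
  (forall i, l ord0 i != 0 -> cmeas (fun y : L3 R => h (hyp_pt l i y))) ->
  cintegrable (l3 R) (fun y => h (hyp_pt l j y)) ->
  int_delta l h = (`|l ord0 j|^-1)%:C%C * cintegral (l3 R) (fun y => h (hyp_pt l j y)).
Proof.
move=> lj mh ih; rewrite /int_delta; case: pickP => [i /= li|/(_ j)]; last by rewrite lj.
rewrite (leb3E _).2.
rewrite (_ : (fun y : R3 R => _) = (fun y => h (hyp_pt l i y))); last first.
  by apply/funext => -[[a b] c].
have -> : cintegral (l3 R) (fun y => h (hyp_pt l i y)) =
    cintegral (l3 R) (fun y => (`|l ord0 i| / `|l ord0 j|)%:C%C * h (hyp_pt l j y)).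
  rewrite (cintegral_cov (cov_chart li lj) (mh i li)).
  by apply: eq_cintegral => y; rewrite hyp_pt_del // hyp_pt_orth.
rewrite cintegralMl // mulrA -rmorphM mulrA mulVf ?mul1r //.
by rewrite normr_eq0.
Qed.

End Charts.

(** * Continuity and measurability along sequences *)

Section Sequential.
Context {R : realType}.

(** Dominated convergence speaks of sequences, and this turns its conclusions into continuity: a
    failure of continuity would produce bad points within [harmonic n] of [x]. *)
Lemma seq_continuous (V : normedModType R) (g : V -> R) (x : V) :
  (forall u : nat -> V, u @ \oo --> x -> (fun n => g (u n)) @ \oo --> g x) ->
  {for x, continuous g}.
Proof.
move=> H; apply/cvgrPdist_lt => e e0; apply: contrapT => nc.
have : forall n : nat, exists t : V, `|x - t| < harmonic n /\ ~ (`|g x - g t| < e).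
  move=> n; apply: contrapT => nt; apply: nc.
  apply/nbhs_normP; exists (harmonic n) => /=; first exact: harmonic_gt0.
  by move=> t /= xt; apply: contrapT => h; apply: nt; exists t.
move=> /choice[u Hu].
have ux : u @ \oo --> x.
  apply/cvgrPdist_lt => d d0; move/cvgrPdist_lt : (@cvg_harmonic R) => /(_ d d0).
  apply: filterS => n; rewrite sub0r normrN ger0_norm; last by rewrite ltW // harmonic_gt0.
  by apply: lt_trans; case: (Hu n).
move/cvgrPdist_lt : (H u ux) => /(_ e e0) [N _ /(_ N (leqnn N)) h].
by case: (Hu N).
Qed.

Lemma continuous_coord6 i : continuous (@coord6 R i).
Proof.
have f1 (U V : topologicalType) : continuous (fun z : U * V => z.1) by move=> z; exact: cvg_fst.
have f2 (U V : topologicalType) : continuous (fun z : U * V => z.2) by move=> z; exact: cvg_snd.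
have c5 : continuous (fun x : R6 R => x.1.1) by move=> x; apply: continuous_comp; exact: f1.
have c4 : continuous (fun x : R6 R => x.1.1.1).
  by move=> x; apply: (@continuous_comp _ _ _ (fun x : R6 R => x.1.1) fst); [exact: c5|exact: f1].
have c3 : continuous (fun x : R6 R => x.1.1.1.1).
  by move=> x; apply: (@continuous_comp _ _ _ (fun x : R6 R => x.1.1.1) fst); [exact: c4|exact: f1].
case: i => [|[|[|[|[|i]]]]] x.
- by apply: (@continuous_comp _ _ _ (fun x : R6 R => x.1.1.1.1) fst); [exact: c3|exact: f1].
- by apply: (@continuous_comp _ _ _ (fun x : R6 R => x.1.1.1.1) snd); [exact: c3|exact: f2].
- by apply: (@continuous_comp _ _ _ (fun x : R6 R => x.1.1.1) snd); [exact: c4|exact: f2].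
- by apply: (@continuous_comp _ _ _ (fun x : R6 R => x.1.1) snd); [exact: c5|exact: f2].
- by apply: (@continuous_comp _ _ _ (fun x : R6 R => x.1) snd); [exact: f1|exact: f2].
- exact: f2.
Qed.

Lemma measurable_seq6 (g : R6 R -> R) :
  (forall (u : nat -> R6 R) x, (forall i, (fun n => coord6 i (u n)) @ \oo --> coord6 i x) ->
     (fun n => g (u n)) @ \oo --> g x) ->
  measurable_fun (setT : set (L6 R)) g.
Proof.
move=> H; apply: continuous_measurable6 => x; apply: seq_continuous => u ux; apply: H => i.
by apply: (cvg_comp _ (coord6 i) ux); exact: continuous_coord6.
Qed.

Definition cvg3 (u : nat -> R * R * R) (y : R * R * R) : Prop :=
  [/\ (fun n => (u n).1.1) @ \oo --> y.1.1, (fun n => (u n).1.2) @ \oo --> y.1.2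
    & (fun n => (u n).2) @ \oo --> y.2].

(** Sequential continuity in two blocks of three variables is transported to [R6], where
    [measurable_seq6] applies. *)
Lemma measurable_seq33 (g : R * R * R -> R * R * R -> R) :
  (forall u v y w, cvg3 u y -> cvg3 v w -> (fun n => g (u n) (v n)) @ \oo --> g y w) ->
  measurable_fun (setT : set (L3 R * L3 R)) (fun z => g z.1 z.2).
Proof.
move=> H.
have m6 : measurable_fun (setT : set (L6 R))
    (fun x : R6 R => g (x.1.1.1.1.1, x.1.1.1.1.2, x.1.1.1.2) (x.1.1.2, x.1.2, x.2)).
  apply: measurable_seq6 => u x c; apply: H; split.
  - exact: (c 0%N).
  - exact: (c 1%N).
  - exact: (c 2%N).
  - exact: (c 3%N).
  - exact: (c 4%N).
  - exact: (c 5%N).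
have := measurableT_comp m6 (measurable_join6
  (measurable_fst : measurable_fun setT (fun z : L3 R * L3 R => z.1))
  (measurable_snd : measurable_fun setT (fun z : L3 R * L3 R => z.2))).
by congr (measurable_fun _ _); apply/funext => -[[[a b] c] [[d e] h]].
Qed.

Lemma measurable_seq3 (g : R * R * R -> R) :
  (forall u y, cvg3 u y -> (fun n => g (u n)) @ \oo --> g y) ->
  measurable_fun (setT : set (L3 R)) g.
Proof.
move=> H.
have m : measurable_fun (setT : set (L3 R * L3 R)) (fun z => g z.1).
  by apply: (measurable_seq33 (g := fun a b => g a)) => u v y w c _; exact: H.
apply: (measurableT_comp m (g := fun y : L3 R => (y, y))).
exact: measurable_fun_pair.
Qed.

End Sequential.

(** * The Fourier transform of f over a hyperplane *)

Section HyperplaneTransform.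
Context {R : realType}.
Local Notation V := ('rV[R]_4 * 'rV[R]_4)%type.
Variables (k : nat) (f : V -> R[i]).
Hypotheses (f_smooth : smooth_on_cone f)
  (f_homog : homogeneous_on_cone (- (k + 4)%N%:Z) f).

(** With the factor 1/2 in [skew_prod], the choice lhat = 2 m solves l_[A lhat_B] = l_A m_B - l_B
    m_A; hence the 2. *)
Definition hyp_phase (m w : 'rV[R]_4) : R := - (2 * \sum_(A < 4) m ord0 A * w ord0 A).

Definition hyp_integrand (l m w : 'rV[R]_4) : R[i] := f (w, l) * expi (hyp_phase m w).

(** The transform D(l, m) of the overview. *)
Definition hyp_fourier (l m : 'rV[R]_4) : R[i] := int_delta l (hyp_integrand l m).

Lemma int_delta_ext (l : 'rV[R]_4) (h h' : 'rV[R]_4 -> R[i]) :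
  (forall w : 'rV[R]_4, \sum_(A < 4) w ord0 A * l ord0 A = 0 -> h w = h' w) ->
  int_delta l h = int_delta l h'.
Proof.
move=> H; rewrite /int_delta; case: pickP => // j lj; congr (_ * cintegral _ _).
apply/funext => -[[a b] c]; apply: H.
exact: (hyp_pt_orth (a, b, c) lj).
Qed.

Lemma rV_neq0_ex (l : 'rV[R]_4) : l != 0 -> exists j, l ord0 j != 0.
Proof. by move/rV0Pn. Qed.

Lemma rV_max_coord (l : 'rV[R]_4) : l != 0 -> exists2 j, l ord0 j != 0 & `|l ord0 j| = `|l|.
Proof.
move=> l0; have : mx_norm l != 0 by rewrite -[mx_norm l]/(`|l|) normr_eq0.
move=> /mx_norm_neq0[[i j]] /=; rewrite -[mx_norm l]/(`|l|) (ord1 i) => E.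
by exists j; rewrite // -normr_eq0 -E normr_eq0.
Qed.

Lemma hyp_pt_cone (l : 'rV[R]_4) j y : l ord0 j != 0 -> twistor_cone (hyp_pt l j y, l).
Proof.
move=> lj; split; first exact: hyp_pt_orth.
apply/eqP => -[_ l0]; by rewrite l0 mxE eqxx in lj.
Qed.

Lemma hyp_pt_coord_le (l : 'rV[R]_4) j y :
  [/\ `|y.1.1| <= `|(hyp_pt l j y, l)|, `|y.1.2| <= `|(hyp_pt l j y, l)|, `|y.2| <= `|(hyp_pt l j
    y, l)|
    & `|l| <= `|(hyp_pt l j y, l)|].
Proof.
have P : `|hyp_pt l j y| <= `|(hyp_pt l j y, l)| by rewrite norm_pair le_max lexx.
have Q m := le_trans (coord_le_norm (hyp_pt l j y) ord0 (lift j m)) P.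
by split; [have := Q o0|have := Q o1|have := Q o2|]; rewrite ?hyp_pt_lift //= norm_pair le_max
  lexx orbT.
Qed.

(** Every 1 + |y_i| is at most 2 M, so each factor is at least (2 M)^(-4/3). Three of them make (2
    M)^-4, whence 16 = 2^4. *)
Lemma w43_bound (M y1 y2 y3 : R) : 1 <= M -> `|y1| <= M -> `|y2| <= M -> `|y3| <= M ->
  (M ^+ 4)^-1 <= 16 * (w43 y1 * w43 y2 * w43 y3).
Proof.
move=> M1 h1 h2 h3.
have M0 : 0 < M by exact: lt_le_trans M1.
pose a := expR (- (4 / 3) * ln (2 * M)).
have W (y : R) : `|y| <= M -> a <= w43 y.
  move=> yM; rewrite ler_expR !mulNr lerN2; apply: ler_wpM2l; first by rewrite divr_ge0.
  rewrite ler_ln ?posrE ?mulr_gt0 ?ltr_pwDl //; lra.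
have a0 : 0 <= a by exact: expR_ge0.
have <- : 16 * (a * a * a) = (M ^+ 4)^-1.
  rewrite -!expRD (_ : _ + _ + _ = - (4%:R * ln (2 * M))); last by field.
  rewrite expRN expRM_natl lnK ?posrE ?mulr_gt0 // exprMn -natrX invfM mulrA divff ?mul1r //.
apply: ler_wpM2l => //.
by apply: ler_pM; rewrite ?mulr_ge0 ?W //; apply: ler_pM; rewrite ?W.
Qed.

(** The weight at scale [c]. Its mass is proportional to [c ^+ 3], which brings out the right power
    of the norm of the spinor in [hyp_fourier_bound]. *)
Definition wt (c : R) (y : R * R * R) : R := prod3 (fun s => w43 (c^-1 * s)) y.

Lemma wt_integral (c : R) : 0 < c -> rintegrable (l3 R) (wt c) /\
  \int[l3 R]_y wt c y = c ^+ 3 * \int[l3 R]_y prod3 w43 y.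
Proof.
move=> c0; have i3 := rintegrable_prod3 (@w43_integrable R).
have cS := cov_scale3 c0.
have mwt : measurable_fun (setT : set (L3 R)) (wt c).
  apply: measurable_seq3 => u y [c1 c2 c3]; rewrite /wt /prod3.
  have cw (t : nat -> R) (s : R) : t @ \oo --> s -> (fun n => w43 (c^-1 * t n)) @ \oo --> w43
    (c^-1 * s).
    move=> ts; apply: (cvg_comp (fun n => c^-1 * t n) w43); last exact: continuous_w43.
    by apply: cvgM => //; exact: cvg_cst.
  by apply: cvgM; [apply: cvgM|]; exact: cw.
have E (s : L3 R) : wt c (c * s.1.1, c * s.1.2, c * s.2) * c ^+ 3 = c ^+ 3 * prod3 w43 s.
  rewrite mulrC /wt /prod3 /=; congr (_ * _).
  by rewrite !mulKf ?gt_eqF.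
split.
  apply/(rintegrable_cov cS) => //.
  by apply: eq_integrable (rintegrableZ (c ^+ 3) i3) => // s _; rewrite /= -E.
by rewrite (rintegral_cov cS) // -RintegralZl //; apply: eq_Rintegral => s _; rewrite /= -E.
Qed.

(** With M the norm of (omega, l), M^-(k+4) is split as M^-k M^-4: the first factor is at most c^-k,
    the second is estimated by [w43_bound] after division by [c]. Any positive lower bound [c] of
    the norm of [l] is allowed, which makes the majorant uniform while [l] varies. *)
Lemma chart_bound : exists2 C, 0 <= C & forall (l : 'rV[R]_4) j c y, l ord0 j != 0 ->
  0 < c -> c <= `|l| -> cabs (f (hyp_pt l j y, l)) <= C * (c ^+ (k + 4))^-1 * wt c y.
Proof.
have [C C0 HC] := cone_bound f_smooth f_homog.
exists (C * 16); first by rewrite mulr_ge0.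
move=> l j c y lj c0 cl.
apply: (le_trans (HC _ (hyp_pt_cone y lj))).
have [h1 h2 h3 h4] := hyp_pt_coord_le l j y.
set M := `|(hyp_pt l j y, l)| in h1 h2 h3 h4 *.
have cM : c <= M by exact: le_trans h4.
have M0 : 0 < M by exact: lt_le_trans cM.
rewrite -!mulrA; apply: ler_wpM2l => //.
have B := @w43_bound (c^-1 * M) (c^-1 * y.1.1) (c^-1 * y.1.2) (c^-1 * y.2).
have ci : 0 < c^-1 by rewrite invr_gt0.
have {}B := B _ _ _ _.
rewrite (exprD M) (exprD c) (invfM (M ^+ k)) (invfM (c ^+ k)).
have -> : 16 * ((c ^+ k)^-1 * (c ^+ 4)^-1 * wt c y) = (c ^+ k)^-1 * ((c ^+ 4)^-1 * (16 * wt c y))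
  by ring.
apply: ler_pM; rewrite ?invr_ge0 ?exprn_ge0 ?(ltW M0) //.
  by rewrite lef_pV2 ?posrE ?exprn_gt0 // lerXn2r // nnegrE ltW.
have {B} : ((c^-1 * M) ^+ 4)^-1 <= 16 * wt c y.
  apply: B; rewrite ?normrM ?(gtr0_norm ci) ?ler_pM2l //.
  by rewrite mulrC ler_pdivlMr // mul1r.
rewrite exprMn exprVn invfM invrK => B.
by rewrite -ler_pdivrMl ?invr_gt0 ?exprn_gt0 // invrK.
Qed.

Lemma hyp_phase_cvg (m w : nat -> 'rV[R]_4) (m0 w0 : 'rV[R]_4) :
  (forall A, (fun n => m n ord0 A) @ \oo --> m0 ord0 A) ->
  (forall A, (fun n => w n ord0 A) @ \oo --> w0 ord0 A) ->
  (fun n => hyp_phase (m n) (w n)) @ \oo --> hyp_phase m0 w0.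
Proof.
move=> cm cw; apply: cvgN; apply: cvgM; first exact: cvg_cst.
rewrite (sum_lift ord0); under eq_fun do rewrite (sum_lift ord0).
by apply: cvgD; [|apply: cvgD; [apply: cvgD|]]; apply: cvgM.
Qed.

Lemma cvg_expi (t : nat -> R) (s : R) : t @ \oo --> s ->
  (fun n => complex.Re (expi (t n))) @ \oo --> complex.Re (expi s) /\
  (fun n => complex.Im (expi (t n))) @ \oo --> complex.Im (expi s).
Proof.
move=> ts; split; first by apply: (cvg_comp t (@cos R) ts); exact: continuous_cos.
by apply: (cvg_comp t (@sin R) ts); exact: continuous_sin.
Qed.

Lemma cvg_cM (u v : nat -> R[i]) (a b : R[i]) :
  (fun n => complex.Re (u n)) @ \oo --> complex.Re a /\
  (fun n => complex.Im (u n)) @ \oo --> complex.Im a ->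
  (fun n => complex.Re (v n)) @ \oo --> complex.Re b /\
  (fun n => complex.Im (v n)) @ \oo --> complex.Im b ->
  (fun n => complex.Re (u n * v n)) @ \oo --> complex.Re (a * b) /\
  (fun n => complex.Im (u n * v n)) @ \oo --> complex.Im (a * b).
Proof.
move=> [u1 u2] [v1 v2]; rewrite ReM ImM.
have Er : (fun n => complex.Re (u n * v n)) =
    (fun n => complex.Re (u n) * complex.Re (v n) - complex.Im (u n) * complex.Im (v n)).
  by apply/funext => n; rewrite ReM.
have Ei : (fun n => complex.Im (u n * v n)) =
    (fun n => complex.Re (u n) * complex.Im (v n) + complex.Im (u n) * complex.Re (v n)).
  by apply/funext => n; rewrite ImM.
by rewrite Er Ei; split; [apply: cvgB|apply: cvgD]; apply: cvgM.
Qed.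

Lemma hyp_pt_cvg (l : nat -> 'rV[R]_4) (l0 : 'rV[R]_4) j (y : nat -> R * R * R) y0 A :
  l0 ord0 j != 0 -> (forall A, (fun n => l n ord0 A) @ \oo --> l0 ord0 A) -> cvg3 y y0 ->
  (fun n => hyp_pt (l n) j (y n) ord0 A) @ \oo --> hyp_pt l0 j y0 ord0 A.
Proof.
move=> lj cl [y1 y2 y3]; case: (unliftP j A) => [m ->|->].
  rewrite hyp_pt_lift; under eq_fun do rewrite hyp_pt_lift.
  by case: (ord3P m) => ->.
rewrite hyp_pt_self; under eq_fun do rewrite hyp_pt_self.
apply: cvgM; last exact: cvgV.
by apply: cvgN; apply: cvgD; [apply: cvgD|]; apply: cvgM.
Qed.

Lemma hyp_integrand_cvg (l m : nat -> 'rV[R]_4) (lo mo : 'rV[R]_4) j (y : nat -> R * R * R) y0 :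
  lo ord0 j != 0 -> (forall n, l n ord0 j != 0) ->
  (forall A, (fun n => l n ord0 A) @ \oo --> lo ord0 A) ->
  (forall A, (fun n => m n ord0 A) @ \oo --> mo ord0 A) -> cvg3 y y0 ->
  (fun n => complex.Re (hyp_integrand (l n) (m n) (hyp_pt (l n) j (y n)))) @ \oo -->
    complex.Re (hyp_integrand lo mo (hyp_pt lo j y0)) /\
  (fun n => complex.Im (hyp_integrand (l n) (m n) (hyp_pt (l n) j (y n)))) @ \oo -->
    complex.Im (hyp_integrand lo mo (hyp_pt lo j y0)).
Proof.
move=> loj lj cl cm cy; apply: cvg_cM.
  apply: (cone_cvg f_smooth) => [|n|]; try exact: hyp_pt_cone.
  apply: cvgn_pair; apply: cvgn_mx => i B; rewrite (ord1 i) //.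
  exact: hyp_pt_cvg.
by apply: cvg_expi; apply: hyp_phase_cvg => // A; exact: hyp_pt_cvg.
Qed.

Lemma cmeas_hyp_integrand (l m : 'rV[R]_4) j : l ord0 j != 0 ->
  cmeas (fun y : L3 R => hyp_integrand l m (hyp_pt l j y)).
Proof.
move=> lj; split; apply: measurable_seq3 => u y cu.
  have := (@hyp_integrand_cvg (fun=> l) (fun=> m) l m j u y lj (fun=> lj) _ _ cu).1.
  by apply=> A; exact: cvg_cst.
have := (@hyp_integrand_cvg (fun=> l) (fun=> m) l m j u y lj (fun=> lj) _ _ cu).2.
by apply=> A; exact: cvg_cst.
Qed.

Lemma hyp_integrand_bound : exists2 C, 0 <= C & forall (l m : 'rV[R]_4) j c y, l ord0 j != 0 ->
  0 < c -> c <= `|l| -> cabs (hyp_integrand l m (hyp_pt l j y)) <= C * (c ^+ (k + 4))^-1 * wt c y.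
Proof.
have [C C0 HC] := chart_bound; exists (2 * C); first by rewrite mulr_ge0.
move=> l m j c y lj c0 cl; apply: (le_trans (cabsM _ _)).
rewrite mulrC -!mulrA; apply: ler_pM; rewrite ?cabs_ge0 ?cabs_expi // mulrA; exact: HC.
Qed.

Lemma cintegrable_hyp_integrand (l m : 'rV[R]_4) j : l ord0 j != 0 ->
  cintegrable (l3 R) (fun y => hyp_integrand l m (hyp_pt l j y)).
Proof.
move=> lj; have [C C0 HC] := hyp_integrand_bound.
have l0 : 0 < `|l|.
  by rewrite normr_gt0; apply: contraNneq lj => ->; rewrite mxE.
apply: (cintegrable_dom (cmeas_hyp_integrand m lj)
  (rintegrableZ (C * (`|l| ^+ (k + 4))^-1) (wt_integral l0).1)) => y.
exact: HC.
Qed.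

Lemma hyp_fourierE (l m : 'rV[R]_4) j : l ord0 j != 0 ->
  hyp_fourier l m = (`|l ord0 j|^-1)%:C%C * cintegral (l3 R) (fun y => hyp_integrand l m (hyp_pt l
    j y)).
Proof.
by move=> lj; apply: int_deltaE => // [i li|]; [exact: cmeas_hyp_integrand|exact:
  cintegrable_hyp_integrand].
Qed.

Lemma hyp_fourier_bound : exists2 C, 0 <= C & forall l m : 'rV[R]_4, l != 0 ->
  cabs (hyp_fourier l m) <= C * (`|l| ^+ (k + 2))^-1.
Proof.
have [C C0 HC] := hyp_integrand_bound.
pose W := \int[l3 R]_y prod3 w43 y.
have W0 : 0 <= W.
  by apply: Rintegral_ge0 => y _; apply: prod3_ge0 => s; rewrite ltW // w43_gt0.
exists (C * W); first by rewrite mulr_ge0.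
(* In the chart of the largest component |l_j| = |l|, and the exponents add up: -1 - (k + 4) + 3 =
   -(k + 2). *)
move=> l m l0; have [j lj E] := rV_max_coord l0.
have n0 : 0 < `|l| by rewrite normr_gt0.
rewrite (hyp_fourierE m lj) cabs_realM E ger0_norm ?invr_ge0 //.
have ii := wt_integral n0.
apply: (@le_trans _ _ (`|l|^-1 * (C * (`|l| ^+ (k + 4))^-1 * (`|l| ^+ 3 * W)))).
  apply: ler_wpM2l; first by rewrite invr_ge0.
  apply: (le_trans (cabs_cintegral (cintegrable_hyp_integrand m lj))).
  rewrite -ii.2 -RintegralZl //; last exact: ii.1.
  apply: le_Rintegral => //.
  - exact: cintegrable_cabs (cintegrable_hyp_integrand m lj).
  - exact: rintegrableZ _ ii.1.
  - by move=> y _; exact: HC.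
rewrite le_eqVlt; apply/orP; left; apply/eqP.
rewrite -[(k + 4)%N]/(k + (2 + 2))%N addnA exprD.
have e2 : `|l| ^+ (k + 2) != 0 by rewrite expf_neq0 // gt_eqF.
have e1 : `|l| != 0 by rewrite gt_eqF.
by field; rewrite e1 e2.
Qed.

Lemma hyp_fourier_cvg (l m : nat -> 'rV[R]_4) (lo mo : 'rV[R]_4) : lo != 0 ->
  (forall A, (fun n => l n ord0 A) @ \oo --> lo ord0 A) ->
  (forall A, (fun n => m n ord0 A) @ \oo --> mo ord0 A) ->
  (fun n => complex.Re (hyp_fourier (l n) (m n))) @ \oo --> complex.Re (hyp_fourier lo mo) /\
  (fun n => complex.Im (hyp_fourier (l n) (m n))) @ \oo --> complex.Im (hyp_fourier lo mo).
Proof.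
move=> lo0 cl cm; have [j loj] := rV_neq0_ex lo0.
have [C C0 HC] := hyp_integrand_bound.
(* The chart [j] of the limit and half of its component there serve a whole tail of the sequence;
   shifting by [N] makes the bounds hold for all indices, as [cdct] demands. *)
pose c := `|lo ord0 j| / 2.
have c0 : 0 < c by rewrite divr_gt0 // normr_gt0.
have [N _ HN] : \forall n \near \oo, c <= `|l n ord0 j|.
  have cn : (fun n => `|l n ord0 j|) @ \oo --> `|lo ord0 j|.
    by apply: (cvg_comp _ _ (cl j)); exact: norm_continuous.
  have /cvgrPdist_le : (fun n => `|l n ord0 j|) @ \oo --> `|lo ord0 j| by [].
  move=> /(_ c c0); apply: filterS => n.
  rewrite ler_norml => /andP[_]; rewrite /c; lra.
pose l' n := l (n + N)%N; pose m' n := m (n + N)%N.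
have cl' A : (fun n => l' n ord0 A) @ \oo --> lo ord0 A.
  by rewrite /l' (cvg_shiftn N (fun n => l n ord0 A)); exact: cl.
have cm' A : (fun n => m' n ord0 A) @ \oo --> mo ord0 A.
  by rewrite /m' (cvg_shiftn N (fun n => m n ord0 A)); exact: cm.
have levi_civita_nat n : c <= `|l' n ord0 j| by apply: HN => /=; rewrite leq_addl.
have lj n : l' n ord0 j != 0 by rewrite -normr_gt0; exact: lt_le_trans (levi_civita_nat n).
have lcn n : c <= `|l' n| by apply: le_trans (levi_civita_nat n) _; exact: coord_le_norm.
suff : (fun n => complex.Re (hyp_fourier (l' n) (m' n))) @ \oo --> complex.Re (hyp_fourier lo mo) /\
    (fun n => complex.Im (hyp_fourier (l' n) (m' n))) @ \oo --> complex.Im (hyp_fourier lo mo).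
  move=> [h1 h2]; split.
    by rewrite -(cvg_shiftn N (fun n => complex.Re (hyp_fourier (l n) (m n)))).
  by rewrite -(cvg_shiftn N (fun n => complex.Im (hyp_fourier (l n) (m n)))).
have Ere : (fun n => complex.Re (hyp_fourier (l' n) (m' n))) = (fun n => complex.Re ((`|l' n ord0
  j|^-1)%:C%C *
    cintegral (l3 R) (fun y => hyp_integrand (l' n) (m' n) (hyp_pt (l' n) j y)))).
  by apply/funext => n; rewrite (hyp_fourierE _ (lj n)).
have Eim : (fun n => complex.Im (hyp_fourier (l' n) (m' n))) = (fun n => complex.Im ((`|l' n ord0
  j|^-1)%:C%C *
    cintegral (l3 R) (fun y => hyp_integrand (l' n) (m' n) (hyp_pt (l' n) j y)))).
  by apply/funext => n; rewrite (hyp_fourierE _ (lj n)).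
rewrite Ere Eim (hyp_fourierE mo loj); apply: cvg_cM.
  split => /=; last exact: cvg_cst.
  apply: cvgV; first by rewrite normr_eq0.
  by apply: (cvg_comp _ _ (cl' j)); exact: norm_continuous.
have cc (y : R * R * R) : cvg3 (fun=> y) y by split; exact: cvg_cst.
apply: (@cdct _ _ _ (l3 R) (fun n y => hyp_integrand (l' n) (m' n) (hyp_pt (l' n) j y))
   (fun y => hyp_integrand lo mo (hyp_pt lo j y)) (fun y => C * (c ^+ (k + 4))^-1 * wt c y)).
- by move=> n; exact: cmeas_hyp_integrand.
- by move=> y; have [] := hyp_integrand_cvg loj lj cl' cm' (cc y).
- by move=> y; have [] := hyp_integrand_cvg loj lj cl' cm' (cc y).
- exact: rintegrableZ _ (wt_integral c0).1.
- by move=> n y; exact: HC.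
Qed.

Lemma hyp_ptZ (s : R) (l : 'rV[R]_4) j y : s != 0 -> hyp_pt (s *: l) j y = hyp_pt l j y.
Proof.
move=> s0; apply/rowP => A; case: (unliftP j A) => [m ->|->]; first by rewrite !hyp_pt_lift.
rewrite !hyp_pt_self !mxE; have [->|lj] := eqVneq (l ord0 j) 0; first by rewrite mulr0 !invr0
  !mulr0.
by field; rewrite lj s0.
Qed.

Lemma hyp_ptZy (s : R) (l : 'rV[R]_4) j y :
  hyp_pt l j (s * y.1.1 + 0, s * y.1.2 + 0, s * y.2 + 0) = s *: hyp_pt l j y.
Proof.
apply/rowP => A; rewrite [RHS]mxE; case: (unliftP j A) => [m ->|->].
  by rewrite !hyp_pt_lift; case: (ord3P m) => ->; rewrite /= addr0.
by rewrite !hyp_pt_self /= !addr0; ring.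
Qed.

(** Homogeneity gives f(omega, s l) = s^-(k+4) f(omega / s, l). Rescaling omega contributes |s|^3
    and the delta function |s|^-1; since |s|^2 = s^2, the total is s^-(k+2) with its sign. The phase
    is unchanged, because m / s pairs with omega as m does with omega / s. *)
Lemma hyp_fourierZ (s : R) (l m : 'rV[R]_4) : s != 0 -> l != 0 ->
  hyp_fourier (s *: l) (s^-1 *: m) = ((s ^+ (k + 2))^-1)%:C%C * hyp_fourier l m.
Proof.
move=> s0 l0; have [j lj] := rV_neq0_ex l0.
have slj : (s *: l) ord0 j != 0 by rewrite mxE mulf_neq0.
have si : s^-1 != 0 by rewrite invr_eq0.
rewrite (hyp_fourierE _ lj) (hyp_fourierE _ slj).
have cA := cov_affine3 ((0, 0, 0) : R * R * R) si.
rewrite [X in _ = _ * (_ * X)](cintegral_cov cA (cmeas_hyp_integrand m lj)).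
have E (y : L3 R) : hyp_integrand (s *: l) (s^-1 *: m) (hyp_pt (s *: l) j y) =
    ((s ^+ (k + 4))^-1)%:C%C * hyp_integrand l m (hyp_pt l j (s^-1 * y.1.1 + 0, s^-1 * y.1.2 + 0,
      s^-1 * y.2 + 0)).
  rewrite hyp_ptZ // hyp_ptZy /hyp_integrand mulrA; congr (_ * expi _).
    have -> : (hyp_pt l j y, s *: l) = s *: (s^-1 *: hyp_pt l j y, l).
      by rewrite -[s *: (_, _)]/(s *: _, s *: _) scalerA divff // scale1r.
    rewrite f_homog // -?exprnN //; rewrite ?exprnN //.
    have := hyp_pt_cone (s^-1 * y.1.1 + 0, s^-1 * y.1.2 + 0, s^-1 * y.2 + 0) lj.
    by rewrite hyp_ptZy.
  by rewrite /hyp_phase; congr (- (2 * _)); apply: eq_bigr => A _; rewrite !mxE; ring.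
rewrite (eq_cintegral _ E).
have ig : cintegrable (l3 R) (fun y : L3 R =>
    hyp_integrand l m (hyp_pt l j (s^-1 * y.1.1 + 0, s^-1 * y.1.2 + 0, s^-1 * y.2 + 0))).
  have := (cintegrable_cov cA (cmeas_hyp_integrand m lj)).2 (cintegrable_hyp_integrand m lj).
  move=> /(cintegrableM_real (`|s^-1| ^+ 3)^-1); apply: eq_cintegrable => y.
  by rewrite /= mulrA -rmorphM mulVf ?mul1r // expf_neq0 // normr_eq0.
rewrite !cintegralMl // !mulrA -!rmorphM; congr ((_)%:C%C * _).
rewrite mxE normrM normfV.
have lj' : `|l ord0 j| != 0 by rewrite normr_eq0.
have s' : `|s| != 0 by rewrite normr_eq0.
have -> : (s ^+ (k + 4))^-1 = (s ^+ (k + 2))^-1 * (`|s| ^+ 2)^-1.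
  by rewrite real_normK ?num_real // -invfM -exprD -addnA.
field; rewrite lj' s' /=; exact: expf_neq0.
Qed.

Lemma hyp_fourierD (c : R) (l m : 'rV[R]_4) : hyp_fourier l (m + c *: l) = hyp_fourier l m.
Proof.
apply: int_delta_ext => w wl; rewrite /hyp_integrand; congr (_ * expi _).
rewrite /hyp_phase; congr (- (2 * _)).
have -> : \sum_(A < 4) (m + c *: l) ord0 A * w ord0 A =
    \sum_(A < 4) m ord0 A * w ord0 A + c * \sum_(A < 4) w ord0 A * l ord0 A.
  by rewrite mulr_sumr -big_split; apply: eq_bigr => A _; rewrite !mxE /=; ring.
by rewrite wl mulr0 addr0.
Qed.

End HyperplaneTransform.

(** * Integrals over the projective line *)

Section Inversion1D.
Context {R : realType}.

Lemma measurable_invr : measurable_fun (setT : set (L1 R)) (fun t : R => t^-1).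
Proof.
have -> : (fun t : R => t^-1) = (fun t => if t == 0 then 0 else if 0 < t then expR (- ln t)
    else - expR (- ln (- t))).
  apply/funext => t; have [->|t0] := eqVneq t 0; first by rewrite invr0.
  case: ltgtP t0 => // [t0|t0] _; first by rewrite expRN lnK ?posrE.
  by rewrite expRN lnK ?posrE ?oppr_gt0 // invrN opprK.
have m1 : measurable_fun (setT : set (L1 R)) (fun t : R => expR (- ln t)).
  apply: measurableT_comp; first exact: measurable_expR.
  by apply: measurableT_comp => //; exact: measurable_ln.
apply: measurable_fun_ifT => //; first exact: measurable_fun_eqr.
apply: measurable_fun_ifT => //; first exact: measurable_fun_ltr.
apply: measurable_funN; apply: (measurableT_comp m1); exact: measurable_funN.
Qed.

Lemma lebesgue0 : lebesgue_measure (set1 (0 : R)) = 0%E.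
Proof. exact: lebesgue_measure_set1. Qed.

(** The blow-up (r, t) -> (r, r t), degenerate on the null line r = 0. *)
Lemma cov_polar : cov (l1 R \xs l1 R) (l1 R \xs l1 R)
  (fun z : L1 R * L1 R => (z.1, z.1 * z.2 + 0 : R)) (fun z => `|z.1|).
Proof.
apply: (@cov_fibR _ _ _ _ _ _ _ (l1 R) (l1 R) (l1 R) (fun z : L1 R * L1 R => z.1 * z.2 + 0 : L1 R)
  (fun z => `|z.1|) [set 0]) => //.
- exact: lebesgue0.
- apply: measurable_funD => //.
  by apply: measurable_funM; [exact: measurable_fst|exact: measurable_snd].
- by apply: measurableT_comp => //; exact: measurable_fst.
- by move=> r /eqP r0; exact: (cov_affine 0 r0).
Qed.

Lemma integral_cw_scale (t : R) : t != 0 ->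
  (\int[l1 R]_r (cw (t * r) * `|t|)%:E = pi%:E)%E.
Proof.
move=> t0; have [ic E] := @cw_integral R.
have mc := rintegrable_meas ic.
have [_ _ _ H] := cov_affine (0 : R) t0.
transitivity (\int[l1 R]_r (cw r)%:E)%E; last by rewrite -E /Rintegral fineK // integrable_fin_num.
rewrite [RHS](H (fun r => (cw r)%:E)); last 2 first.
- exact: emeas.
- by move=> y; rewrite lee_fin; exact: ltW (cw_gt0 y).
by apply: eq_integral => r _; rewrite addr0 EFinM.
Qed.

(* Integrate g(u_1 / u_0) cw(u_0) / |u_0| over the plane, in the coordinates
   u = (r, r t), before and after exchanging u_0 and u_1. *)
Lemma cov_inv : cov (l1 R) (l1 R) (fun t : L1 R => t^-1 : R) (fun t => t ^- 2).
Proof.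
split.
- exact: measurable_invr.
- under eq_fun do rewrite -exprVn.
  by apply: measurable_funX; exact: measurable_invr.
- by move=> t; rewrite invr_ge0 sqr_ge0.
move=> g mg g0.
(* The factor 1 / |r| cancels the Jacobian of [cov_polar] and leaves [cw], of mass [pi]. *)
pose v (r : R) : R := cw r * `|r|^-1.
have v0 r : 0 <= v r by apply: mulr_ge0; [exact: ltW (cw_gt0 r)|rewrite invr_ge0].
have mv : measurable_fun (setT : set (L1 R)) v.
  apply: measurable_funM; first exact: rintegrable_meas (@cw_integral R).1.
  apply: (measurableT_comp (f := fun t : L1 R => t^-1 : L1 R) measurable_invr).
  exact: (@normr_measurable R setT).
pose K (z : L1 R * L1 R) : \bar R := (g (z.2 * z.1^-1)%R * (v z.1)%:E)%E.
have K0 z : (0 <= K z)%E by rewrite mule_ge0 // lee_fin.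
have mK : measurable_fun setT K.
  apply: emeasurable_funM.
    apply: (measurableT_comp mg); apply: measurable_funM; first exact: measurable_snd.
    exact: (measurableT_comp measurable_invr measurable_fst).
  by apply: emeas; exact: (measurableT_comp mv measurable_fst).
have [ic cE] := @cw_integral R.
have cEe : (\int[l1 R]_r (cw r)%:E = pi%:E)%E.
  by rewrite -cE /Rintegral fineK // integrable_fin_num.
have [mp mw w0 HP] := cov_polar.
have [ms _ _ HS] := cov_swap (l1 R) (l1 R).
have E1 : (\int[l1 R \xs l1 R]_z K z = pi%:E * \int[l1 R]_t g t)%E.
  rewrite HP // tonelli1; last 2 first.
  - apply: emeasurable_funM; first exact: (measurableT_comp mK mp).
    exact: emeas.
  - by move=> z; rewrite mule_ge0 // lee_fin.
  transitivity (\int[l1 R]_r ((cw r)%:E * \int[l1 R]_t g t))%E.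
    apply: ae_eq_integral => //.
    - apply: (tonelli_measurable1 (l1 R) (f := fun z : L1 R * L1 R =>
          (K (z.1, (z.1 * z.2 + 0)%R) * (`|z.1|)%:E)%E)).
        by apply: emeasurable_funM; [exact: (measurableT_comp mK mp)|exact: emeas].
      by move=> z; rewrite mule_ge0 // lee_fin.
    - apply: emeasurable_funM; last exact: measurable_cst.
      by apply: emeas; exact: rintegrable_meas ic.
    exists [set 0]; split => //; first exact: lebesgue0.
    move=> r /= /not_implyP[_ nr]; apply: contrapT => /eqP r0; apply: nr.
    rewrite -ge0_integralZl //; last by rewrite lee_fin; exact: ltW (cw_gt0 r).
    apply: eq_integral => t _; rewrite /K /v /= addr0 mulrC mulKf // -muleA -EFinM.
    by rewrite divfK ?normr_eq0 // muleC.
  rewrite ge0_integralZr //; first by rewrite cEe.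
  - by apply: emeas; exact: rintegrable_meas ic.
  - by move=> r _; rewrite lee_fin; exact: ltW (cw_gt0 r).
  - by apply: integral_ge0.
have E2 : (\int[l1 R \xs l1 R]_z K z = pi%:E * \int[l1 R]_t (g (t^-1)%R * (t ^- 2)%:E))%E.
  have mKs : measurable_fun setT (fun z : L1 R * L1 R => (K (z.2, z.1) * 1%:E)%E).
    by apply: emeasurable_funM => //; exact: (measurableT_comp mK ms).
  rewrite HS // HP //; last by move=> z; rewrite mule_ge0.
  have mL : measurable_fun setT (fun z : L1 R * L1 R =>
      (K ((z.1 * z.2 + 0)%R, z.1) * 1%:E * (`|z.1|)%:E)%E).
    apply: emeasurable_funM; last exact: emeas.
    exact: (measurableT_comp mKs mp).
  rewrite tonelli1 //; last by move=> z; rewrite mule_ge0 ?lee_fin // mule_ge0.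
  rewrite (tonelli12 (l1 R) (l1 R) mL); last by move=> z; rewrite mule_ge0 ?lee_fin // mule_ge0.
  rewrite -ge0_integralZl //; last 3 first.
  - apply: emeasurable_funM; first exact: (measurableT_comp mg measurable_invr).
    apply: emeas; under eq_fun do rewrite -exprVn.
    by apply: measurable_funX; exact: measurable_invr.
  - by move=> t _; rewrite mule_ge0 // lee_fin invr_ge0 sqr_ge0.
  - by rewrite lee_fin pi_ge0.
  apply: eq_integral => t _.
  (* At t = 0 both sides vanish, since 0^-1 = 0. *)
  have [->|t0] := eqVneq t 0.
    rewrite expr0n /= invr0 !mule0; apply: integral0_eq => r _.
    by rewrite /K /v /= mulr0 addr0 normr0 invr0 !mulr0 mule0 !mul0e.
  transitivity (\int[l1 R]_r ((g (t^-1)%R * (t ^- 2)%:E) * (cw (t * r) * `|t|)%:E))%E.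
    apply: ae_eq_integral => //.
    - exact: (measurableT_comp mL (pair2_measurable t)).
    - apply: emeasurable_funM; first exact: measurable_cst.
      apply: emeas; apply: measurable_funM => //.
      apply: (measurableT_comp (rintegrable_meas ic)).
      by apply: measurable_funM.
    exists [set 0]; split => //; first exact: lebesgue0.
    move=> r /= /not_implyP[_ nr]; apply: contrapT => /eqP r0; apply: nr.
    (* For nonzero r and t, |t r|^-1 |r| = t^-2 |t|, so the weight [t ^- 2] splits off an integrand
       of mass [pi] in r. *)
    have -> : K ((r * t + 0)%R, r) =
        (g (t^-1)%R * (cw (t * r) * `|t * r|^-1)%:E)%E.
      by rewrite /K /v /= addr0 invfM mulrA mulfV // mul1r (mulrC r t).
    rewrite mule1 -!muleA -!EFinM; congr (_ * (_)%:E)%E.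
    rewrite -(real_normK (num_real t)) normrM /=; field.
    by rewrite !normr_eq0 r0 t0.
  rewrite ge0_integralZl //.
  - by rewrite integral_cw_scale // muleC.
  - apply: emeas; apply: measurable_funM => //.
    apply: (measurableT_comp (rintegrable_meas ic)).
    by apply: measurable_funM.
  - by move=> r _; rewrite lee_fin mulr_ge0 //; exact: ltW (cw_gt0 _).
  - by rewrite mule_ge0 // lee_fin invr_ge0 sqr_ge0.
have pi0 : (pi%:E != 0 :> \bar R)%E by rewrite eqe gt_eqF // pi_gt0.
have := E1; rewrite E2 => /(congr1 (fun x => (pi^-1)%:E * x))%E.
by rewrite !muleA -!EFinM mulVf ?gt_eqF ?pi_gt0 // !mul1e => ->.
Qed.

End Inversion1D.

Section ProjectiveLine.
Context {R : realType}.

Lemma cvgn_prod (I : Type) (s : seq I) (u : nat -> I -> R) (v : I -> R) :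
  (forall i, (fun n => u n i) @ \oo --> v i) ->
  (fun n => \prod_(i <- s) u n i) @ \oo --> \prod_(i <- s) v i.
Proof.
move=> H; elim: s => [|i s IH].
  by rewrite big_nil; under eq_fun do rewrite big_nil; exact: cvg_cst.
by rewrite big_cons; under eq_fun do rewrite big_cons; exact: cvgM.
Qed.

Lemma cvgn_bounded (u : nat -> R) (a : R) : u @ \oo --> a ->
  \forall n \near \oo, `|u n| <= `|a| + 1.
Proof.
move=> /cvgrPdist_le/(_ 1 ltr01); apply: filterS => n h.
by have := ler_normD (u n - a) a; rewrite subrK distrC; lra.
Qed.

Lemma eq_cintegral_off_point (h g : R -> R[i]) (t0 : R) :
  cmeas (h : L1 R -> _) -> cmeas (g : L1 R -> _) -> (forall t, t != t0 -> h t = g t) ->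
  cintegral (l1 R) h = cintegral (l1 R) g.
Proof.
move=> [h1 h2] [g1 g2] E.
have P (a b : R -> R) : measurable_fun (setT : set (L1 R)) a ->
    measurable_fun (setT : set (L1 R)) b -> (forall t, t != t0 -> a t = b t) ->
    \int[l1 R]_t a t = \int[l1 R]_t b t.
  move=> ma mb ab; rewrite /Rintegral; congr fine; apply: ae_eq_integral => //.
  - exact: emeas.
  - exact: emeas.
  exists [set t0]; split => //; first exact: lebesgue_measure_set1.
  move=> t /= /not_implyP[_ nt]; apply: contrapT => /eqP tt; apply: nt.
  by rewrite ab.
rewrite /cintegral (P (fun t => complex.Re (h t)) (fun t => complex.Re (g t))) //; last first.
  by move=> t /E ->.
by rewrite (P (fun t => complex.Im (h t)) (fun t => complex.Im (g t))) // => t /E ->.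
Qed.

Definition line_spinor (l : 'M[R]_(2, 4)) (t : R) : 'rV[R]_4 := \row_A (l 0 A + t * l 1 A).

(** Both P_AB and t P_AB are skew combinations of the line spinor with a row of [l], and each is
    thus at most 2 b times its norm. Hence the line spinor grows at least like 1 + |t|, with
    constants that depend only on bounds for [l] and for one component of the momentum. *)
Lemma line_spinor_bound (l : 'M[R]_(2, 4)) (A B : 'I_4) (b c t : R) :
  (forall i C, `|l i C| <= b) -> c <= `|momentum l A B| ->
  (1 + `|t|) * c <= 4 * b * `|line_spinor l t|.
Proof.
move=> lb cP; have b0 : 0 <= b by exact: le_trans (lb 0 A).
have hA : `|line_spinor l t ord0 A| <= `|line_spinor l t| by exact: coord_le_norm.
have hB : `|line_spinor l t ord0 B| <= `|line_spinor l t| by exact: coord_le_norm.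
have P1 : momentum l A B = line_spinor l t ord0 A * l 1 B - l 1 A * line_spinor l t ord0 B.
  by rewrite !mxE; ring.
have P2 : t * momentum l A B = l 0 A * line_spinor l t ord0 B - line_spinor l t ord0 A * l 0 B.
  by rewrite !mxE; ring.
have Q (x y z w : R) : `|x| <= `|line_spinor l t| -> `|y| <= b -> `|z| <= b -> `|w| <=
  `|line_spinor l t| ->
    `|x * y - z * w| <= 2 * b * `|line_spinor l t|.
  move=> hx hy hz hw; apply: (le_trans (ler_normB _ _)); rewrite !normrM.
  have e1 : `|x| * `|y| <= `|line_spinor l t| * b by exact: ler_pM.
  have e2 : `|z| * `|w| <= b * `|line_spinor l t| by exact: ler_pM.
  lra.
have Q1 : `|momentum l A B| <= 2 * b * `|line_spinor l t| by rewrite P1; exact: Q.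
have Q2 : `|t| * `|momentum l A B| <= 2 * b * `|line_spinor l t|.
  by rewrite -normrM P2 distrC; apply: Q.
have Q3 : `|t| * c <= `|t| * `|momentum l A B| by exact: ler_wpM2l.
lra.
Qed.

Lemma momentum_neq0 (l : 'M[R]_(2, 4)) : momentum l != 0 ->
  exists A B, momentum l A B != 0.
Proof.
move=> l0; apply: contrapT => H; move/eqP: l0; apply.
apply/matrixP => A B; rewrite [RHS]mxE; apply/eqP; apply: contrapT => /negP h.
by apply: H; exists A, B.
Qed.

Lemma line_spinor_neq0 (l : 'M[R]_(2, 4)) t : momentum l != 0 -> line_spinor l t != 0.
Proof.
move=> /momentum_neq0[A [B P0]]; apply/eqP => L0.
have lb i C : `|l i C| <= `|l| by exact: coord_le_norm.
have := line_spinor_bound t lb (lexx `|momentum l A B|); rewrite L0 normr0 mulr0.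
by apply/negP; rewrite -ltNge mulr_gt0 ?normr_gt0 // ltr_pwDl.
Qed.

Variables (k : nat) (f : 'rV[R]_4 * 'rV[R]_4 -> R[i]).
Hypotheses (f_smooth : smooth_on_cone f)
  (f_homog : homogeneous_on_cone (- (k + 4)%N%:Z) f).

(** One integrand for two uses: [p i + t * q i] is u_a when [p], [q] are the indicators of a = 0 and
    a = 1, and a component of the line spinor when they are components of the rows of [l]. *)
Definition line_integrand (p q : 'I_k -> R) (l : 'M[R]_(2, 4)) (t : R) : R[i] :=
  (\prod_(i < k) (p i + t * q i))%:C%C * hyp_fourier f (line_spinor l t) (row 1 l).

Definition line_int (p q : 'I_k -> R) (l : 'M[R]_(2, 4)) : R[i] := cintegral (l1 R)
  (line_integrand p q l).

(** The k linear factors grow like (1 + |t|)^k and [hyp_fourier] decays like (1 + |t|)^-(k+2), which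
    leaves (1 + |t|)^-2 <= [cw t]. The constant is explicit in [b], [c], [M], hence uniform for [l]
    near a limit. *)
Lemma line_integrand_bound : exists2 C : R, 0 <= C & forall p q (l : 'M[R]_(2, 4)) t A B b c M,
  (forall i C, `|l i C| <= b) -> 0 < c -> c <= `|momentum l A B| ->
  (forall i, `|p i| <= M) -> (forall i, `|q i| <= M) -> 0 <= M ->
  cabs (line_integrand p q l t) <= C * M ^+ k * (4 * b / c) ^+ (k + 2) * cw t.
Proof.
have [C C0 HC] := hyp_fourier_bound f_smooth f_homog.
exists C => // p q l t A B b c M lb c0 cP pM qM M0.
have P0 : momentum l A B != 0 by rewrite -normr_gt0; exact: lt_le_trans cP.
have l0 : momentum l != 0 by apply: contra P0 => /eqP ->; rewrite mxE.
have L0 := line_spinor_neq0 t l0.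
have LB := line_spinor_bound t lb cP.
have s0 : 0 < 1 + `|t| by rewrite ltr_pwDl.
have n0 : 0 < `|line_spinor l t| by rewrite normr_gt0.
have b0 : 0 < b.
  have : 0 < 4 * b * `|line_spinor l t| by apply: lt_le_trans LB; exact: mulr_gt0.
  by rewrite (pmulr_lgt0 _ n0); lra.
rewrite /line_integrand cabs_realM.
have prodB : `|\prod_(i < k) (p i + t * q i)| <= (M * (1 + `|t|)) ^+ k.
  rewrite normr_prod -[X in _ ^+ X](card_ord k) -prodr_const.
  apply: ler_prod => i _; rewrite normr_ge0 /=.
  apply: (le_trans (ler_normD _ _)); rewrite normrM mulrDr mulr1.
  by apply: lerD => //; rewrite mulrC; apply: ler_wpM2r.
apply: (@le_trans _ _ ((M * (1 + `|t|)) ^+ k * (C * ((4 * b / c) ^+ (k + 2) * ((1 + `|t|) ^+ (k +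
  2))^-1)))).
  apply: ler_pM => //; first exact: cabs_ge0.
  apply: (le_trans (HC _ _ L0)); apply: ler_wpM2l => //.
  rewrite -exprVn -exprVn -exprMn; apply: lerXn2r; rewrite ?nnegrE ?invr_ge0 //.
    by rewrite mulr_ge0 ?invr_ge0 ?(ltW s0) // divr_ge0 ?mulr_ge0 ?ltW.
  rewrite -ler_pV2 ?inE ?unitfE ?gt_eqF ?invr_gt0 ?mulr_gt0 ?divr_gt0 ?mulr_gt0 //= ?invr_gt0 //.
  rewrite invrK invfM invrK invf_div mulrC mulrA ler_pdivrMr ?mulr_gt0 //.
  by rewrite [leRHS]mulrC.
have sq : ((1 + `|t|) ^+ 2)^-1 <= cw t.
  rewrite lef_pV2 ?posrE ?exprn_gt0 //; last by have := sqr_ge0 t; lra.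
  by have := normr_ge0 t; rewrite sqrrD expr1n mul1r -(real_normK (num_real t)) -mulr_natr; lra.
rewrite [leLHS](_ : _ = C * M ^+ k * (4 * b / c) ^+ (k + 2) * ((1 + `|t|) ^+ 2)^-1).
  apply: ler_wpM2l => //; apply: mulr_ge0; first by rewrite mulr_ge0 ?exprn_ge0.
  by rewrite exprn_ge0 // divr_ge0 ?mulr_ge0 ?ltW.
rewrite exprMn !(exprD (1 + `|t|)) invfM; set e := (4 * b / c) ^+ _; field.
by rewrite !expf_neq0 // gt_eqF.
Qed.

Lemma line_integrand_cvg (p q : nat -> 'I_k -> R) (p0 q0 : 'I_k -> R) (l : nat -> 'M[R]_(2, 4)) lo
    (t : nat -> R) (t0 : R) : momentum lo != 0 ->
  (forall i, (fun n => p n i) @ \oo --> p0 i) -> (forall i, (fun n => q n i) @ \oo --> q0 i) ->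
  (forall i A, (fun n => l n i A) @ \oo --> lo i A) -> t @ \oo --> t0 ->
  (fun n => complex.Re (line_integrand (p n) (q n) (l n) (t n))) @ \oo --> complex.Re
    (line_integrand p0 q0 lo t0) /\
  (fun n => complex.Im (line_integrand (p n) (q n) (l n) (t n))) @ \oo --> complex.Im
    (line_integrand p0 q0 lo t0).
Proof.
move=> l0 pc qc levi_civita_nat tc; apply: cvg_cM.
  split => /=; last exact: cvg_cst.
  apply: cvgn_prod => i; apply: cvgD => //; exact: cvgM.
apply: (hyp_fourier_cvg f_smooth f_homog); first exact: line_spinor_neq0.
  move=> A; rewrite mxE; under eq_fun do rewrite mxE.
  by apply: cvgD => //; apply: cvgM.
by move=> A; rewrite mxE; under eq_fun do rewrite mxE; exact: levi_civita_nat.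
Qed.

Lemma measurable_seq1 (g : R -> R) :
  (forall (u : nat -> R) (y : R), u @ \oo --> y -> (fun n => g (u n)) @ \oo --> g y) ->
  measurable_fun (setT : set (L1 R)) g.
Proof.
move=> H; apply: continuous_measurable_fun => x.
by apply: (@seq_continuous R R^o g x) => u; exact: H.
Qed.

Lemma cmeas_line_integrand p q l : momentum l != 0 -> cmeas (line_integrand p q l : L1 R -> R[i]).
Proof.
by move=> l0; split; apply: measurable_seq1 => u y uy;
  have [] := @line_integrand_cvg (fun=> p) (fun=> q) p q (fun=> l) l u y l0
    (fun i => cvg_cst _) (fun i => cvg_cst _) (fun i A => cvg_cst _) uy.
Qed.

Lemma cintegrable_line_integrand p q l : momentum l != 0 -> cintegrable (l1 R) (line_integrand p q
  l).
Proof.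
move=> l0; have [A [B P0]] := momentum_neq0 l0.
have [C C0 HC] := line_integrand_bound.
pose M := \sum_(i < k) (`|p i| + `|q i|).
have pqM i : `|p i| + `|q i| <= M.
  rewrite /M (bigD1 i) //= lerDl; apply: sumr_ge0 => j _; exact: addr_ge0.
have M0 : 0 <= M by apply: sumr_ge0 => i _; exact: addr_ge0.
apply: (@cintegrable_dom _ _ _ (l1 R) (line_integrand p q l)
  (fun t => C * M ^+ k * (4 * `|l| / `|momentum l A B|) ^+ (k + 2) * cw t)).
- exact: cmeas_line_integrand.
- exact: rintegrableZ (@cw_integral R).1.
move=> t; apply: (HC p q l t A B) => //.
- by move=> i D; exact: coord_le_norm.
- by rewrite normr_gt0.
- by move=> i; apply: le_trans (pqM i); rewrite lerDl.
- by move=> i; apply: le_trans (pqM i); rewrite lerDr.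
Qed.

Lemma line_int_cvg p q (l : nat -> 'M[R]_(2, 4)) lo : momentum lo != 0 ->
  (forall i A, (fun n => l n i A) @ \oo --> lo i A) ->
  (fun n => complex.Re (line_int p q (l n))) @ \oo --> complex.Re (line_int p q lo) /\
  (fun n => complex.Im (line_int p q (l n))) @ \oo --> complex.Im (line_int p q lo).
Proof.
move=> l0 levi_civita_nat; have [A [B P0]] := momentum_neq0 l0.
have [C C0 HC] := line_integrand_bound.
pose M := \sum_(i < k) (`|p i| + `|q i|).
have pqM i : `|p i| + `|q i| <= M.
  rewrite /M (bigD1 i) //= lerDl; apply: sumr_ge0 => j _; exact: addr_ge0.
have M0 : 0 <= M by apply: sumr_ge0 => i _; exact: addr_ge0.
(* Half of a nonzero component of the limiting momentum, and the norm of the limit plus 1, are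
   bounds valid along a whole tail of the sequence. *)
pose c := `|momentum lo A B| / 2.
have c0 : 0 < c by rewrite divr_gt0 // normr_gt0.
pose b := `|lo| + 1.
have near1 : \forall n \near \oo, forall iA : 'I_2 * 'I_4, `|l n iA.1 iA.2| <= b.
  apply: filter_forall => -[i D] /=; apply: filterS (cvgn_bounded (levi_civita_nat i D)) => n h.
  by apply: (le_trans h); rewrite lerD2r; exact: coord_le_norm.
have near2 : \forall n \near \oo, c <= `|momentum (l n) A B|.
  have cP : (fun n => momentum (l n) A B) @ \oo --> momentum lo A B.
    rewrite mxE; under eq_fun do rewrite mxE.
    by apply: cvgB; apply: cvgM.
  move/cvgrPdist_le : cP => /(_ c c0); apply: filterS => n h.
  have := ler_normD (momentum lo A B - momentum (l n) A B) (momentum (l n) A B).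
  by rewrite subrK; move: h; rewrite /c; lra.
have [N _ HN] := filterI near1 near2.
have l0n n : momentum (l (n + N)%N) != 0.
  have [_ h] := HN _ (leq_addl n N); apply/eqP => E; move: h.
  by rewrite E mxE normr0 leNgt c0.
rewrite -(cvg_shiftn N) -(cvg_shiftn N (fun n => complex.Im _)).
apply: (cdct (h_ := fun n => line_integrand p q (l (n + N)%N)) (mu := l1 R)
  (g' := fun t => C * M ^+ k * (4 * b / c) ^+ (k + 2) * cw t)).
- by move=> n; exact: cmeas_line_integrand.
- move=> t; have [h _] := @line_integrand_cvg (fun=> p) (fun=> q) p q l lo (fun=> t) t l0
    (fun i => cvg_cst _) (fun i => cvg_cst _) levi_civita_nat (cvg_cst _).
  by rewrite (cvg_shiftn N (fun n => complex.Re (line_integrand p q (l n) t))).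
- move=> t; have [_ h] := @line_integrand_cvg (fun=> p) (fun=> q) p q l lo (fun=> t) t l0
    (fun i => cvg_cst _) (fun i => cvg_cst _) levi_civita_nat (cvg_cst _).
  by rewrite (cvg_shiftn N (fun n => complex.Im (line_integrand p q (l n) t))).
- exact: rintegrableZ (@cw_integral R).1.
move=> n t; have [h1 h2] := HN _ (leq_addl n N).
apply: (HC p q _ t A B) => //.
- by move=> i D; exact: (h1 (i, D)).
- by move=> i; apply: le_trans (pqM i); rewrite lerDl.
- by move=> i; apply: le_trans (pqM i); rewrite lerDr.
Qed.

Definition ftilde (l : 'M[R]_(2, 4)) (a : k.-tuple 'I_2) : R[i] :=
  line_int (fun i => (tnth a i == 0)%:R) (fun i => (tnth a i == 1)%:R) l.

Definition ftilde_contr (l : 'M[R]_(2, 4)) (A : k.-tuple 'I_4) : R[i] :=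
  line_int (fun i => l 0 (tnth A i)) (fun i => l 1 (tnth A i)) l.

Lemma sumI2 (V : nmodType) (F : 'I_2 -> V) : \sum_i F i = F 0 + F 1.
Proof. by rewrite !big_ord_recl big_ord0 addr0; congr (F _ + F _); apply: val_inj. Qed.

Lemma sum_prod_tuple (C : comNzRingType) (n : nat) (J : finType) (F : 'I_n -> J -> C) :
  \sum_(a : n.-tuple J) \prod_(i < n) F i (tnth a i) = \prod_(i < n) \sum_j F i j.
Proof.
rewrite bigA_distr_bigA /= (reindex (fun g : {ffun 'I_n -> J} => [tuple g i | i < n])) /=.
  by apply: eq_bigr => g _; apply: eq_bigr => i _; rewrite tnth_mktuple.
exists (fun a : n.-tuple J => [ffun i => tnth a i]).
  by move=> g _; apply/ffunP => i; rewrite ffunE tnth_mktuple.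
by move=> a _; apply: eq_from_tnth => i; rewrite tnth_mktuple ffunE.
Qed.

(** Each factor l^0 + t l^1 of the product is a sum over one spinor index; expanding the product
    gives a sum over the tuples [a], which is then exchanged with the integral. *)
Lemma ftilde_contract l A : momentum l != 0 ->
  ftilde_contr l A = \sum_(a : k.-tuple 'I_2) ftilde l a * (\prod_(i < k) l (tnth a i) (tnth A
    i))%:C%C.
Proof.
move=> l0; rewrite /ftilde_contr /line_int.
pose F (a : k.-tuple 'I_2) (t : R) : R[i] := (\prod_(i < k) l (tnth a i) (tnth A i))%:C%C *
  line_integrand (fun i => (tnth a i == 0)%:R) (fun i => (tnth a i == 1)%:R) l t.
have iF a : cintegrable (l1 R) (F a).
  by apply: cintegrableMl; exact: cintegrable_line_integrand.
have [_ E] := cintegral_sum (index_enum _) iF.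
transitivity (\sum_a cintegral (l1 R) (F a)); last first.
  apply: eq_bigr => a _; rewrite /F (cintegralMl _ (cintegrable_line_integrand _ _ l0)).
  exact: mulrC.
rewrite -E; apply: eq_cintegral => t.
have EF a : F a t = (\prod_(i < k) (l (tnth a i) (tnth A i) *
    ((tnth a i == 0)%:R + t * (tnth a i == 1)%:R)))%:C%C * hyp_fourier f (line_spinor l t) (row 1
      l).
  by rewrite /F /line_integrand mulrA -rmorphM /= -big_split.
rewrite (eq_bigr _ (fun a _ => EF a)) /line_integrand.
rewrite -mulr_suml -rmorph_sum /=; congr (_%:C%C * _).
have EL i : l 0 (tnth A i) + t * l 1 (tnth A i) =
    \sum_(b : 'I_2) l b (tnth A i) * ((b == 0)%:R + t * (b == 1)%:R).
  rewrite sumI2 (_ : (0 == 1 :> 'I_2) = false) // (_ : (1 == 0 :> 'I_2) = false) // !eqxx /=. ring.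
rewrite (eq_bigr _ (fun i _ => EL i)).
symmetry; exact: (sum_prod_tuple (fun i b => l b (tnth A i) * ((b == 0)%:R + t * (b == 1)%:R))).
Qed.

Lemma ftilde_sym l (a : k.-tuple 'I_2) (s : 'S_k) : ftilde l [tuple tnth a (s i) | i < k] = ftilde
  l a.
Proof.
apply: eq_cintegral => t; congr (_%:C%C * _).
rewrite [RHS](reindex_inj (@perm_inj _ s)) /=.
by apply: eq_bigr => i _; rewrite !tnth_mktuple.
Qed.

Lemma ftilde_continuous l a : momentum l != 0 ->
  {for l, continuous (fun m => complex.Re (ftilde m a))} /\
  {for l, continuous (fun m => complex.Im (ftilde m a))}.
Proof.
move=> l0; split; apply: seq_continuous => u ul;
  by have [] := line_int_cvg (fun i => (tnth a i == 0)%:R) (fun i => (tnth a i == 1)%:R) l0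
    (fun i A => cvgn_coord ul).
Qed.

Definition spinor_form (A : k.-tuple 'I_4) (l m : 'rV[R]_4) : R[i] :=
  (\prod_(i < k) l ord0 (tnth A i))%:C%C * hyp_fourier f l m.

Lemma ftilde_contrE l A : ftilde_contr l A = cintegral (l1 R) (fun t => spinor_form A (line_spinor
  l t) (row 1 l)).
Proof.
apply: eq_cintegral => t; congr (_%:C%C * _).
by apply: eq_bigr => i _; rewrite mxE.
Qed.

Lemma cmeas_spinor_form l A : momentum l != 0 ->
  cmeas ((fun t => spinor_form A (line_spinor l t) (row 1 l)) : L1 R -> R[i]).
Proof.
move=> l0; rewrite (_ : (fun t => _) = line_integrand (fun i => l 0 (tnth A i)) (fun i => l 1
  (tnth A i)) l).
  exact: cmeas_line_integrand.
apply/funext => t; congr (_%:C%C * _).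
by apply: eq_bigr => i _; rewrite mxE.
Qed.

(** The components give s^k against s^-(k+2) from [hyp_fourierZ]; the multiple of the spinor added
    to [m] is absorbed by [hyp_fourierD]. *)
Lemma spinor_formZ A s l m c : s != 0 -> l != 0 ->
  spinor_form A (s *: l) (s^-1 *: m + c *: (s *: l)) = (s ^- 2)%:C%C * spinor_form A l m.
Proof.
move=> s0 l0; rewrite /spinor_form hyp_fourierD (hyp_fourierZ f_smooth f_homog) // mulrA -rmorphM
  mulrA -rmorphM /=.
congr (_%:C%C * _).
under eq_bigr do rewrite mxE.
rewrite big_split /= prodr_const card_ord exprD; field.
by rewrite s0 expf_neq0.
Qed.

(* SL(2) acts on the affine coordinate t of u by a Moebius transformation; the
   weight -2 of spinor_form compensates its Jacobian. *)
Lemma ftilde_contr_momentum l l' A : momentum l != 0 -> momentum l' = momentum l -> ftilde_contr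
  l' A = ftilde_contr l A.
Proof.
move=> l0 EP; have [B [D P0]] := momentum_neq0 l0.
have l'0 : momentum l' != 0 by rewrite EP.
set P := momentum l B D in P0.
have PE : P = l 0 B * l 1 D - l 1 B * l 0 D by rewrite /P mxE.
have M (i j : 'I_4) : l' 0 i * l' 1 j - l' 1 i * l' 0 j = l 0 i * l 1 j - l 1 i * l 0 j.
  by have := congr1 (fun X : 'M[R]_4 => X i j) EP; rewrite !mxE.
(* Cramer's rule on the columns [B], [D] expresses the rows of [l'] through those of [l]. The
   equality of all 2 by 2 minors extends this to every column and makes the determinant 1. *)
pose a := (l' 0 B * l 1 D - l' 0 D * l 1 B) / P.
pose b := (l' 0 D * l 0 B - l' 0 B * l 0 D) / P.
pose c := (l' 1 B * l 1 D - l' 1 D * l 1 B) / P.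
pose d := (l' 1 D * l 0 B - l' 1 B * l 0 D) / P.
have Pdiv x : P * (x / P) = x by rewrite mulrC divfK.
have Eab i : l' 0 i = a * l 0 i + b * l 1 i.
  apply: (mulfI P0); rewrite mulrDr (mulrA P a) (mulrA P b) !Pdiv.
  rewrite PE -(M B D) [RHS](_ : _ = l' 0 B * (l 0 i * l 1 D - l 1 i * l 0 D) +
    l' 0 D * (l 0 B * l 1 i - l 1 B * l 0 i)); first by rewrite -(M i D) -(M B i); ring.
  ring.
have Ecd i : l' 1 i = c * l 0 i + d * l 1 i.
  apply: (mulfI P0); rewrite mulrDr (mulrA P c) (mulrA P d) !Pdiv.
  rewrite PE -(M B D) [RHS](_ : _ = l' 1 B * (l 0 i * l 1 D - l 1 i * l 0 D) +
    l' 1 D * (l 0 B * l 1 i - l 1 B * l 0 i)); first by rewrite -(M i D) -(M B i); ring.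
  ring.
have det1 : a * d - b * c = 1.
  apply: (mulfI P0); rewrite mulr1 [RHS]PE -(M B D) !Eab !Ecd PE; ring.
have wt_lam t : line_spinor l' t = (a + t * c) *: row 0 l + (b + t * d) *: row 1 l.
  by apply/rowP => i; rewrite !mxE Eab Ecd; ring.
have lamE t : line_spinor l t = row 0 l + t *: row 1 l.
  by apply/rowP => i; rewrite !mxE.
have r1 : row 1 l' = c *: row 0 l + d *: row 1 l.
  by apply/rowP => i; rewrite !mxE Ecd.
have mJ := cmeas_spinor_form A l0.
rewrite !ftilde_contrE; have [c0|c0] := eqVneq c 0.
  have ad : a * d = 1 by rewrite -det1 c0 mulr0 subr0.
  have d0 : d != 0 by apply/eqP => h; move/eqP: ad; rewrite h mulr0 eq_sym oner_eq0.
  have aE : a = d^-1 by rewrite -[LHS]mulr1 -(mulfV d0) mulrA ad mul1r.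
  have dd0 : d ^+ 2 != 0 by rewrite expf_neq0.
  (* For c = 0 the Moebius map is affine: (b + d t) / a = d^2 t + d b. *)
  apply: etrans (esym (cintegral_cov (cov_affine (d * b) dd0) mJ)); apply: eq_cintegral => t.
  rewrite wt_lam r1 c0 scale0r add0r mulr0 addr0.
  have -> : a *: row 0 l + (b + t * d) *: row 1 l = a *: line_spinor l (d ^+ 2 * t + d * b).
    by rewrite lamE scalerDr scalerA aE; congr (_ + _ *: _); field.
  have -> : d *: row 1 l = a^-1 *: row 1 l + 0 *: (a *: line_spinor l (d ^+ 2 * t + d * b)).
    by rewrite scale0r addr0 aE invrK.
  rewrite spinor_formZ ?line_spinor_neq0 ?aE ?invr_eq0 //.
  by rewrite exprVn invrK ger0_norm // sqr_ge0.
have ci0 : - c^-1 != 0 by rewrite oppr_eq0 invr_eq0.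
(* For nonzero c the Moebius map (b + d t) / (a + c t) equals d / c - 1 / (c (c t + a)): an affine
   map, an inversion and an affine map in turn, with its pole at t = -a / c. *)
have C1 := cov_comp (cov_comp (cov_affine a c0) cov_inv) (cov_affine (d / c) ci0).
apply: etrans (esym (cintegral_cov C1 mJ)).
apply: (@eq_cintegral_off_point _ _ (- a / c)).
- exact: cmeas_spinor_form.
- have [w1 w2 _ _] := C1; apply: cmeasM.
    by split; [exact: w2|exact: measurable_cst].
  exact: (cmeas_comp mJ w1).
move=> t tN; set s := c * t + a.
have s0 : s != 0.
  apply: contra tN => h; have ct : c * t = - a by apply/eqP; rewrite -subr_eq0 opprK.
  by apply/eqP; rewrite -ct mulrAC mulfV // mul1r.
rewrite /= -/s; set v := - c^-1 * s^-1 + d / c.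
have E1 : line_spinor l' t = s *: line_spinor l v.
  rewrite wt_lam lamE scalerDr scalerA; congr (_ *: _ + _ *: _); first by rewrite /s; ring.
  have -> : s * v = (s * d - 1) / c by rewrite /v; field; rewrite c0 s0.
  by rewrite -det1 /s; field.
have E2 : row 1 l' = s^-1 *: row 1 l + (c / s) *: (s *: line_spinor l v).
  rewrite r1 lamE scalerA divfK // scalerDr scalerA addrCA -scalerDl; congr (_ + _ *: _).
  by rewrite /v; field; rewrite c0 s0.
rewrite E1 E2 spinor_formZ ?line_spinor_neq0 //; congr (_%:C%C * _).
by rewrite normrN normfV mulrCA mulVf ?normr_eq0 // mulr1.
Qed.

End ProjectiveLine.

(** * The momentum pairing in coordinates *)

Section Pairing.
Context {R : realType}.

Lemma det_recl n (g : nat -> nat -> R) :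
  \det (\matrix_(i < n.+1, j < n.+1) g i j) =
  \sum_(j < n.+1) g 0%N j * ((-1) ^+ j * \det (\matrix_(i < n, m < n) g i.+1 (bump j m))).
Proof.
rewrite (expand_det_row _ ord0); apply: eq_bigr => j _; rewrite mxE; congr (_ * (_ * \det _)).
by apply/matrixP => i m; rewrite !mxE.
Qed.

(** Determinants of functions on pairs of natural numbers: the row expansion unfolds by
    simplification, so that [levi_civita] can be evaluated without handling ordinals. *)
Fixpoint ndet n (g : nat -> nat -> R) : R :=
  if n is n'.+1 then
    \sum_(j < n) g 0%N j * ((-1) ^+ j * ndet n' (fun i m => g i.+1 (bump j m)))
  else 1.

Lemma det_ndet n (g : nat -> nat -> R) : \det (\matrix_(i < n, j < n) g i j) = ndet n g.
Proof.
elim: n g => [|n IH] g; first by rewrite det_mx00.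
by rewrite det_recl /=; apply: eq_bigr => j _; rewrite (IH (fun i m => g i.+1 (bump j m))).
Qed.

(** Laplace expansion along the first two rows. *)
Lemma ndet4 (g : nat -> nat -> R) :
  let m a b := g 2%N a * g 3%N b - g 2%N b * g 3%N a in
  let d a b := g 0%N a * g 1%N b - g 0%N b * g 1%N a in
  ndet 4 g =
  d 0%N 1%N * m 2%N 3%N - d 0%N 2%N * m 1%N 3%N + d 0%N 3%N * m 1%N 2%N +
  d 1%N 2%N * m 0%N 3%N - d 1%N 3%N * m 0%N 2%N + d 2%N 3%N * m 0%N 1%N.
Proof.
by rewrite /= !big_ord_recl !big_ord0 /= /bump /=; ring.
Qed.

Definition levi_civita_nat (a b c d : nat) : R := ndet 4 (fun r s => (nth 0%N [:: a; b; c; d] r ==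
  s)%:R).

Lemma levi_civitaE (A B C D : 'I_4) : levi_civita R A B C D = levi_civita_nat A B C D.
Proof.
rewrite /levi_civita_nat -det_ndet; congr (\det _); apply/matrixP => i j; rewrite !mxE; congr ((_
  : bool)%:R).
rewrite -val_eqE /= (tnth_nth ord0) /=.
by case: i => [[|[|[|[|//]]]] ?].
Qed.

Lemma sum4 (V : nmodType) (F : 'I_4 -> V) : \sum_(i < 4) F i = F (@Ordinal 4 0 isT) +
  F (@Ordinal 4 1 isT) + F (@Ordinal 4 2 isT) + F (@Ordinal 4 3 isT).
Proof.
rewrite !big_ord_recl big_ord0 addr0 !addrA.
by congr (F _ + F _ + F _ + F _); apply/val_inj.
Qed.

Lemma hodgeE (v : 'M[R]_4) (A B : 'I_4) :
  let d (a b : nat) : R := ((A : nat) == a)%:R * ((B : nat) == b)%:R -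
    ((A : nat) == b)%:R * ((B : nat) == a)%:R in
  let w (i j : 'I_4) := v i j - v j i in
  let i0 : 'I_4 := @Ordinal 4 0 isT in let i1 : 'I_4 := @Ordinal 4 1 isT in
  let i2 : 'I_4 := @Ordinal 4 2 isT in let i3 : 'I_4 := @Ordinal 4 3 isT in
  2 * hodge v A B = d 0%N 1%N * w i2 i3 - d 0%N 2%N * w i1 i3 + d 0%N 3%N * w i1 i2 +
    d 1%N 2%N * w i0 i3 - d 1%N 3%N * w i0 i2 + d 2%N 3%N * w i0 i1.
Proof.
move=> d w i0 i1 i2 i3.
rewrite mxE mulrA mulfV ?pnatr_eq0 // mul1r sum4 !(sum4 (fun D => _ * _)).
rewrite !levi_civitaE /levi_civita_nat !ndet4 /= /d /w /i0 /i1 /i2 /i3; ring.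
Qed.

Lemma hodge_bivector (p : R6 R) : hodge (bivector p) =
  bivector (p.2, - p.1.2, p.1.1.2, p.1.1.1.2, - p.1.1.1.1.2, p.1.1.1.1.1).
Proof.
case: p => [[[[[p0 p1] p2] p3] p4] p5].
apply/matrixP => A B; apply: (mulfI (_ : (2 : R) != 0)); first by rewrite pnatr_eq0.
rewrite hodgeE !mxE /=.
by case: A => [[|[|[|[|A]]]] HA] //; case: B => [[|[|[|[|B]]]] HB] //=; ring.
Qed.

(** [hodge] permutes the six components up to signs, which occur twice and cancel; the sum over
    ordered pairs of indices counts each component twice. *)
Lemma pairing_dot6 (P x : R6 R) : pairing (bivector P) (bivector x) = 2 * dot6 P x.
Proof.
rewrite /pairing !hodge_bivector; case: P => [[[[[p0 p1] p2] p3] p4] p5].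
case: x => [[[[[x0 x1] x2] x3] x4] x5].
by rewrite sum4 !(sum4 (fun D => _ * _)) !mxE /dot6 /=; ring.
Qed.

Lemma fourier_test_fhat (phi : R6 R -> R[i]) x : fourier_test phi x = fhat phi x.
Proof.
rewrite /fourier_test (leb6E _).2; apply: eq_cintegral => p.
by rewrite pairing_dot6.
Qed.

End Pairing.

(** * The Fourier transform of the field *)

Section FibredIntegrability.
Context {R : realType} {d1 d2 : measure_display} {T1 : measurableType d1} {T2 : measurableType d2}.
Variables (m1 : {sigma_finite_measure set T1 -> \bar R})
  (m2 : {sigma_finite_measure set T2 -> \bar R}).

(** Tonelli with the first variable innermost, the order in which the estimates are available. *)
Lemma cintegrable_fibred (h : T1 * T2 -> R[i]) (w : T2 -> R) : cmeas h ->
  (forall y, rintegrable m1 (fun x => cabs (h (x, y)))) ->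
  (forall y, \int[m1]_x cabs (h (x, y)) <= w y) -> rintegrable m2 w ->
  cintegrable (m1 \xs m2) h.
Proof.
move=> mh hi hw wi; apply: (cintegrable_dom mh (f := fun z => cabs (h z))) => //.
have mc := measurable_cabs mh.
have mE : measurable_fun setT (fun z => (cabs (h z))%:E) by exact: emeas.
have c0 z : (0 <= (cabs (h z))%:E)%E by rewrite lee_fin; exact: cabs_ge0.
apply/integrableP; split => //.
rewrite (eq_integral (fun z => (cabs (h z))%:E)); last by move=> z _; rewrite gee0_abs.
have E0 := etrans (tonelli1 m1 m2 mE c0) (tonelli12 m1 m2 mE c0).
rewrite E0.
have E y : (\int[m1]_x (cabs (h (x, y)))%:E = (\int[m1]_x cabs (h (x, y)))%:E)%E.
  by rewrite /Rintegral fineK // integrable_fin_num.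
rewrite (eq_integral (fun y => (\int[m1]_x cabs (h (x, y)))%:E)); last by move=> y _; exact: E.
have w0 y : 0 <= w y.
  by apply: le_trans (hw y); apply: Rintegral_ge0 => x _; exact: cabs_ge0.
apply: (@le_lt_trans _ _ (\int[m2]_y (w y)%:E)%E).
  apply: ge0_le_integral => //.
  - by move=> y _; rewrite lee_fin; apply: Rintegral_ge0 => x _; exact: cabs_ge0.
  - rewrite (_ : (fun y => _) = (fun y => \int[m1]_x (cabs (h (x, y)))%:E)%E); last first.
      by apply/funext => y; rewrite E.
    exact: (measurable_fun_fubini_tonelli_G (m1 := m1) _ mE c0).
  - by apply: emeas; exact: rintegrable_meas wi.
  - by move=> y _; rewrite lee_fin.
exact: integrable_lty.
Qed.

End FibredIntegrability.

(** * Linear substitutions and the decay of the p-integral *)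

Section Shears.
Context {R : realType}.

Lemma cov_linear3 (s0 s c d : R) : s0 != 0 -> s != 0 ->
  cov (l3 R) (l3 R) (fun u => (s0 * u.1.1, s * u.1.2 + c * u.1.1, s * u.2 + d * u.1.1))
    (fun=> `|s0| * `|s| ^+ 2).
Proof.
move=> h0 hs.
have C1 : cov (l1 R \xs l1 R) (l1 R \xs l1 R) (fun z : L1 R * L1 R => (z.1, s * z.2 + c * z.1 : R))
    (fun=> `|s|).
  apply: (@cov_fibR _ _ _ _ _ _ _ (l1 R) (l1 R) (l1 R)
    (fun z : L1 R * L1 R => s * z.2 + c * z.1 : L1 R) (fun=> `|s|) set0) => //.
    by apply: measurable_funD; apply: measurable_funM.
  by move=> x _; exact: (cov_affine (c * x) hs).
have C2 : cov (l1 R \xs l1 R \xs l1 R) (l1 R \xs l1 R \xs l1 R)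
    (fun z : L3 R => (z.1, s * z.2 + d * z.1.1 : R)) (fun=> `|s|).
  apply: (@cov_fibR _ _ _ _ _ _ _ (l1 R \xs l1 R) (l1 R) (l1 R)
    (fun z : L3 R => s * z.2 + d * z.1.1 : L1 R) (fun=> `|s|) set0) => //.
    apply: measurable_funD; apply: measurable_funM => //.
    exact: (measurableT_comp measurable_fst measurable_fst).
  by move=> x _; exact: (cov_affine (d * x.1) hs).
have C3 := cov_prod (cov_prod (cov_affine 0 h0) (cov_id (l1 R))) (cov_id (l1 R)).
have C := cov_comp C2 (cov_comp (cov_prod C1 (cov_id (l1 R))) C3).
apply: (cov_eq C) => [[[u1 u2] u3]|u] /=; first by rewrite addr0.
by rewrite !mulr1; ring.
Qed.

(** In use, [tau] is a permutation bringing a distinguished p_i to the front; the map that follows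
    is triangular with diagonal 1, s, s. *)
Lemma integral_shear (s c d : R) (tau : L3 R -> L3 R) : s != 0 ->
  cov (l3 R) (l3 R) tau (fun=> 1) ->
  let h (p : L3 R) : R := let u := tau p in cw u.1.1 * cw (s * u.1.2 + c * u.1.1) * cw (s * u.2 +
    d * u.1.1) in
  rintegrable (l3 R) h /\ \int[l3 R]_p h p = (`|s| ^+ 2)^-1 * \int[l3 R]_p prod3 cw p.
Proof.
move=> s0 ct h; have i3 := rintegrable_prod3 (@cw_integral R).1.
have C := cov_comp ct (cov_linear3 c d (@oner_neq0 R) s0).
have m3 := rintegrable_meas i3.
have n0 : `|s| ^+ 2 != 0 by rewrite expf_neq0 // normr_eq0.
have E p : h p = (`|s| ^+ 2)^-1 * (prod3 cw ((fun u : L3 R => (1 * u.1.1, s * u.1.2 + c * u.1.1, s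
  * u.2 + d * u.1.1) : L3 R) (tau p))
    * (`|1 : R| * `|s| ^+ 2 * 1)).
  by rewrite /h /prod3 /= normr1 mul1r mulr1 mul1r mulrCA mulVf // mulr1.
have hi := (rintegrable_cov C m3).2 i3.
split.
  by apply: eq_integrable (rintegrableZ (`|s| ^+ 2)^-1 hi) => // p _; rewrite /= E.
rewrite (rintegral_cov C m3) -RintegralZl //.
by apply: eq_Rintegral => p _; rewrite E.
Qed.

Lemma cwN (s : R) : cw (- s) = cw s. Proof. by rewrite /cw sqrrN. Qed.

(* Keep only the three factors that involve the p_i multiplying N = |y_i|: they are
   independent linear coordinates of p with Jacobian N^2. *)
Lemma wedge3_integral (y : R * R * R) (N : R) : 1 <= N ->
  (N = 1 \/ [\/ N = `|y.1.1|, N = `|y.1.2| | N = `|y.2|]) ->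
  let h (p : L3 R) := prod3 cw p * prod3 cw (wedge3 y p) in
  rintegrable (l3 R) h /\ \int[l3 R]_p h p <= (N ^+ 2)^-1 * \int[l3 R]_p prod3 cw p.
Proof.
move=> N1 HN h; have i3 := rintegrable_prod3 (@cw_integral R).1.
have c0 (s : R) : 0 <= cw s by rewrite ltW // cw_gt0.
have c1 := @cw_le1 R.
have mh : measurable_fun setT h.
  apply: measurable_funM; first exact: rintegrable_meas i3.
  apply: (measurableT_comp (rintegrable_meas i3) (g := fun p : L3 R => wedge3 y p : L3 R)).
  by apply: measurable_wedge3 => //; exact: measurable_cst.
have h0 p : 0 <= h p by rewrite mulr_ge0 // prod3_cw_ge0.
have D (g : L3 R -> R) : rintegrable (l3 R) g -> (forall p, h p <= g p) ->
    \int[l3 R]_p g p = (N ^+ 2)^-1 * \int[l3 R]_p prod3 cw p ->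
    rintegrable (l3 R) h /\ \int[l3 R]_p h p <= (N ^+ 2)^-1 * \int[l3 R]_p prod3 cw p.
  move=> gi hg <-.
  have hi : rintegrable (l3 R) h.
    by apply: (rintegrable_dom mh gi) => p; rewrite ger0_norm.
  by split => //; apply: le_Rintegral.
have B (a b c d e g : R) : cw a * cw b * cw c * (cw d * cw e * cw g) <= cw a * cw d * cw e.
  rewrite [leLHS](_ : _ = (cw a * cw d * cw e) * (cw b * cw c * cw g)); last by ring.
  by rewrite ler_piMr ?mulr_ge0 // !mulr_ile1 ?mulr_ge0.
case: HN => [E|HN].
  apply: (D (prod3 cw)) => //; last by rewrite E expr1n invr1 mul1r.
  by move=> p; rewrite ler_piMr ?prod3_cw_ge0 ?prod3_cw_le1.
have nz (t : R) : N = `|t| -> t != 0 by move=> E; rewrite -normr_gt0 -E; exact: lt_le_trans N1.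
case: HN => E; have t0 := nz _ E.
- have [gi gE] := integral_shear (- y.1.2) (- y.2) t0 (cov_id (l3 R)).
  apply: (D _ gi) => [p|]; last by rewrite E.
  rewrite /h /prod3 /wedge3 /= !mulNr; exact: B.
- have [gi gE] := integral_shear (- y.2) (- y.1.1) t0 (cov_to_last 0).
  apply: (D _ gi) => [p|]; last by rewrite E.
  rewrite /h /prod3 /wedge3 /= !mulNr -(cwN (y.1.2 * p.1.1 - _)) opprB.
  apply: le_trans (B p.1.2 p.1.1 p.2 _ _ (y.1.1 * p.2 - y.2 * p.1.1)).
  rewrite le_eqVlt; apply/orP; left; apply/eqP; ring.
- have [gi gE] := integral_shear (- y.1.1) (- y.1.2) t0 (cov_from_last 0).
  apply: (D _ gi) => [p|]; last by rewrite E.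
  rewrite /h /prod3 /wedge3 /= !mulNr -(cwN (y.2 * p.1.1 - _)) -(cwN (y.2 * p.1.2 - _)) !opprB.
  apply: le_trans (B p.2 p.1.1 p.1.2 _ _ (y.1.1 * p.1.2 - y.1.2 * p.1.1)).
  rewrite le_eqVlt; apply/orP; left; apply/eqP; ring.
Qed.

End Shears.

(** * Coordinates on the momentum cone *)

Section ConeCoordinates.
Context {R : realType}.

Lemma cov_split6 : cov (l6 R) (l3 R \xs l3 R)
  (fun x : L6 R => ((x.1.1.1, (x.1.1.2, x.1.2, x.2)) : L3 R * L3 R)) (fun=> 1).
Proof.
have A1 := cov_assocV (l3 R \xs l1 R) (l1 R) (l1 R).
have A2 := cov_assocV (l3 R) (l1 R) (l1 R \xs l1 R).
have A3 := cov_prod (cov_id (l3 R)) (cov_assoc (l1 R) (l1 R) (l1 R)).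
apply: (cov_eq (cov_comp A1 (cov_comp A2 A3))) => [[[[p a] b] c]|x] //=.
by rewrite !mulr1.
Qed.

Lemma null_first : (l3 R) [set p : L3 R | p.1.1 = 0] = 0%E /\
  measurable ([set p | p.1.1 = 0] : set (L3 R)).
Proof.
have E : [set p : L3 R | p.1.1 = 0] = (([set 0] : set (L1 R)) `*` (setT : set (L1 R))) `*` (setT :
  set (L1 R)).
  by apply/seteqP; split => [p h|p [[h _] _]].
have m2 : measurable (([set 0] : set (L1 R)) `*` (setT : set (L1 R))) by exact: measurableX.
split; last by rewrite E; exact: measurableX.
rewrite E; apply: etrans (product_measure1E (l1 R \xs l1 R) (l1 R) m2 measurableT) _.
have E2 : (l1 R \xs l1 R) (([set 0] : set (L1 R)) `*` (setT : set (L1 R))) = 0%E.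
  apply: etrans (product_measure1E (l1 R) (l1 R) (measurable_set1 0) measurableT) _.
  exact: etrans (congr1 (fun u => (u * _)%E) lebesgue0) (mul0e _).
exact: etrans (congr1 (fun u => (u * _)%E) E2) (mul0e _).
Qed.

(* For fixed p with p_1 != 0, the coordinates z = (P_12, P_13, t) of the spinor
   (1, y) = line_spinor l t, where momentum l has components P_0i = p_i, P_12, P_13. *)
Definition cone_y (p z : R * R * R) : R * R * R :=
  (p.1.1 * z.2, - p.1.1^-1 * z.1.1 + p.1.2 * z.2, - p.1.1^-1 * z.1.2 + p.2 * z.2).

(** At fixed p with p_1 nonzero, [cone_y] is linear in (t, P_12, P_13) and triangular with diagonal
    p_1, -1 / p_1, -1 / p_1, whose determinant has absolute value 1 / |p_1|. The set p_1 = 0 is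
    null. *)
Lemma cov_cone : cov (l6 R) (l3 R \xs l3 R)
  (fun x : L6 R => (x.1.1.1, cone_y x.1.1.1 (x.1.1.2, x.1.2, x.2)) : L3 R * L3 R)
  (fun x => `|x.1.1.1.1.1|^-1).
Proof.
have [N0 mN] := null_first.
have minv (g : L3 R * L3 R -> R) : measurable_fun setT g -> measurable_fun setT (fun z => (g z)^-1).
  by move=> mg; exact: (measurableT_comp measurable_invr mg).
have [p1 p2 p3] := measurable_co3 (measurable_fst : measurable_fun setT (fun z : L3 R * L3 R =>
  z.1)).
have [z1 z2 z3] := measurable_co3 (measurable_snd : measurable_fun setT (fun z : L3 R * L3 R =>
  z.2)).
have my : measurable_fun setT (fun z : L3 R * L3 R => cone_y z.1 z.2 : L3 R).
  apply: measurable3; first exact: measurable_funM.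
    apply: measurable_funD; apply: measurable_funM => //.
    by apply: measurable_funN; exact: minv.
  apply: measurable_funD; apply: measurable_funM => //.
  by apply: measurable_funN; exact: minv.
have mw : measurable_fun setT (fun z : L3 R * L3 R => `|z.1.1.1|^-1 : R).
  apply: minv; exact: (measurableT_comp (@normr_measurable R setT) p1).
have C1 : cov (l3 R \xs l3 R) (l3 R \xs l3 R) (fun z : L3 R * L3 R => (z.1, cone_y z.1 z.2 : L3 R))
    (fun z => `|z.1.1.1|^-1).
  apply: (@cov_fibR _ _ _ _ _ _ _ (l3 R) (l3 R) (l3 R)
    (fun z : L3 R * L3 R => cone_y z.1 z.2 : L3 R) (fun z => `|z.1.1.1|^-1) [set p | p.1.1 = 0] mN
      N0 my mw).
    by move=> z; rewrite invr_ge0.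
  move=> p /= /eqP p0.
  have q0 : - p.1.1^-1 != 0 by rewrite oppr_eq0 invr_eq0.
  apply: (cov_eq (cov_comp (cov_from_last 0) (cov_linear3 p.1.2 p.2 p0 q0))) => [z|z] //.
  rewrite normrN normfV mulr1 exprVn expr2 invfM mulVKf //.
  by rewrite normr_eq0.
apply: (cov_eq (cov_comp cov_split6 C1)) => // x.
by rewrite mulr1.
Qed.

End ConeCoordinates.

Section ConeTransform.
Context {R : realType}.
Variables (k : nat) (f : 'rV[R]_4 * 'rV[R]_4 -> R[i]).
Hypotheses (f_smooth : smooth_on_cone f)
  (f_homog : homogeneous_on_cone (- (k + 4)%N%:Z) f).
Variable A : k.-tuple 'I_4.

Definition chart_spinor (y : R * R * R) : 'rV[R]_4 := \row_(B < 4) [:: 1; y.1.1; y.1.2; y.2]`_B.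

Definition chart_dir (p : R * R * R) : 'rV[R]_4 := \row_(B < 4) [:: 0; p.1.1; p.1.2; p.2]`_B.

Definition spinor_prod (l : 'rV[R]_4) : R := \prod_(i < k) l ord0 (tnth A i).

Lemma chart_spinor0 y : chart_spinor y ord0 ord0 = 1. Proof. by rewrite mxE. Qed.

Lemma chart_spinor0_neq0 y : chart_spinor y ord0 ord0 != 0. Proof. by rewrite chart_spinor0
  oner_neq0. Qed.

Lemma chart_spinor_norm y : 1 <= `|chart_spinor y|.
Proof. by have := coord_le_norm (chart_spinor y) ord0 ord0; rewrite chart_spinor0 normr1. Qed.

Lemma chart_spinor_neq0 y : chart_spinor y != 0.
Proof. by rewrite -normr_gt0; exact: lt_le_trans (chart_spinor_norm y). Qed.

Lemma chart_spinor_coord y : [/\ `|y.1.1| <= `|chart_spinor y|, `|y.1.2| <= `|chart_spinor y| &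
  `|y.2| <= `|chart_spinor y|].
Proof.
have H (i : 'I_4) := coord_le_norm (chart_spinor y) ord0 i.
by split; [have := H (lift ord0 o0)|have := H (lift ord0 o1)|have := H (lift ord0 o2)];
  rewrite mxE.
Qed.

Lemma chart_spinor_norm4 y : (`|chart_spinor y| ^+ 4)^-1 <= 16 * prod3 w43 y.
Proof. by have [h1 h2 h3] := chart_spinor_coord y; apply: w43_bound => //; exact:
  chart_spinor_norm. Qed.

(** The component omega^0 follows from the other three: as x is skew, omega = x pi is orthogonal to
    pi. *)
Lemma bivector_spinor (x : R6 R) y :
  \row_(B < 4) \sum_(C < 4) bivector x B C * chart_spinor y ord0 C = hyp_pt (chart_spinor y) ord0
    (omega3 y x).
Proof.
case: x => [[[[[x0 x1] x2] x3] x4] x5]; case: y => [[y1 y2] y3].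
apply/rowP => B; rewrite [LHS]mxE sum4.
case: (unliftP ord0 B) => [m ->|->]; rewrite ?hyp_pt_lift ?hyp_pt_self.
  by case: (ord3P m) => ->; rewrite !mxE /=; ring.
by rewrite !mxE /=; field.
Qed.

Definition field_kernel (w y : R * R * R) : R[i] := (spinor_prod (chart_spinor y))%:C%C * f
  (hyp_pt (chart_spinor y) ord0 w, chart_spinor y).

Lemma twistor_fieldE x :
  twistor_field f x A = 6%:C%C * cintegral (l3 R) (fun y => field_kernel (omega3 y x) y).
Proof.
rewrite /twistor_field /int_RP3 (leb3E _).2; congr (_ * _); first by rewrite rmorph_nat.
apply: eq_cintegral => -[[y1 y2] y3]; rewrite /field_kernel -bivector_spinor.
by congr (_ * f (_, _)).
Qed.

Lemma spinor_prod_bound y : `|spinor_prod (chart_spinor y)| <= `|chart_spinor y| ^+ k.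
Proof.
rewrite normr_prod -[X in _ ^+ X](card_ord k) -prodr_const.
by apply: ler_prod => i _; rewrite normr_ge0 coord_le_norm.
Qed.

(** The norm of (omega, pi) is at least that of pi; the decay of order k + 4, less the k factors of
    pi, leaves |pi|^-4 uniformly in omega. *)
Lemma field_kernel_bound : exists2 C : R, 0 <= C & forall w y, cabs (field_kernel w y) <= C *
  prod3 w43 y.
Proof.
have [C C0 HC] := cone_bound f_smooth f_homog.
exists (C * 16); first by rewrite mulr_ge0.
move=> w y; rewrite /field_kernel cabs_realM -mulrA.
apply: le_trans (ler_wpM2l C0 (chart_spinor_norm4 y)).
have n1 := chart_spinor_norm y; have n0 : 0 < `|chart_spinor y| by exact: lt_le_trans n1.
apply: (@le_trans _ _ (`|chart_spinor y| ^+ k * (C * (`|chart_spinor y| ^+ (k + 4))^-1))); last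
  first.
  rewrite exprD invfM mulrCA mulVKf ?lexx //.
  by rewrite expf_neq0 // gt_eqF.
apply: ler_pM => //; first exact: cabs_ge0; first exact: spinor_prod_bound.
apply: (le_trans (HC _ (hyp_pt_cone w (chart_spinor0_neq0 y)))); apply: ler_wpM2l => //.
rewrite lef_pV2 ?posrE ?exprn_gt0 //; last by rewrite norm_pair lt_max n0 orbT.
by apply: lerXn2r; rewrite ?nnegrE // norm_pair le_max lexx orbT.
Qed.

Lemma chart_spinor_cvg (y : nat -> R * R * R) y0 B : cvg3 y y0 ->
  (fun n => chart_spinor (y n) ord0 B) @ \oo --> chart_spinor y0 ord0 B.
Proof.
move=> [y1 y2 y3]; rewrite mxE; under eq_fun do rewrite mxE.
by case: B => [[|[|[|[|//]]]] ?] //=; exact: cvg_cst.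
Qed.

Lemma chart_dir_cvg (y : nat -> R * R * R) y0 B : cvg3 y y0 ->
  (fun n => chart_dir (y n) ord0 B) @ \oo --> chart_dir y0 ord0 B.
Proof.
move=> [y1 y2 y3]; rewrite mxE; under eq_fun do rewrite mxE.
by case: B => [[|[|[|[|//]]]] ?] //=; exact: cvg_cst.
Qed.

Lemma spinor_prod_cvg (y : nat -> R * R * R) y0 : cvg3 y y0 ->
  (fun n => complex.Re (spinor_prod (chart_spinor (y n)))%:C%C) @ \oo --> complex.Re (spinor_prod
    (chart_spinor y0))%:C%C /\
  (fun n => complex.Im (spinor_prod (chart_spinor (y n)))%:C%C) @ \oo --> complex.Im (spinor_prod
    (chart_spinor y0))%:C%C.
Proof.
move=> cy; split => /=; last exact: cvg_cst.
by apply: cvgn_prod => i; exact: chart_spinor_cvg.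
Qed.

Lemma cmeas_field_kernel : cmeas (fun z : L3 R * L3 R => field_kernel z.1 z.2).
Proof.
have H u v y w : cvg3 u y -> cvg3 v w ->
    (fun n => complex.Re (field_kernel (u n) (v n))) @ \oo --> complex.Re (field_kernel y w) /\
    (fun n => complex.Im (field_kernel (u n) (v n))) @ \oo --> complex.Im (field_kernel y w).
  move=> cu cv; apply: cvg_cM; first exact: spinor_prod_cvg.
  apply: (cone_cvg f_smooth); [exact: hyp_pt_cone (chart_spinor0_neq0 _)|move=> n; exact:
    hyp_pt_cone (chart_spinor0_neq0 _)|].
  apply: cvgn_pair; apply: cvgn_mx => i B; rewrite (ord1 i); last exact: chart_spinor_cvg.
  by apply: hyp_pt_cvg => // [|D]; [exact: chart_spinor0_neq0|exact: chart_spinor_cvg].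
split.
  by apply: (measurable_seq33 (g := fun a b => complex.Re (field_kernel a b))) => u v y w cu cv;
    case: (H u v y w cu cv).
by apply: (measurable_seq33 (g := fun a b => complex.Im (field_kernel a b))) => u v y w cu cv;
  case: (H u v y w cu cv).
Qed.

Variable phi : R6 R -> R[i].
Hypothesis sphi : schwartz phi.

Definition field_product (z : L6 R * L3 R) : R[i] := field_kernel (omega3 z.2 z.1) z.2 * fhat phi
  z.1.

Lemma cintegrable_field_product : cintegrable (l6 R \xs l3 R) field_product.
Proof.
have [C C0 HC] := field_kernel_bound.
have ifh := cintegrable_fhat sphi.
apply: (cintegrable_dom _ (rintegrable_prod (cintegrable_cabs ifh)
   (rintegrableZ C (rintegrable_prod3 (@w43_integrable R))))).
  apply: cmeasM; last exact: (cmeas_comp (cintegrable_cmeas ifh) measurable_fst).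
  apply: (cmeas_comp cmeas_field_kernel (phi := fun z : L6 R * L3 R => (omega3 z.2 z.1, z.2))).
  apply: measurable_fun_pair; last exact: measurable_snd.
  by apply: measurable_omega3; [exact: measurable_snd|exact: measurable_fst].
move=> z; apply: (le_trans (cabsM _ _)); rewrite mulrC.
by apply: ler_wpM2l; [exact: cabs_ge0|exact: HC].
Qed.

Lemma cintegrable_field_kernel x : cintegrable (l3 R) (fun y : L3 R => field_kernel (omega3 y x) y).
Proof.
have [C C0 HC] := field_kernel_bound.
apply: (cintegrable_dom _ (rintegrableZ C (rintegrable_prod3 (@w43_integrable R)))) => //.
apply: (cmeas_comp cmeas_field_kernel (phi := fun y : L3 R => (omega3 y x : L3 R, y))).
by apply: measurable_fun_pair => //; apply: measurable_omega3.
Qed.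

Lemma field_fhat x : twistor_field f x A * fhat phi x =
  6%:C%C * cintegral (l3 R) (fun y => field_product (x, y)).
Proof.
rewrite twistor_fieldE -mulrA; congr (_ * _).
rewrite mulrC -cintegralMl; last exact: cintegrable_field_kernel.
by apply: eq_cintegral => y; rewrite /field_product /= mulrC.
Qed.

Lemma cintegrable_field : cintegrable (l6 R) (fun x => twistor_field f x A * fhat phi x).
Proof.
apply: (eq_cintegrable (h := fun x : L6 R => 6%:C%C * cintegral (l3 R) (fun y => field_product (x,
  y)))) => [x|].
  by rewrite field_fhat.
by apply: cintegrableMl; have [] := cfubini cintegrable_field_product.
Qed.

Lemma hyp_phase_hyp_pt p y w : hyp_phase (chart_dir p) (hyp_pt (chart_spinor y) ord0 w) = - 2 *
  dot3 p w.
Proof.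
rewrite /hyp_phase (sum_lift ord0) !hyp_pt_lift !mxE /= /dot3; ring.
Qed.

Lemma cintegrable_field_kernel_fibre y : cintegrable (l3 R) (fun w : L3 R => field_kernel w y).
Proof.
apply: cintegrableM_real.
(* Without the polynomial factor, this is the integrand of [hyp_fourier] for the direction 0, where
   the phase is 1. *)
apply: eq_cintegrable (cintegrable_hyp_integrand f_smooth f_homog 0 (chart_spinor0_neq0 y)) => w.
rewrite /hyp_integrand (_ : hyp_phase 0 _ = 0) ?expi0 ?mulr1 //.
by rewrite /hyp_phase big1 ?mulr0 ?oppr0 // => B _; rewrite mxE mul0r.
Qed.

Lemma field_kernel_transform p y : cintegral (l3 R) (fun w => field_kernel w y * expi (- 2 * dot3
  p w)) =
  (spinor_prod (chart_spinor y))%:C%C * hyp_fourier f (chart_spinor y) (chart_dir p).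
Proof.
rewrite (hyp_fourierE f_smooth f_homog _ (chart_spinor0_neq0 y)) chart_spinor0 normr1 invr1 mul1r.
rewrite -cintegralMl; last exact: (cintegrable_hyp_integrand f_smooth f_homog _
  (chart_spinor0_neq0 y)).
by apply: eq_cintegral => w; rewrite /field_kernel /hyp_integrand hyp_phase_hyp_pt mulrA.
Qed.

Definition cone_kernel (z : L3 R * L3 R) : R[i] :=
  (spinor_prod (chart_spinor z.2))%:C%C * hyp_fourier f (chart_spinor z.2) (chart_dir z.1) * phi
    (join6 z.1 (wedge3 z.2 z.1)).

Lemma cmeas_cone_kernel : cmeas cone_kernel.
Proof.
have H u v y w : cvg3 u y -> cvg3 v w ->
    (fun n => complex.Re ((spinor_prod (chart_spinor (v n)))%:C%C * hyp_fourier f (chart_spinor (v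
      n)) (chart_dir (u n)))) @ \oo -->
      complex.Re ((spinor_prod (chart_spinor w))%:C%C * hyp_fourier f (chart_spinor w) (chart_dir
        y)) /\
    (fun n => complex.Im ((spinor_prod (chart_spinor (v n)))%:C%C * hyp_fourier f (chart_spinor (v
      n)) (chart_dir (u n)))) @ \oo -->
      complex.Im ((spinor_prod (chart_spinor w))%:C%C * hyp_fourier f (chart_spinor w) (chart_dir
        y)).
  move=> cu cv; apply: cvg_cM; first exact: spinor_prod_cvg.
  by apply: (hyp_fourier_cvg f_smooth f_homog (chart_spinor_neq0 _)) => B; [exact:
    chart_spinor_cvg|exact: chart_dir_cvg].
apply: cmeasM.
  split.
    by apply: (measurable_seq33 (g := fun a b => complex.Re ((spinor_prod (chart_spinor b))%:C%C *
      hyp_fourier f (chart_spinor b) (chart_dir a)))) => u v y w cu cv; case: (H u v y w cu cv).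
  by apply: (measurable_seq33 (g := fun a b => complex.Im ((spinor_prod (chart_spinor b))%:C%C *
    hyp_fourier f (chart_spinor b) (chart_dir a)))) => u v y w cu cv; case: (H u v y w cu cv).
apply: (cmeas_comp (schwartz_cmeas sphi) (phi := fun z : L3 R * L3 R => join6 z.1 (wedge3 z.2
  z.1))).
apply: measurable_join6; first exact: measurable_fst.
by apply: measurable_wedge3; [exact: measurable_snd|exact: measurable_fst].
Qed.

(** Fubini puts x innermost. At fixed y the x-integral is [fixed_spinor_transform], whose inner
    transform is [hyp_fourier] without a Jacobian factor, because the chart spinor has 0-component
    1. *)
Lemma field_pairing : cintegral (l6 R) (fun x => twistor_field f x A * fhat phi x) =
  6%:C%C * cintegral (l3 R) (fun y => (pi ^+ 3)%:C%C * cintegral (l3 R) (fun p => cone_kernel (p,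
    y))).
Proof.
have [ih E1] := cfubini cintegrable_field_product; have [_ E2] := cfubini2
  cintegrable_field_product.
transitivity (6%:C%C * cintegral (l6 R) (fun x => cintegral (l3 R) (fun y => field_product (x,
  y)))).
  apply: etrans _ (cintegralMl _ ih); apply: eq_cintegral => x; exact: field_fhat.
rewrite E1 -E2; congr (_ * _); apply: eq_cintegral => y.
have [C C0 HC] := field_kernel_bound.
apply: etrans (fixed_spinor_transform y sphi (cintegrable_field_kernel_fibre y) (fun w => HC w y))
  _.
congr (_ * _); apply: eq_cintegral => p.
by rewrite field_kernel_transform /cone_kernel /= mulrC.
Qed.

Lemma chart_spinor_norm_cases y : `|chart_spinor y| = 1 \/ [\/ `|chart_spinor y| = `|y.1.1|,
  `|chart_spinor y| = `|y.1.2| | `|chart_spinor y| = `|y.2|].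
Proof.
have [j _ <-] := rV_max_coord (chart_spinor_neq0 y); case: (unliftP ord0 j) => [m ->|->].
  by right; case: (ord3P m) => ->; rewrite mxE; [apply: Or31|apply: Or32|apply: Or33].
by left; rewrite chart_spinor0 normr1.
Qed.

(** The order of integration matters: the bound on the transform offers only |pi|^-2 in y, and it is
    the p-integral, through [wedge3_integral], that supplies the other |pi|^-2. *)
Lemma cintegrable_cone_kernel : cintegrable (l3 R \xs l3 R) cone_kernel.
Proof.
have [C C0 HC] := hyp_fourier_bound f_smooth f_homog.
have [K K0 HK] := schwartz_cabs_decay sphi.
pose W := \int[l3 R]_p prod3 cw p.
have W0 : 0 <= W by apply: Rintegral_ge0 => p _; exact: prod3_cw_ge0.
have B p y : cabs (cone_kernel (p, y)) <=
    C * K * (`|chart_spinor y| ^+ 2)^-1 * (prod3 cw p * prod3 cw (wedge3 y p)).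
  have n0 : 0 < `|chart_spinor y| by exact: lt_le_trans (chart_spinor_norm y).
  rewrite /cone_kernel /=; apply: (le_trans (cabsM _ _)).
  rewrite [leRHS](_ : _ = (C * (`|chart_spinor y| ^+ 2)^-1) * (K * (prod3 cw p * prod3 cw (wedge3
    y p)))); last by ring.
  apply: ler_pM; rewrite ?cabs_ge0 //; last by rewrite -prod6_join; exact: HK.
  rewrite cabs_realM.
  apply: (le_trans (ler_pM (normr_ge0 _) (cabs_ge0 _) (spinor_prod_bound y) (HC _ (chart_dir p)
    (chart_spinor_neq0 y)))).
  by rewrite exprD invfM mulrCA mulVKf ?lexx // expf_neq0 // gt_eqF.
have ms := cmeas_cone_kernel.
have J y := wedge3_integral (chart_spinor_norm y) (chart_spinor_norm_cases y).
have ib y := rintegrableZ (C * K * (`|chart_spinor y| ^+ 2)^-1) (J y).1.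
have ii y : rintegrable (l3 R) (fun p => cabs (cone_kernel (p, y))).
  apply: (rintegrable_dom _ (ib y)) => [|p].
    apply: measurable_cabs; exact: (cmeas_comp ms (pair2_measurable y)).
  by rewrite ger0_norm ?cabs_ge0 //; exact: B.
apply: (@cintegrable_fibred _ _ _ _ _ (l3 R) (l3 R) cone_kernel
  (fun y => C * K * W * 16 * prod3 w43 y) ms ii); last first.
  exact: rintegrableZ (rintegrable_prod3 (@w43_integrable R)).
move=> y; apply: (@le_trans _ _ (C * K * (`|chart_spinor y| ^+ 2)^-1 * ((`|chart_spinor y| ^+
  2)^-1 * W))).
  apply: (le_trans (le_Rintegral measurableT (ii y) (ib y) (fun p _ => B p y))).
  rewrite RintegralZl //; last exact: (J y).1.
  by apply: ler_wpM2l; [rewrite !mulr_ge0 // invr_ge0 exprn_ge0|exact: (J y).2].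
rewrite [leLHS](_ : _ = C * K * W * (`|chart_spinor y| ^+ 4)^-1).
  rewrite -!mulrA; do 3!apply: ler_wpM2l => //; exact: chart_spinor_norm4.
have -> : (`|chart_spinor y| ^+ 4)^-1 = (`|chart_spinor y| ^+ 2)^-1 * (`|chart_spinor y| ^+ 2)^-1
  by rewrite -invfM -exprD.
ring.
Qed.

(** The representative of the SL(2) orbit with l^0 = (1, 0, ., .) and l^1 = (0, P_01, ., .). Its
    line spinors have 0-component 1 for every t, so they lie in the chart used for D^3pi, and l^1 is
    the direction (0, p). *)
Definition cone_spinors (q : R5 R) : 'M[R]_(2, 4) :=
  let: (p01, p02, p03, p12, p13) := q in
  \matrix_(i, B) nth 0 (nth [::] [:: [:: 1; 0; - p12 / p01; - p13 / p01]; [:: 0; p01; p02; p03]]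
    i) B.

Lemma momentum_cone_spinors q : q.1.1.1.1 != 0 -> momentum (cone_spinors q) = bivector (cone_pt q).
Proof.
case: q => [[[[p1 p2] p3] p12] p13] /= p0.
apply/matrixP => B C; rewrite !mxE /=.
by case: B => [[|[|[|[|B]]]] HB] //; case: C => [[|[|[|[|C]]]] HC] //=; field.
Qed.

Lemma cone_momentum_neq0 q : q.1.1.1.1 != 0 -> momentum (cone_spinors q) != 0.
Proof.
move=> q0; rewrite momentum_cone_spinors //; apply/eqP => /matrixP/(_ ord0 (lift ord0 ord0)).
case: q q0 => [[[[p1 p2] p3] p12] p13] /= p0; rewrite !mxE /= => E.
by rewrite E eqxx in p0.
Qed.

Lemma chart_spinor_cone (q : R5 R) (t : R) : q.1.1.1.1 != 0 ->
  chart_spinor (cone_y q.1.1 (q.1.2, q.2, t)) = line_spinor (cone_spinors q) t.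
Proof.
case: q => [[[[p1 p2] p3] p12] p13] /= p0.
by apply/rowP => B; rewrite !mxE /=; case: B => [[|[|[|[|B]]]] HB] //=; field.
Qed.

Lemma chart_dir_cone (q : R5 R) : chart_dir q.1.1 = row 1 (cone_spinors q).
Proof.
case: q => [[[[p1 p2] p3] p12] p13] /=.
by apply/rowP => B; rewrite !mxE /=.
Qed.

Lemma join_cone (q : R5 R) (t : R) : q.1.1.1.1 != 0 ->
  join6 q.1.1 (wedge3 (cone_y q.1.1 (q.1.2, q.2, t)) q.1.1) = cone_pt q.
Proof.
case: q => [[[[p1 p2] p3] p12] p13] /= p0.
by rewrite /join6 /wedge3 /cone_y /=; congr (_, _, _, _, _, _); field.
Qed.

Definition cone_slice (x : L6 R) : R[i] :=
  (`|x.1.1.1.1.1|^-1)%:C%C * cone_kernel (x.1.1.1, cone_y x.1.1.1 (x.1.1.2, x.1.2, x.2)).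

(** The argument of [phi] does not move with t, so the t-integral is the contracted line integral.
    The 4 accounts for 1 / |P_01| against the Leray density 1 / |4 P_01|. *)
Lemma cintegral_cone_slice (q : R5 R) : cintegral (l1 R) (fun t => cone_slice (q, t)) =
  4%:C%C * cone_integrand (fun P => ftilde_contr f (cone_spinors q) A * phi P) q.
Proof.
(* Where P_01 = 0 both sides are 0, by the convention 0^-1 = 0. *)
have [q0|q0] := eqVneq q.1.1.1.1 0.
  rewrite (@eq_cintegral _ _ _ (l1 R) _ (fun=> 0)); last first.
    by move=> t; rewrite /cone_slice /= q0 normr0 invr0 mul0r.
  rewrite cintegral0; case: q q0 => [[[[p1 p2] p3] p12] p13] /= ->.
  by rewrite mulr0 normr0 invr0 mul0r mulr0.
have m0 := cone_momentum_neq0 q0.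
rewrite (@eq_cintegral _ _ _ (l1 R) _ (fun t => ((`|q.1.1.1.1|^-1)%:C%C * phi (cone_pt q)) *
    spinor_form f A (line_spinor (cone_spinors q) t) (row 1 (cone_spinors q)))); last first.
  move=> t; rewrite /cone_slice /cone_kernel /= chart_spinor_cone // chart_dir_cone join_cone //
    /spinor_form -!mulrA.
  by congr (_ * _); rewrite [RHS]mulrC -mulrA.
rewrite cintegralMl; last first.
  have := cintegrable_line_integrand f_smooth f_homog (fun i => cone_spinors q 0 (tnth A i))
     (fun i => cone_spinors q 1 (tnth A i)) m0.
  apply: eq_cintegrable => t; congr (_%:C%C * _).
  by apply: eq_bigr => i _; rewrite mxE.
rewrite -ftilde_contrE; case: q q0 m0 => [[[[p1 p2] p3] p12] p13] /= p0 m0.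
rewrite [RHS]mulrA -rmorphM /= normrM invfM (ger0_norm (ler0n R 4)) mulVKf ?pnatr_eq0 //.
by rewrite -[LHS]mulrA; congr (_ * _); exact: mulrC.
Qed.

Lemma cone_fourier :
  cintegrable (l5 R) (fun q => cone_integrand (fun P => ftilde_contr f (cone_spinors q) A * phi P)
    q) /\
  cintegral (l6 R) (fun x => twistor_field f x A * fhat phi x) =
  (cone_norm R)%:C%C *
    cintegral (l5 R) (fun q => cone_integrand (fun P => ftilde_contr f (cone_spinors q) A * phi P)
      q).
Proof.
have iS := cintegrable_cone_kernel.
have mS := cintegrable_cmeas iS.
have ic : cintegrable (l6 R) cone_slice := (cintegrable_cov cov_cone mS).2 iS.
have [ic1 cE] := cfubini (m1 := l5 R) (m2 := l1 R) ic.
have E4 : (fun q : L5 R => cintegral (l1 R) (fun t => cone_slice (q, t))) =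
    (fun q => 4%:C%C * cone_integrand (fun P => ftilde_contr f (cone_spinors q) A * phi P) q).
  by apply/funext => q; exact: cintegral_cone_slice.
rewrite E4 in ic1 cE.
have i5 : cintegrable (l5 R) (fun q => cone_integrand (fun P => ftilde_contr f (cone_spinors q) A
  * phi P) q).
  apply: eq_cintegrable (cintegrableM_real 4^-1 ic1) => q.
  by rewrite mulrA -rmorphM mulVf ?mul1r // pnatr_eq0.
split => //; rewrite field_pairing.
have [js jE] := cfubini2 iS.
rewrite cintegralMl // jE (cintegral_cov cov_cone mS) -[X in _ * (_ * X)]/(cintegral (l6 R)
  cone_slice).
rewrite -[cintegral (l6 R) cone_slice]cE cintegralMl // !mulrA -!rmorphM; congr (_%:C%C * _).
(* The factors are 6 from D^3pi, [pi ^+ 3] from the inversion and 4 from the Leray density. *)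
rewrite /cone_norm; ring.
Qed.

End ConeTransform.

Section Existence.
Context {R : realType}.
Variables (k : nat) (f : 'rV[R]_4 * 'rV[R]_4 -> R[i]).
Hypotheses (f_smooth : smooth_on_cone f)
  (f_homog : homogeneous_on_cone (- (k + 4)%N%:Z) f).

(** Some pair of spinors with momentum [P] is chosen; [ftilde_contr_momentum] makes the choice
    immaterial for nonzero momenta. The default 0 of [xget] occurs only when [P] is not a
    momentum. *)
Definition cone_density (P : 'M[R]_4) (A : k.-tuple 'I_4) : R[i] :=
  ftilde_contr f (xget 0 [set l | momentum l = P]) A.

Lemma cone_densityE l A : momentum l != 0 -> cone_density (momentum l) A = ftilde_contr f l A.
Proof.
move=> l0; apply: ftilde_contr_momentum => //.
exact: (@xgetPex _ 0 [set l' : 'M[R]_(2, 4) | momentum l' = momentum l] (ex_intro _ l erefl)).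
Qed.

Lemma eq_cone_integrand (h h' : R6 R -> R[i]) (q : R5 R) :
  (q.1.1.1.1 != 0 -> h (cone_pt q) = h' (cone_pt q)) -> cone_integrand h q = cone_integrand h' q.
Proof.
case: q => [[[[p1 p2] p3] p12] p13] /= H.
have [->|/H -> //] := eqVneq p1 0; by rewrite mulr0 normr0 invr0 !mul0r.
Qed.

Lemma cone_density_fourier A :
  fourier_on_cone ((@twistor_field R k f) ^~ A) (fun P => cone_density (bivector P) A) (cone_norm
    R).
Proof.
move=> phi sphi; have [ic E] := cone_fourier f_smooth f_homog A sphi.
have EG (q : R5 R) : q.1.1.1.1 != 0 ->
    cone_density (bivector (cone_pt q)) A = ftilde_contr f (cone_spinors q) A.
  by move=> q0; rewrite -(momentum_cone_spinors q0); exact: cone_densityE (cone_momentum_neq0 q0).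
have EI (q : L5 R) : cone_integrand (fun P => ftilde_contr f (cone_spinors q) A * phi P) q =
    cone_integrand (fun P => cone_density (bivector P) A * phi P) q.
  apply: eq_cone_integrand => q0.
  exact: (congr1 (fun z => z * phi (cone_pt q)) (esym (EG q q0))).
have Ef (x : L6 R) : twistor_field f x A * fhat phi x = twistor_field f x A * fourier_test phi x.
  exact: (congr1 (fun z => twistor_field f x A * z) (esym (fourier_test_fhat phi x))).
split.
- apply: (proj2 (leb6E _).1).
  exact: (eq_cintegrable Ef (cintegrable_field f_smooth f_homog A sphi)).
- apply: (proj2 (leb5E _).1); exact: (eq_cintegrable EI ic).
apply: etrans (leb6E _).2 _.
apply: etrans (eq_cintegral _ (fun x => esym (Ef x))) _.
apply: etrans E _.
apply: congr1; apply: etrans _ (esym (leb5E _).2); exact: (eq_cintegral _ EI).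
Qed.

Lemma ftilde_is_cone_fourier : is_cone_fourier (@twistor_field R k f) (ftilde f).
Proof.
split.
- by move=> l _ a s; exact: ftilde_sym.
- by move=> l l0 a; exact: (ftilde_continuous f_smooth f_homog).
exists cone_density; split; last exact: cone_density_fourier.
by move=> l l0 A; rewrite cone_densityE //; exact: (ftilde_contract f_smooth f_homog).
Qed.

End Existence.

(** * Uniqueness of the density on the cone *)

Section Gaussians.
Context {R : realType}.

(** Reduces directional derivatives to one variable, where the chain rule for [expR] is at hand. *)
Lemma is_derive_line (F : R6 R -> R) (x v : R6 R) (d : R) :
  is_derive (0 : R) 1 (fun t : R => F (x + t *: v)) d <-> is_derive x v F d.
Proof.
have E : (fun h : R => h^-1 *: (((fun t : R => F (x + t *: v)) \o shift 0) (h *: 1) - F (x + 0 *: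
  v))) =
    (fun h : R => h^-1 *: ((F \o shift x) (h *: v) - F x)).
  by apply/funext => h /=; rewrite [_ *: 1]mulr1 addr0 scale0r addr0 [_ + x]addrC.
by split=> -[d1 d2]; split; rewrite /derivable /derive ?E // in d1 d2 *; move: d1 d2; rewrite E.
Qed.

Lemma is_derive_expR_comp (q : R6 R -> R) (x v : R6 R) (d : R) : is_derive x v q d ->
  is_derive x v (fun y => expR (q y)) (expR (q x) * d).
Proof.
move=> /is_derive_line h; apply/is_derive_line.
have e : is_derive (q (x + 0 *: v)) 1 expR (expR (q (x + 0 *: v))) by exact: is_derive_expR.
by have := is_derive1_comp (f := expR) (g := fun t : R => q (x + t *: v)) e h; rewrite scale0r
  addr0.
Qed.

(** An inductive class of polynomial functions, closed under directional derivatives and of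
    polynomial growth. Every iterated derivative of p exp(q) is then of the form p' exp(q), which
    yields the Schwartz bounds. *)
Inductive polyfn : (R6 R -> R) -> Prop :=
  | polyfn_cst c : polyfn (fun=> c)
  | polyfn_coord6 i : polyfn (coord6 i)
  | polyfnD p q : polyfn p -> polyfn q -> polyfn (fun x => p x + q x)
  | polyfnM p q : polyfn p -> polyfn q -> polyfn (fun x => p x * q x).

Lemma coord6D i (x y : R6 R) : coord6 i (x + y) = coord6 i x + coord6 i y.
Proof. by case: i => [|[|[|[|[|i]]]]]. Qed.

Lemma coord6Z i (c : R) (x : R6 R) : coord6 i (c *: x) = c * coord6 i x.
Proof. by case: i => [|[|[|[|[|i]]]]]. Qed.

Lemma polyfn_derive p (v : R6 R) : polyfn p ->
  exists2 p', polyfn p' & forall x, is_derive x v p (p' x).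
Proof.
elim=> [c|i|f g _ [f' pf' df] _ [g' pg' dg]|f g pf [f' pf' df] pg [g' pg' dg]].
- by exists (fun=> 0); [exact: polyfn_cst|move=> x; exact: is_derive_cst].
- exists (fun=> coord6 i v); first exact: polyfn_cst.
  move=> x; apply/is_derive_line.
  rewrite (_ : (fun t => _) = (fun t : R => coord6 i x + t * coord6 i v)); last first.
    by apply/funext => t; rewrite coord6D coord6Z.
  apply: (is_derive_eq (f' := 0 + (1 * coord6 i v + 0))); last by rewrite mul1r add0r addr0.
  apply: (@is_deriveD _ _ _ (fun=> coord6 i x) (fun t : R => t * coord6 i v)).
  apply: (is_derive_eq (is_deriveM (f := id) (g := fun=> coord6 i v) (is_derive_id _ _)
    (is_derive_cst _ _ _))).
  by rewrite scaler0 add0r addr0 [_ *: 1]mulr1 mul1r.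
- by exists (fun x => f' x + g' x); [exact: polyfnD|move=> x; exact: (is_deriveD (df x) (dg x))].
exists (fun x => f x * g' x + g x * f' x).
  by apply: polyfnD; exact: polyfnM.
by move=> x; exact: (is_deriveM (df x) (dg x)).
Qed.

Lemma polyfn_continuous p : polyfn p -> continuous p.
Proof.
elim=> [c|i|f g _ cf _ cg|f g _ cf _ cg] x.
- exact: cvg_cst.
- exact: continuous_coord6.
- by apply: cvgD; [exact: cf|exact: cg].
- by apply: cvgM; [exact: cf|exact: cg].
Qed.

Lemma polyfn_growth p : polyfn p ->
  exists C m, 0 <= C /\ forall x : R6 R, `|p x| <= C * (1 + `|x|) ^+ m.
Proof.
have g1 (x : R6 R) : 1 <= 1 + `|x| by rewrite lerDl.
have g0 (x : R6 R) : 0 <= 1 + `|x| by rewrite (le_trans _ (g1 x)).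
elim=> [c|i|f g _ [C [m [C0 HC]]] _ [D [n [D0 HD]]]|f g _ [C [m [C0 HC]]] _ [D [n [D0 HD]]]].
- by exists `|c|, 0%N; split => // x; rewrite expr0 mulr1.
- exists 1, 1%N; split => // x; rewrite mul1r expr1.
  by apply: (le_trans (coord6_le_norm i x)); rewrite lerDr.
- exists (C + D), (m + n)%N; split; first exact: addr_ge0.
  move=> x; apply: (le_trans (ler_normD _ _)); rewrite mulrDl; apply: lerD.
    apply: (le_trans (HC x)); apply: ler_wpM2l => //; apply: ler_weXn2l => //; exact: leq_addr.
  apply: (le_trans (HD x)); apply: ler_wpM2l => //; apply: ler_weXn2l => //; exact: leq_addl.
exists (C * D), (m + n)%N; split; first exact: mulr_ge0.
move=> x; rewrite normrM exprD mulrACA; exact: ler_pM.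
Qed.

Lemma schwartz_polyfn_expR p q : polyfn p -> polyfn q ->
  (forall m, exists C, forall x : R6 R, (1 + `|x|) ^+ m * expR (q x) <= C) ->
  schwartz_real (fun x => p x * expR (q x)).
Proof.
move=> pp pq Hq.
have D vs : exists2 p', polyfn p' &
    iter_derive vs (fun x => p x * expR (q x)) = (fun x => p' x * expR (q x)).
  elim: vs => [|v vs [p' pp' E]]; first by exists p.
  have [r pr dr] := polyfn_derive v pp'; have [s ps ds] := polyfn_derive v pq.
  exists (fun x => p' x * s x + r x); first by apply: polyfnD => //; exact: polyfnM.
  rewrite /= -/(iter_derive vs _) E; apply/funext => x.
  apply: etrans (@derive_val _ _ _ _ _ _ _ (is_deriveM (dr x) (is_derive_expR_comp (ds x)))) _.
  by rewrite /GRing.scale /=; ring.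
split.
  move=> vs x _; have [p' pp' ->] := D vs; split.
    apply: cvgM; first exact: polyfn_continuous.
    apply: (@continuous_comp _ _ _ q expR); first exact: polyfn_continuous.
    exact: continuous_expR.
  move=> v; have [r _ dr] := polyfn_derive v pp'; have [s _ ds] := polyfn_derive v pq.
  by have [] := is_deriveM (dr x) (is_derive_expR_comp (ds x)).
move=> vs m; have [p' pp' ->] := D vs.
have [C [n [C0 HC]]] := polyfn_growth pp'; have [K HK] := Hq (m + n)%N.
exists (C * K) => x; rewrite normrM (ger0_norm (expR_ge0 _)) mulrA.
apply: (@le_trans _ _ ((1 + `|x|) ^+ m * (C * (1 + `|x|) ^+ n) * expR (q x))).
  apply: ler_wpM2r; first exact: expR_ge0.
  by apply: ler_wpM2l => //; rewrite exprn_ge0 // addr_ge0.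
rewrite (mulrCA _ C) -mulrA -exprD; exact: ler_wpM2l.
Qed.

(** The squared Euclidean distance: a polynomial, unlike the square of the maximum norm, which it
    dominates. *)
Definition dist2 (a x : R6 R) : R := \sum_(i < 6) (coord6 i x - coord6 i a) ^+ 2.

Lemma norm_le_dist2 (a x : R6 R) : `|x - a| ^+ 2 <= dist2 a x.
Proof.
have d0 : 0 <= dist2 a x by apply: sumr_ge0 => i _; exact: sqr_ge0.
have H (i : 'I_6) : `|coord6 i (x - a)| <= Num.sqrt (dist2 a x).
  rewrite -sqrtr_sqr ler_wsqrtr // /dist2 (bigD1 i) //= coord6D.
  have -> : coord6 i (- a) = - coord6 i a by rewrite -scaleN1r coord6Z mulN1r.
  by rewrite lerDl; apply: sumr_ge0 => j _; exact: sqr_ge0.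
rewrite -[leRHS](sqr_sqrtr d0); apply: lerXn2r; rewrite ?nnegrE ?sqrtr_ge0 //.
rewrite !norm_pair !ge_max.
by rewrite (H (@Ordinal 6 0 isT)) (H (@Ordinal 6 1 isT)) (H (@Ordinal 6 2 isT))
  (H (@Ordinal 6 3 isT)) (H (@Ordinal 6 4 isT)) (H (@Ordinal 6 5 isT)).
Qed.

Definition gauss (c : R) (a x : R6 R) : R := expR (- (c * dist2 a x)).

Lemma polyfn_dist2 (c : R) a : polyfn (fun x => - (c * dist2 a x)).
Proof.
rewrite (_ : (fun x => _) = (fun x => (- c) * dist2 a x)); last by apply/funext => x; rewrite mulNr.
apply: (polyfnM (polyfn_cst _)).
rewrite /dist2; elim: (index_enum 'I_6) => [|i s IH].
  by rewrite (_ : (fun x => _) = (fun=> 0)); [exact: polyfn_cst|apply/funext => x; rewrite big_nil].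
rewrite (_ : (fun x => _) = (fun x => (coord6 i x + - coord6 i a) * (coord6 i x + - coord6 i a) +
  \sum_(j <- s) (coord6 j x - coord6 j a) ^+ 2)).
  apply: polyfnD IH.
  by apply: polyfnM; apply: polyfnD (polyfn_coord6 i) (polyfn_cst _).
by apply/funext => x; rewrite big_cons expr2.
Qed.

(** From 1 + |x| <= (1 + |a|) exp(s) with s = |x - a|, the product is at most (1 + |a|)^m exp(m s -
    c s^2), and completing the square bounds the exponent by m^2 / (4 c). *)
Lemma gauss_decay (c : R) a m : 0 < c ->
  exists C, forall x : R6 R, (1 + `|x|) ^+ m * expR (- (c * dist2 a x)) <= C.
Proof.
move=> c0; exists ((1 + `|a|) ^+ m * expR (m%:R ^+ 2 / (4 * c))) => x.
set s := `|x - a|.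
have h1 : 1 + `|x| <= (1 + `|a|) * expR s.
  apply: (@le_trans _ _ ((1 + `|a|) * (1 + s))).
    have := ler_normD (x - a) a; rewrite subrK -/s.
    have : 0 <= `|a| * s := mulr_ge0 (normr_ge0 a) (normr_ge0 (x - a)).
    rewrite mulrDl mul1r mulrDr mulr1; lra.
  by apply: ler_wpM2l; [rewrite addr_ge0|exact: expR_ge1Dx].
apply: (@le_trans _ _ (((1 + `|a|) * expR s) ^+ m * expR (- (c * s ^+ 2)))).
  apply: ler_pM; rewrite ?exprn_ge0 ?addr_ge0 ?expR_ge0 //.
    by apply: lerXn2r; rewrite ?nnegrE ?mulr_ge0 ?addr_ge0 ?expR_ge0.
  by rewrite ler_expR lerN2; apply: ler_wpM2l; [exact: ltW|exact: norm_le_dist2].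
rewrite exprMn -mulrA; apply: ler_wpM2l; first by rewrite exprn_ge0 // addr_ge0.
rewrite -expRM_natl -expRD ler_expR.
rewrite -subr_ge0 (_ : _ - _ = (c * s - m%:R / 2) ^+ 2 / c); first by rewrite divr_ge0 ?sqr_ge0 //
  ltW.
by field; rewrite gt_eqF.
Qed.

Lemma schwartz_gauss (c : R) a : 0 < c -> schwartz (fun x => (gauss c a x)%:C%C).
Proof.
move=> c0; have H p (pp : polyfn p) := schwartz_polyfn_expR pp (polyfn_dist2 c a) (fun m =>
  gauss_decay a m c0).
split.
  have := H (fun=> 1) (polyfn_cst 1); congr schwartz_real.
  by apply/funext => x; rewrite mul1r.
have := H (fun=> 0) (polyfn_cst 0); congr schwartz_real.
by apply/funext => x; rewrite mul0r.
Qed.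

End Gaussians.

(** * Continuous densities annihilated by Gaussians *)

Section VanishingDensity.
Context {R : realType}.

Lemma rintegral_prod d1 d2 (T1 : measurableType d1) (T2 : measurableType d2)
    (m1 : {sigma_finite_measure set T1 -> \bar R})
    (m2 : {sigma_finite_measure set T2 -> \bar R}) (f : T1 -> R) (g : T2 -> R) :
  rintegrable m1 f -> rintegrable m2 g ->
  \int[m1 \xs m2]_z (f z.1 * g z.2) = (\int[m1]_x f x) * \int[m2]_y g y.
Proof.
move=> fi gi; have [_ <-] := rfubini (rintegrable_prod fi gi).
rewrite -RintegralZr //; apply: eq_Rintegral => x _ /=; exact: RintegralZl.
Qed.

Lemma integral_box (a r : R) : 0 <= r ->
  rintegrable (l1 R) (\1_(`[a - r, a + r])) /\ \int[l1 R]_s \1_(`[a - r, a + r]) s = 2 * r.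
Proof.
move=> r0; have mB : measurable (`[a - r, a + r] : set (L1 R)) by exact: measurable_itv.
have E : (\int[l1 R]_s (\1_(`[a - r, a + r]) s)%:E = (2 * r)%:E)%E.
  rewrite integral_indic // setIT; apply: etrans (lebesgue_measure_itv _) _.
  rewrite /= lte_fin; case: ltP => h; last first.
    have {}h : a + r <= a - r :> R := h.
    have -> : r = 0 by apply: le_anti; apply/andP; split => //; move: h; clear; lra.
    by rewrite mulr0.
  by rewrite -EFinB; congr EFin; ring.
split; last by rewrite /Rintegral E.
apply/integrableP; split; first by apply: emeas; exact: measurable_indic.
rewrite (eq_integral (fun s : L1 R => (\1_(`[a - r, a + r]) s)%:E)) ?E ?ltry // => s _.
by rewrite gee0_abs // lee_fin.
Qed.

Definition coord5 (i : nat) (q : R5 R) : R :=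
  match i with 0 => q.1.1.1.1 | 1 => q.1.1.1.2 | 2 => q.1.1.2 | 3 => q.1.2 | _ => q.2 end.

Lemma coord5_cone i (q : R5 R) : (i < 5)%N -> coord6 i (cone_pt q) = coord5 i q.
Proof. by case: q => [[[[? ?] ?] ?] ?]; case: i => [|[|[|[|[|i]]]]]. Qed.

Lemma continuous_coord5 i : continuous (coord5 i).
Proof.
have f1 (U V : topologicalType) : continuous (fun z : U * V => z.1) by move=> z; exact: cvg_fst.
have f2 (U V : topologicalType) : continuous (fun z : U * V => z.2) by move=> z; exact: cvg_snd.
have c3 : continuous (fun x : R5 R => x.1.1).
  by move=> x; apply: (@continuous_comp _ _ _ fst fst); exact: f1.
have c2 : continuous (fun x : R5 R => x.1.1.1).
  by move=> x; apply: (@continuous_comp _ _ _ (fun x : R5 R => x.1.1) fst); [exact: c3|exact: f1].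
case: i => [|[|[|[|i]]]] x.
- by apply: (@continuous_comp _ _ _ (fun x : R5 R => x.1.1.1) fst); [exact: c2|exact: f1].
- by apply: (@continuous_comp _ _ _ (fun x : R5 R => x.1.1.1) snd); [exact: c2|exact: f2].
- by apply: (@continuous_comp _ _ _ (fun x : R5 R => x.1.1) snd); [exact: c3|exact: f2].
- by apply: (@continuous_comp _ _ _ fst snd); [exact: f1|exact: f2].
- exact: f2.
Qed.

Lemma norm5_le (q : R5 R) (c : R) : (forall i, (i < 5)%N -> `|coord5 i q| <= c) -> `|q| <= c.
Proof.
by move=> H; rewrite !norm_pair !ge_max (H 0%N isT) (H 1%N isT) (H 2%N isT) (H 3%N isT) (H 4%N isT).
Qed.

Lemma coord5B i (p q : R5 R) : coord5 i (p - q) = coord5 i p - coord5 i q.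
Proof. by case: i => [|[|[|[|i]]]]. Qed.

Lemma measurable_coord5 i : measurable_fun (setT : set (L5 R)) (coord5 i).
Proof.
have m3 : measurable_fun setT (fun q : L5 R => q.1.1 : L3 R).
  exact: (measurableT_comp measurable_fst measurable_fst).
have [h0 h1 h2] := measurable_co3 m3; case: i => [|[|[|[|i]]]].
- exact: h0.
- exact: h1.
- exact: h2.
- exact: (measurableT_comp measurable_snd measurable_fst).
- exact: measurable_snd.
Qed.

(** The squared distance is taken in R^6 but regarded as a function of the five chart coordinates:
    the test functions live on R^6, the integral on the chart. *)
Definition cone_dist (q0 q : R5 R) : R := dist2 (cone_pt q0) (cone_pt q).

Lemma coord6_cone_last (q : R5 R) : coord6 5 (cone_pt q) = (coord5 1 q * coord5 4 q - coord5 2 q *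
  coord5 3 q) / coord5 0 q.
Proof. by case: q => [[[[? ?] ?] ?] ?]. Qed.

Lemma cone_distE (q0 q : R5 R) : cone_dist q0 q = \sum_(i < 5) (coord5 i q - coord5 i q0) ^+ 2 +
  ((coord5 1 q * coord5 4 q - coord5 2 q * coord5 3 q) / coord5 0 q - coord6 5 (cone_pt q0)) ^+ 2.
Proof.
rewrite /cone_dist /dist2 big_ord_recr; congr (_ + _).
  by apply: eq_bigr => i _; rewrite -!(coord5_cone _ (ltn_ord i)).
exact: (congr1 (fun t => (t - coord6 5 (cone_pt q0)) ^+ 2) (coord6_cone_last q)).
Qed.

Lemma cone_dist_cvg (q0 q1 : R5 R) (u : nat -> R5 R) : coord5 0 q1 != 0 -> u @ \oo --> q1 ->
  (fun n => cone_dist q0 (u n)) @ \oo --> cone_dist q0 q1.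
Proof.
move=> n0 uc; have C i : (fun n => coord5 i (u n)) @ \oo --> coord5 i q1.
  by apply: (cvg_comp u (coord5 i) uc); exact: continuous_coord5.
rewrite cone_distE; under eq_fun do rewrite cone_distE.
have sq (v : nat -> R) (a b : R) : v @ \oo --> a -> (fun n => (v n - b) ^+ 2) @ \oo --> (a - b) ^+
  2.
  by move=> va; rewrite expr2; under eq_fun do rewrite expr2; apply: cvgM; apply: cvgB => //;
    exact: cvg_cst.
apply: cvgD; last first.
  apply: sq; apply: cvgM; last exact: cvgV.
  by apply: cvgB; exact: cvgM.
rewrite !big_ord_recl big_ord0; under eq_fun do rewrite !big_ord_recl big_ord0.
by do 5!(apply: cvgD; first exact: sq); exact: cvg_cst.
Qed.

Lemma measurable_cone_dist (q0 : R5 R) : measurable_fun (setT : set (L5 R)) (cone_dist q0).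
Proof.
have m := measurable_coord5.
rewrite (_ : cone_dist q0 = fun q : L5 R => \sum_(i < 5) (coord5 i q - coord5 i q0) ^+ 2 +
  ((coord5 1 q * coord5 4 q - coord5 2 q * coord5 3 q) / coord5 0 q - coord6 5 (cone_pt q0)) ^+
    2); last first.
  by apply/funext => q; exact: cone_distE.
apply: measurable_funD.
  by apply: measurable_sum => i; apply: measurable_funX; apply: measurable_funB.
apply: measurable_funX; apply: measurable_funB => //; apply: measurable_funM; last first.
  exact: (measurableT_comp measurable_invr (m 0%N)).
by apply: measurable_funB; apply: measurable_funM.
Qed.

(* If w q0 > 0, choose del with w > 0 on {rho <= del}, where rho is the squared
   distance to cone_pt q0. Then e^(n (del - rho)) >= min(e^(n (del - rho)), 1) on that
   set, with equality off it, and the minimum tends to its indicator. *)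
Lemma cone_test_pos (w : R5 R -> R) (q0 : R5 R) : q0.1.1.1.1 != 0 -> {for q0, continuous w} ->
  (forall n, rintegrable (l5 R) (fun q => w q * gauss n.+1%:R (cone_pt q0) (cone_pt q)) /\
     \int[l5 R]_q (w q * gauss n.+1%:R (cone_pt q0) (cone_pt q)) = 0) -> w q0 <= 0.
Proof.
move=> q00 cw Hw; rewrite leNgt; apply/negP => w0.
pose rho := cone_dist q0; pose eta := w q0 / 2.
have eta0 : 0 < eta by rewrite divr_gt0.
have [r r0 Hr] : exists2 r, 0 < r & forall q, `|q0 - q| < r -> eta < w q.
  have /cvgrPdist_lt/(_ eta eta0) : w @ q0 --> w q0 by [].
  move=> /nbhs_normP[r /= r0 Hr]; exists r => // q /Hr /=.
  by have := ler_norm (w q0 - w q); rewrite /eta; lra.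
pose del := (r / 2) ^+ 2.
have del0 : 0 < del by rewrite exprn_gt0 // divr_gt0.
have near_rho q : rho q <= del -> `|q0 - q| < r.
  move=> hq; apply: (@le_lt_trans _ _ (r / 2)); last by lra.
  apply: norm5_le => i i5; rewrite coord5B distrC.
  rewrite -(@ler_pXn2r _ 2) ?nnegrE ?(ltW (divr_gt0 r0 _)) // real_normK ?num_real //.
  (* Each chart coordinate contributes one of the squares that make up [rho], so a small [rho]
     confines q to a small cube. *)
  apply: le_trans hq; rewrite /rho cone_distE (bigD1 (Ordinal i5)) //= -addrA lerDl.
  by apply: addr_ge0; [apply: sumr_ge0 => j _|]; exact: sqr_ge0.
have crho : {for q0, continuous rho}.
  by apply: seq_continuous => u; exact: cone_dist_cvg.
have rho0 : rho q0 = 0.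
  by rewrite /rho /cone_dist /dist2 big1 // => i _; rewrite subrr expr0n.
have [r1 r10 Hr1] : exists2 r1, 0 < r1 & forall q, `|q0 - q| < r1 -> rho q <= del.
  have /cvgrPdist_lt/(_ del del0) : rho @ q0 --> rho q0 by [].
  move=> /nbhs_normP[r1 /= r10 Hr']; exists r1 => // q /Hr' /=.
  by rewrite rho0 sub0r normrN; have := ler_norm (rho q); lra.
(* The first Gaussian makes [h] integrable, and [h] dominates the truncated sequence; the later
   Gaussians differ from the first by the factors exp(-n rho). *)
pose h q := w q * gauss 1 (cone_pt q0) (cone_pt q).
have hE q : h q = w q * expR (- rho q) by rewrite /h /gauss mul1r.
have hi : rintegrable (l5 R) h := (Hw 0%N).1.
have mh := rintegrable_meas hi.
have hpos q : rho q <= del -> 0 < h q.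
  by move=> /near_rho /Hr hq; rewrite hE mulr_gt0 ?expR_gt0 //; lra.
have gE n q : w q * gauss n.+1%:R (cone_pt q0) (cone_pt q) = h q * expR (- (n%:R * rho q)).
  by rewrite hE -mulrA -expRD /gauss -natr1; congr (_ * expR _); rewrite /rho /cone_dist; ring.
pose e n q := expR (n%:R * (del - rho q)).
have heE n q : h q * e n q = expR (n%:R * del) * (w q * gauss n.+1%:R (cone_pt q0) (cone_pt q)).
  by rewrite gE mulrCA -expRD; congr (_ * expR _); ring.
have he n : rintegrable (l5 R) (fun q => h q * e n q) /\ \int[l5 R]_q (h q * e n q) = 0.
  have [i0 E0] := Hw n; split.
    by apply: eq_integrable (rintegrableZ (expR (n%:R * del)) i0) => // q _; rewrite /= heE.
  transitivity (\int[l5 R]_q (expR (n%:R * del) * (w q * gauss n.+1%:R (cone_pt q0) (cone_pt q)))).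
    by apply: eq_Rintegral => q _; exact: heE.
  by rewrite RintegralZl // E0 mulr0.
have mrho := measurable_cone_dist q0.
pose F n q := h q * Num.min (e n q) 1.
have mF n : measurable_fun (setT : set (L5 R)) (F n).
  apply: measurable_funM => //; apply: measurable_minr => //.
  apply: measurableT_comp; first exact: measurable_expR.
  by apply: measurable_funM => //; apply: measurable_funB.
have FB n q : `|F n q| <= `|h q|.
  rewrite normrM ler_piMr // ger0_norm ?ge_min ?lexx ?orbT //.
  by rewrite le_min expR_ge0 ler01.
have hni : rintegrable (l5 R) (fun q => `|h q|).
  have := integrable_abse hi; by congr (integrable _ _ _).
have Fi n : rintegrable (l5 R) (F n) by apply: (rintegrable_dom (mF n) hni) => q; exact: FB.
have F0 n : \int[l5 R]_q F n q <= 0.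
  have [i0 <-] := he n; apply: le_Rintegral => //; first exact: Fi.
  move=> q _; rewrite /F.
  have [hq|hq] := leP (rho q) del.
    by apply: ler_wpM2l; [exact: ltW (hpos _ hq)|rewrite ge_min lexx].
  by rewrite min_l // /e -expR0 ler_expR mulr_ge0_le0 // subr_le0 ltW.
pose F1 q := if rho q <= del then h q else 0.
have FF1 q : (fun n => F n q) @ \oo --> F1 q.
  rewrite /F /F1; have [hq|hq] := leP (rho q) del.
    rewrite (_ : (fun n => _) = fun=> h q); first exact: cvg_cst.
    by apply/funext => n; rewrite min_r ?mulr1 // /e -expR0 ler_expR mulr_ge0 // subr_ge0.
  rewrite -[X in _ --> X](mulr0 (h q)); apply: cvgM; first exact: cvg_cst.
  rewrite (_ : (fun n => _) = fun n => expR (del - rho q) ^+ n).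
    by apply: cvg_expr; rewrite ger0_norm ?expR_ge0 // -expR0 ltr_expR subr_lt0.
  apply/funext => n; rewrite min_l /e ?expRM_natl // -expRM_natl -expR0 ler_expR.
  by rewrite mulr_ge0_le0 // subr_le0 ltW.
have lim := rdct mF FF1 hni FB.
have I0 : \int[l5 R]_q F1 q <= 0.
  rewrite -(cvg_lim _ lim) //; apply: limr_le; first by apply/cvg_ex; exists (\int[l5 R]_q F1 q).
  by apply: nearW.
(* The limit [F1] is nonnegative and at least [kap] on a cube of half-side [r2], which contradicts
   [I0]. *)
pose r2 := Num.min r r1 / 2.
have r20 : 0 < r2 by rewrite divr_gt0 // lt_min r0 r10.
have r2l : r2 < Num.min r r1 by rewrite ltr_pdivrMr // ltr_pMr ?ltr1n // lt_min r0 r10.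
pose b i (s : R) : R := \1_(`[coord5 i q0 - r2, coord5 i q0 + r2]) s.
have [bi bI] : (forall i, rintegrable (l1 R) (b i)) /\ forall i, \int[l1 R]_s b i s = 2 * r2.
  by split=> i; have [] := integral_box (coord5 i q0) (ltW r20).
pose box (q : L5 R) : R := b 0%N q.1.1.1.1 * b 1%N q.1.1.1.2 * b 2%N q.1.1.2 * b 3%N q.1.2 * b 4%N
  q.2.
have boxi : rintegrable (l5 R) box.
  exact: (rintegrable_prod (rintegrable_prod (rintegrable_prod (rintegrable_prod (bi 0%N) (bi
    1%N)) (bi 2%N)) (bi 3%N)) (bi 4%N)).
have boxI : \int[l5 R]_q box q = (2 * r2) ^+ 5.
  have i2 := rintegrable_prod (bi 0%N) (bi 1%N).
  have i3 := rintegrable_prod i2 (bi 2%N); have i4 := rintegrable_prod i3 (bi 3%N).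
  apply: etrans (rintegral_prod i4 (bi 4%N)) _.
  rewrite (rintegral_prod i3 (bi 3%N)) (rintegral_prod i2 (bi 2%N)) (rintegral_prod (bi 0%N) (bi
    1%N)) !bI.
  by rewrite !exprS expr0; ring.
pose kap := eta * expR (- del).
have kap0 : 0 < kap by rewrite mulr_gt0 ?expR_gt0.
have F1i : rintegrable (l5 R) F1.
  apply: (rintegrable_dom _ hni) => [|q].
    by apply: measurable_fun_ifT => //; exact: measurable_fun_ler.
  by rewrite /F1; case: ifP; rewrite ?normr0.
have low q : kap * box q <= F1 q.
  have b01 i s : b i s = 0 \/ (b i s = 1 /\ `|coord5 i q0 - s| <= r2).
    rewrite /b indicE; case: (boolP (s \in _)) => h1; last by left.
    right; split => //; move: h1; rewrite inE /= in_itv /= => /andP[h1 h2].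
    by rewrite distrC ler_distl h1 h2.
  have F1pos : 0 <= F1 q.
    by rewrite /F1; case: ifP => // hq; rewrite ltW // hpos.
  have Z (x : R) : x = 0 -> kap * x <= F1 q by move=> ->; rewrite mulr0.
  rewrite /box.
  case: (b01 0%N q.1.1.1.1) => [->|[-> h0]]; first by apply: Z; rewrite !mul0r.
  case: (b01 1%N q.1.1.1.2) => [->|[-> h1]]; first by apply: Z; rewrite mulr0 !mul0r.
  case: (b01 2%N q.1.1.2) => [->|[-> h2]]; first by apply: Z; rewrite mulr0 !mul0r.
  case: (b01 3%N q.1.2) => [->|[-> h3]]; first by apply: Z; rewrite mulr0 !mul0r.
  case: (b01 4%N q.2) => [->|[-> h4]]; first by apply: Z; rewrite mulr0.
  rewrite !mulr1.
  have nq : `|q0 - q| <= r2.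
    by apply: norm5_le => -[|[|[|[|[|i]]]]] // _; rewrite coord5B.
  have [q1 q2] : `|q0 - q| < r /\ `|q0 - q| < r1.
    by have := le_lt_trans nq r2l; rewrite lt_min => /andP.
  have hq := Hr1 _ q2; rewrite /F1 hq hE /kap.
  apply: ler_pM; rewrite ?expR_ge0 ?(ltW eta0) //; first exact: ltW (Hr _ q1).
  by rewrite ler_expR lerN2.
have : kap * (2 * r2) ^+ 5 <= 0.
  apply: le_trans I0; rewrite -boxI -RintegralZl //.
  by apply: le_Rintegral => //; exact: rintegrableZ.
by apply/negP; rewrite -ltNge mulr_gt0 // exprn_gt0 // mulr_gt0.
Qed.

End VanishingDensity.

Section Uniqueness.
Context {R : realType}.

Lemma ccvg_sum (I : Type) (s : seq I) (u : nat -> I -> R[i]) (v : I -> R[i]) :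
  (forall i, (fun n => complex.Re (u n i)) @ \oo --> complex.Re (v i) /\
    (fun n => complex.Im (u n i)) @ \oo --> complex.Im (v i)) ->
  (fun n => complex.Re (\sum_(i <- s) u n i)) @ \oo --> complex.Re (\sum_(i <- s) v i) /\
  (fun n => complex.Im (\sum_(i <- s) u n i)) @ \oo --> complex.Im (\sum_(i <- s) v i).
Proof.
move=> H; elim: s => [|i s [IH1 IH2]].
  rewrite big_nil; split; [under eq_fun do rewrite big_nil|under eq_fun do rewrite big_nil];
    exact: cvg_cst.
have [h1 h2] := H i; rewrite big_cons ReD ImD; split.
  by under eq_fun do rewrite big_cons ReD; exact: cvgD.
by under eq_fun do rewrite big_cons ImD; exact: cvgD.
Qed.

Lemma cone_test_zero (w : R5 R -> R) (q0 : R5 R) : q0.1.1.1.1 != 0 -> {for q0, continuous w} ->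
  (forall n, rintegrable (l5 R) (fun q => w q * gauss n.+1%:R (cone_pt q0) (cone_pt q)) /\
     \int[l5 R]_q (w q * gauss n.+1%:R (cone_pt q0) (cone_pt q)) = 0) -> w q0 = 0.
Proof.
move=> q00 cw Hw; apply: le_anti; rewrite (cone_test_pos q00 cw Hw) /= -oppr_le0.
apply: (@cone_test_pos _ (fun q => - w q)) => //; first exact: cvgN.
move=> n; have [i0 E0] := Hw n.
have E (q : L5 R) : - w q * gauss n.+1%:R (cone_pt q0) (cone_pt q) =
    -1 * (w q * gauss n.+1%:R (cone_pt q0) (cone_pt q)) by rewrite mulN1r mulNr.
split; first by apply: eq_integrable (rintegrableZ (-1) i0) => // q _; rewrite /= E.
transitivity (\int[l5 R]_q (-1 * (w q * gauss n.+1%:R (cone_pt q0) (cone_pt q)))).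
  by apply: eq_Rintegral => q _; exact: E.
by rewrite RintegralZl // E0 mulr0.
Qed.

Lemma cone_spinors_cvg (u : nat -> R5 R) (q : R5 R) i B : q.1.1.1.1 != 0 -> u @ \oo --> q ->
  (fun n => cone_spinors (u n) i B) @ \oo --> cone_spinors q i B.
Proof.
move=> q0 uq; have C j : (fun n => coord5 j (u n)) @ \oo --> coord5 j q.
  by apply: (cvg_comp u (coord5 j) uq); exact: continuous_coord5.
have E (p : R5 R) : cone_spinors p i B = nth 0 (nth [::] [:: [:: 1; 0; - coord5 3 p / coord5 0 p;
  - coord5 4 p / coord5 0 p];
    [:: 0; coord5 0 p; coord5 1 p; coord5 2 p]] i) B.
  by case: p => [[[[? ?] ?] ?] ?]; rewrite mxE.
rewrite E; under eq_fun do rewrite E.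
have D j : (fun n => - coord5 j (u n) / coord5 0 (u n)) @ \oo --> - coord5 j q / coord5 0 q.
  by apply: cvgM; [apply: cvgN; exact: C|apply: cvgV => //; exact: C].
case: i {E} => [[|[|i]] Hi] //=; case: B => [[|[|[|[|B]]]] HB] //=;
  first [exact: cvg_cst|exact: (D 3%N)|exact: (D 4%N)|exact: (C 0%N)|exact: (C 1%N)|exact: (C 2%N)].
Qed.

(** A momentum satisfies the Pluecker relation, so for nonzero P_01 its component P_23 is the one in
    [cone_pt]. *)
Lemma momentum_cone_pt (l : 'M[R]_(2, 4)) : momentum l ord0 (lift ord0 ord0) != 0 ->
  exists2 q : R5 R, q.1.1.1.1 != 0 & bivector (cone_pt q) = momentum l.
Proof.
move=> P0; pose P (a b : 'I_4) := momentum l a b.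
pose i1 : 'I_4 := @Ordinal 4 1 isT; pose i2 : 'I_4 := @Ordinal 4 2 isT; pose i3 : 'I_4 := @Ordinal
  4 3 isT.
have E1 : lift ord0 ord0 = i1 by apply/val_inj.
rewrite E1 in P0.
exists (P ord0 i1, P ord0 i2, P ord0 i3, P i1 i2, P i1 i3) => //.
have I4 (a : 'I_4) : [\/ a = ord0, a = i1, a = i2 | a = i3].
  case: a => [[|[|[|[|//]]]] Ha]; [apply: Or41|apply: Or42|apply: Or43|apply: Or44]; exact/val_inj.
rewrite /P; apply/matrixP => A B; rewrite !mxE in P0 *.
by case: (I4 A) => ->; case: (I4 B) => ->; rewrite /=; field.
Qed.

(** The rows of [l] are independent and so have a dual family [r]; contracting every index of the
    tensor with [r] isolates one component. *)
Lemma spinor_tensor_inj k (l : 'M[R]_(2, 4)) (E : k.-tuple 'I_2 -> R[i]) : momentum l != 0 ->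
  (forall A : k.-tuple 'I_4, \sum_a E a * (\prod_(i < k) l (tnth a i) (tnth A i))%:C%C = 0) ->
  forall b, E b = 0.
Proof.
move=> /momentum_neq0[B [C P0]] H b; set P := momentum l B C in P0.
have PE : P = l 0 B * l 1 C - l 1 B * l 0 C by rewrite /P mxE.
(* The inverse of the 2 by 2 block of columns [B], [C], extended by zero. *)
pose r (D : 'I_4) (c : 'I_2) : R := (D == B)%:R * ((if c == 0 then l 1 C else - l 0 C) / P) +
  (D == C)%:R * ((if c == 0 then - l 1 B else l 0 B) / P).
have S (g : 'I_4 -> R) (D : 'I_4) (x : R) : \sum_A g A * ((A == D)%:R * x) = g D * x.
  rewrite (bigD1 D) //= eqxx mul1r big1 ?addr0 // => A /negPf ->.
  by rewrite mul0r mulr0.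
have rE (a c : 'I_2) : \sum_D l a D * r D c = (a == c)%:R.
  under eq_bigr do rewrite mulrDr; rewrite big_split /= !S.
  have I2 (j : 'I_2) : j = 0 \/ j = 1.
    by case: j => [[|[|//]] Hj]; [left|right]; exact/val_inj.
  by case: (I2 a) => ->; case: (I2 c) => -> /=; move: P0; rewrite PE => P0; field.
have : \sum_(A : k.-tuple 'I_4) (\prod_(i < k) r (tnth A i) (tnth b i))%:C%C *
    (\sum_a E a * (\prod_(i < k) l (tnth a i) (tnth A i))%:C%C) = 0.
  by apply: big1 => A _; rewrite H mulr0.
under eq_bigr do rewrite mulr_sumr.
rewrite exchange_big /= (bigD1 b) //=.
have T a : \sum_(A : k.-tuple 'I_4) (\prod_(i < k) r (tnth A i) (tnth b i))%:C%C *
    (E a * (\prod_(i < k) l (tnth a i) (tnth A i))%:C%C) =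
    E a * (\prod_(i < k) (tnth a i == tnth b i)%:R)%:C%C.
  have -> : \prod_(i < k) (tnth a i == tnth b i)%:R = \sum_(A : k.-tuple 'I_4)
      \prod_(i < k) (l (tnth a i) (tnth A i) * r (tnth A i) (tnth b i)).
    rewrite (sum_prod_tuple (fun i D => l (tnth a i) D * r D (tnth b i))).
    by apply: eq_bigr => i _; rewrite rE.
  rewrite rmorph_sum /= mulr_sumr; apply: eq_bigr => A _.
  by rewrite big_split /= rmorphM /= mulrCA [X in _ * X]mulrC.
rewrite T (_ : \prod_(i < k) (tnth b i == tnth b i)%:R = 1) ?mulr1; last first.
  by apply: big1 => i _; rewrite eqxx.
rewrite [X in _ + X]big1 ?addr0 // => i /eqP ab.
rewrite T; have [j /negPf abj] : exists j, tnth i j != tnth b j.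
  apply: contrapT => n; apply: ab; apply: eq_from_tnth => j.
  by apply: contrapT => /eqP h; apply: n; exists j.
by rewrite (bigD1 j) //= abj mul0r mulr0.
Qed.

Variables (k : nat) (F : R6 R -> k.-tuple 'I_4 -> R[i]).

Lemma cone_fourier_unique (Ft1 Ft2 : 'M[R]_(2, 4) -> k.-tuple 'I_2 -> R[i]) :
  is_cone_fourier F Ft1 -> is_cone_fourier F Ft2 ->
  forall l, momentum l != 0 -> forall a, Ft1 l a = Ft2 l a.
Proof.
move=> [_ c1 [G1 [g1 F1]]] [_ c2 [G2 [g2 F2]]].
(* The contracted difference is a function of the momentum alone, hence can be tested on the cone;
   [spinor_tensor_inj] then recovers the components. *)
pose Ds (A : k.-tuple 'I_4) l := \sum_(a : k.-tuple 'I_2) (Ft1 l a - Ft2 l a) *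
  (\prod_(i < k) l (tnth a i) (tnth A i))%:C%C.
suff Ds0 A l : momentum l != 0 -> Ds A l = 0.
  move=> l l0 a; apply/eqP; rewrite -subr_eq0; apply/eqP.
  exact: (spinor_tensor_inj (E := fun a => Ft1 l a - Ft2 l a) l0 (fun A => Ds0 A l l0)).
have DsG l' : momentum l' != 0 -> Ds A l' = G1 (momentum l') A - G2 (momentum l') A.
  move=> l'0; rewrite g1 // g2 // -sumrB; apply: eq_bigr => a _; exact: mulrBl.
have ReB (x y : R[i]) : complex.Re (x - y) = complex.Re x - complex.Re y.
  by case: x y => [x1 x2] [y1 y2].
have ImB (x y : R[i]) : complex.Im (x - y) = complex.Im x - complex.Im y.
  by case: x y => [x1 x2] [y1 y2].
have Dsc (u : nat -> 'M[R]_(2, 4)) lo : momentum lo != 0 -> u @ \oo --> lo ->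
    (fun n => complex.Re (Ds A (u n))) @ \oo --> complex.Re (Ds A lo) /\
    (fun n => complex.Im (Ds A (u n))) @ \oo --> complex.Im (Ds A lo).
  move=> lo0 ul; apply: ccvg_sum => a; apply: cvg_cM.
    have [a1 a2] := c1 lo lo0 a; have [b1 b2] := c2 lo lo0 a.
    rewrite ReB ImB; split; [under eq_fun do rewrite ReB|under eq_fun do rewrite ImB]; apply: cvgB.
    - by apply: (cvg_comp u (fun m => complex.Re (Ft1 m a)) ul); exact: a1.
    - by apply: (cvg_comp u (fun m => complex.Re (Ft2 m a)) ul); exact: b1.
    - by apply: (cvg_comp u (fun m => complex.Im (Ft1 m a)) ul); exact: a2.
    - by apply: (cvg_comp u (fun m => complex.Im (Ft2 m a)) ul); exact: b2.
  split => /=; last exact: cvg_cst.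
  by apply: cvgn_prod => i; exact: cvgn_coord.
have cn0 : (cone_norm R)%:C%C != 0.
  apply/eqP => /(congr1 (@complex.Re R)) /= /eqP; apply/negP.
  by rewrite gt_eqF // mulr_gt0 // exprn_gt0 // mulr_gt0 // pi_gt0.
pose H phi (q : L5 R) := cone_integrand (fun P => G1 (bivector P) A * phi P) q +
  -1 * cone_integrand (fun P => G2 (bivector P) A * phi P) q.
have HH phi : schwartz phi -> cintegrable (l5 R) (H phi) /\ cintegral (l5 R) (H phi) = 0.
  move=> sp; have [_ /(leb5E _).1 i1 E1] := F1 A phi sp; have [_ /(leb5E _).1 i2 E2] := F2 A phi sp.
  have i2' := cintegrableMl (-1) i2.
  split; first exact: (cintegrableD i1 i2').
  have EE : cintegral (l5 R) (cone_integrand (fun P => G1 (bivector P) A * phi P)) =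
      cintegral (l5 R) (cone_integrand (fun P => G2 (bivector P) A * phi P)).
    apply: (mulfI cn0); apply: etrans (congr1 (fun z => _ * z) (esym (leb5E _).2)) _.
    apply: etrans (esym E1) _; apply: etrans E2 _.
    exact: (congr1 (fun z => _ * z) (leb5E _).2).
  apply: etrans (cintegralD i1 i2') _.
  apply: etrans (congr1 (fun z => _ + z) (cintegralMl (-1) i2)) _.
  by rewrite EE mulN1r subrr.
(* A real Gaussian leaves the complex difference of the densities as a factor, so its real and
   imaginary parts can be tested separately. *)
have Hgauss n (q0 q : R5 R) : H (fun x => (gauss n.+1%:R (cone_pt q0) x)%:C%C) q =
    (`|4 * q.1.1.1.1|^-1 * gauss n.+1%:R (cone_pt q0) (cone_pt q))%:C%C *
     (G1 (bivector (cone_pt q)) A - G2 (bivector (cone_pt q)) A).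
  by rewrite /H; case: q => [[[[p1 p2] p3] p12] p13]; rewrite /cone_integrand rmorphM /=; ring.
pose W (q : R5 R) := G1 (bivector (cone_pt q)) A - G2 (bivector (cone_pt q)) A.
have WD q : q.1.1.1.1 != 0 -> W q = Ds A (cone_spinors q).
  by move=> q0; rewrite DsG ?cone_momentum_neq0 // momentum_cone_spinors.
have Wc (q0 : R5 R) (u : nat -> R5 R) : q0.1.1.1.1 != 0 -> u @ \oo --> q0 ->
    (fun n => complex.Re (W (u n))) @ \oo --> complex.Re (W q0) /\
    (fun n => complex.Im (W (u n))) @ \oo --> complex.Im (W q0).
  move=> q00 uq.
  have near0 : \forall n \near \oo, (u n).1.1.1.1 != 0.
    have c0 : (fun n => coord5 0 (u n)) @ \oo --> coord5 0 q0.
      by apply: (cvg_comp u (coord5 0) uq); exact: continuous_coord5.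
    have q0' : 0 < `|coord5 0 q0| by rewrite normr_gt0.
    move/cvgrPdist_lt : c0 => /(_ _ q0'); apply: filterS => n; apply: contraTneq.
    by rewrite /coord5 => ->; rewrite subr0 ltxx.
  have [d1 d2] := Dsc (fun n => cone_spinors (u n)) (cone_spinors q0) (cone_momentum_neq0 q00)
    (cvgn_mx (fun i B => cone_spinors_cvg q00 uq)).
  rewrite WD //; split.
    apply: cvg_trans d1; apply: near_eq_cvg; apply: filterS near0 => n h; by rewrite WD.
  apply: cvg_trans d2; apply: near_eq_cvg; apply: filterS near0 => n h; by rewrite WD.
have W0 (q0 : R5 R) : q0.1.1.1.1 != 0 -> W q0 = 0.
  move=> q00.
  have wt (X : R[i] -> R) : (forall (c : R) z, X (c%:C%C * z) = c * X z) ->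
      (forall u : nat -> R5 R, u @ \oo --> q0 -> (fun n => X (W (u n))) @ \oo --> X (W q0)) ->
      (forall n, rintegrable (l5 R) (fun q => X (H (fun x => (gauss n.+1%:R (cone_pt q0) x)%:C%C)
        q)) /\
         \int[l5 R]_q X (H (fun x => (gauss n.+1%:R (cone_pt q0) x)%:C%C) q) = 0) -> X (W q0) = 0.
    move=> XM Xc XH.
    (* The Leray factor is kept inside the tested density; it is continuous and nonzero at [q0]. *)
    suff : `|4 * q0.1.1.1.1|^-1 * X (W q0) = 0.
      move/eqP; rewrite mulf_eq0 invr_eq0 normr_eq0 mulf_eq0 (negPf q00) pnatr_eq0 /=.
      by move/eqP.
    apply: (@cone_test_zero (fun q => `|4 * q.1.1.1.1|^-1 * X (W q))) => //.
      apply: seq_continuous => u uq; apply: cvgM; last exact: Xc.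
      apply: cvgV; first by rewrite normr_eq0 mulf_neq0 ?pnatr_eq0.
      apply: (cvg_comp (fun n => 4 * (u n).1.1.1.1) Num.norm); last exact: norm_continuous.
      apply: cvgM; first exact: cvg_cst.
      have cu : (fun n => coord5 0 (u n)) @ \oo --> coord5 0 q0.
        by apply: (cvg_comp u (coord5 0) uq); exact: continuous_coord5.
      exact: cu.
    move=> n; have E (q : L5 R) : `|4 * q.1.1.1.1|^-1 * X (W q) * gauss n.+1%:R (cone_pt q0)
      (cone_pt q) =
        X (H (fun x => (gauss n.+1%:R (cone_pt q0) x)%:C%C) q).
      by rewrite Hgauss XM -/(W q) mulrAC.
    have [j1 j2] := XH n; split.
      by apply: eq_integrable j1 => // q _; rewrite /= E.
    by rewrite -j2; apply: eq_Rintegral => q _; exact: E.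
  have sg n := HH _ (schwartz_gauss (cone_pt q0) (ltr0Sn R n)).
  apply: complex_eqP.
    apply: wt => [c z|u uq|n].
    - by rewrite ReM /= mul0r subr0.
    - by have [] := Wc _ _ q00 uq.
    - have [[r1 _] /(congr1 (@complex.Re R)) h] := sg n; by split.
  apply: wt => [c z|u uq|n].
  - by rewrite ImM /= mul0r addr0.
  - by have [] := Wc _ _ q00 uq.
  - have [[_ r2] /(congr1 (@complex.Im R)) h] := sg n; by split.
have D1 l' : momentum l' ord0 (lift ord0 ord0) != 0 -> Ds A l' = 0.
  move=> P0; have [q q0 E] := momentum_cone_pt P0.
  have l'0 : momentum l' != 0 by apply: contra P0 => /eqP ->; rewrite mxE.
  by rewrite DsG // -E; exact: W0.
move=> l0; have [P01|] := eqVneq (momentum l ord0 (lift ord0 ord0)) 0; last exact: D1.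
(* Perturb l so that P_01 becomes harmonic n * (s * c) + harmonic n ^+ 2 > 0. *)
pose c := l 0 ord0 + l 1 (lift ord0 ord0).
pose s : R := if 0 <= c then 1 else -1.
have s1 : s * s = 1 by rewrite /s; case: ifP => _; rewrite ?mul1r ?mulrNN ?mul1r.
have sc : 0 <= s * c.
  by rewrite /s; case: ifP => [h|/negbT]; rewrite ?mul1r // -ltNge mulN1r oppr_ge0 => /ltW.
(* On the columns 0 and 1, [m] is the identity, and det (B + e 1) = det B + e tr B + e^2 for a 2 by
   2 block B; [c] is the trace, and the sign [s] makes e tr B nonnegative. *)
pose m : 'M[R]_(2, 4) := \matrix_(i, B) ((i : nat) == B)%:R.
pose u (n : nat) : 'M[R]_(2, 4) := l + (harmonic n * s) *: m.
have Pu n : momentum (u n) ord0 (lift ord0 ord0) != 0.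
  have h0 : (0 : R) < harmonic n by exact: harmonic_gt0.
  have -> : momentum (u n) ord0 (lift ord0 ord0) =
      momentum l ord0 (lift ord0 ord0) + harmonic n * (s * c) + harmonic n ^+ 2 * (s * s).
    by rewrite /c !mxE /=; ring.
  by rewrite P01 s1 add0r mulr1 gt_eqF // ltr_wpDl ?exprn_gt0 // mulr_ge0 // ltW.
have uc : u @ \oo --> l.
  apply: cvgn_mx => i B; rewrite -[X in _ --> X](addr0 (l i B)) -(mul0r (s * m i B)).
  under eq_fun do rewrite /u mxE [X in _ + X]mxE -mulrA.
  by apply: cvgD; [exact: cvg_cst|apply: cvgM; [exact: cvg_harmonic|exact: cvg_cst]].
have [d1 d2] := Dsc u l l0 uc.
have z (X : R[i] -> R) : X 0 = 0 -> (fun n => X (Ds A (u n))) @ \oo --> X (Ds A l) -> X (Ds A l) =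
  0.
  move=> X0 d; have : (fun n => X (Ds A (u n))) @ \oo --> (0 : R).
    rewrite (_ : (fun n => _) = fun=> 0); first exact: cvg_cst.
    by apply/funext => n; rewrite D1.
  by move=> d'; rewrite -(cvg_lim _ d) // (cvg_lim _ d').
by apply: complex_eqP; apply: z.
Qed.

End Uniqueness.

(** * The dual spinor and the affine chart of the projective line *)

Section Chart.
Context {R : realType}.

(** At u = (1, t), lhat(u) and 2 l^1 have the same skew product with the line spinor. They thus
    differ by a multiple of it, which pairs to 0 with omega on the hyperplane of integration. *)
Lemma int_RP1_ftilde k (f : 'rV[R]_4 * 'rV[R]_4 -> R[i]) (l : 'M[R]_(2, 4))
    (lhat : 'rV[R]_2 -> 'rV[R]_4) (a : k.-tuple 'I_2) : momentum l != 0 ->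
  (forall u : 'rV[R]_2, u != 0 -> skew_prod (u *m l) (lhat u) = momentum l) ->
  int_RP1 (fun u : 'rV[R]_2 => (\prod_(i < k) u ord0 (tnth a i))%:C%C *
    int_delta (u *m l) (fun w : 'rV[R]_4 =>
      f (w, u *m l) * expi (- \sum_(A < 4) lhat u ord0 A * w ord0 A))) = ftilde f l a.
Proof.
move=> l0 hl; apply: eq_cintegral => t; rewrite /line_integrand; set u := \row_a _.
have E0 : u ord0 0 = 1 by rewrite mxE.
have E1 : u ord0 1 = t by rewrite mxE.
have u0 : u != 0.
  by apply/eqP => /rowP/(_ 0); rewrite E0 mxE => /eqP; rewrite oner_eq0.
have ul : u *m l = line_spinor l t.
  by apply/rowP => A; rewrite !mxE sumI2 E0 E1 mul1r.
congr (_%:C%C * _).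
  apply: eq_bigr => i _; have [->|->] : tnth a i = 0 \/ tnth a i = 1.
  - by case: (tnth a i) => [[|[|//]] ?]; [left|right]; exact/val_inj.
  - by rewrite E0 eqxx (_ : (0 == 1 :> 'I_2) = false) // mulr0 addr0.
  - by rewrite E1 eqxx (_ : (1 == 0 :> 'I_2) = false) // mulr1 add0r.
have := hl u u0; rewrite ul => hu; have [j lj] := rV_neq0_ex (line_spinor_neq0 t l0).
apply: int_delta_ext => w wl; rewrite /hyp_integrand /hyp_phase; congr (_ * expi (- _)).
rewrite mulr_sumr; apply/eqP; rewrite -subr_eq0 -sumrB; apply/eqP.
pose m (A : 'I_4) := lhat u ord0 A - 2 * l 1 A.
(* A vector whose skew product with a nonzero spinor vanishes is a multiple of it; the factor is
   read off at a nonzero component [j]. *)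
have mE A : m A = m j / line_spinor l t ord0 j * line_spinor l t ord0 A.
  have h : line_spinor l t ord0 j * m A = line_spinor l t ord0 A * m j.
    have := congr1 (fun X : 'M[R]_4 => 2 * X j A) hu; rewrite [skew_prod _ _ _ _]mxE.
    rewrite mulrA mulfV ?mul1r ?pnatr_eq0 // /m !mxE => hh.
    have : 2 * (l 0 j * l 1 A - l 1 j * l 0 A) =
      2 * ((l 0 j + t * l 1 j) * l 1 A - l 1 j * (l 0 A + t * l 1 A)) by ring.
    move: hh; lra.
  by apply: (mulfI lj); rewrite h; field.
rewrite (eq_bigr (fun A => m j / line_spinor l t ord0 j * (w ord0 A * line_spinor l t ord0 A)));
  last first.
  move=> A _; rewrite [row _ _ _ _]mxE mulrA -mulrBl -/(m A) mE; ring.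
by rewrite -mulr_sumr wl mulr0.
Qed.

End Chart.

Theorem proposition6p3 (R : realType) (k : nat)
    (f : 'rV[R]_4 * 'rV[R]_4 -> R[i])
    (f_smooth : smooth_on_cone f)
    (f_homog : homogeneous_on_cone (- (k + 4)%N%:Z) f) :
  (exists Ft : 'M[R]_(2, 4) -> k.-tuple 'I_2 -> R[i],
     is_cone_fourier (@twistor_field R k f) Ft) /\
  forall Ft : 'M[R]_(2, 4) -> k.-tuple 'I_2 -> R[i],
    is_cone_fourier (@twistor_field R k f) Ft ->
  forall l : 'M[R]_(2, 4), momentum l != 0 ->
  forall lhat : 'rV[R]_2 -> 'rV[R]_4,
    (forall u : 'rV[R]_2, u != 0 -> skew_prod (u *m l) (lhat u) = momentum l) ->
  forall a : k.-tuple 'I_2,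
    Ft l a =
    int_RP1 (fun u : 'rV[R]_2 =>
      (\prod_(i < k) u ord0 (tnth a i))%:C%C *
      int_delta (u *m l) (fun w : 'rV[R]_4 =>
        f (w, u *m l) * expi (- \sum_(A < 4) lhat u ord0 A * w ord0 A))).
Proof.
have ex := ftilde_is_cone_fourier f_smooth f_homog.
split; first by exists (ftilde f).
move=> Ft HFt l l0 lhat hl a.
by rewrite int_RP1_ftilde //; exact: (cone_fourier_unique HFt ex).
Qed.
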